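(* Let $F$ be a finite graph and $\epsilon>0$. Then the map $W\mapsto\mathsf{til}_\epsilon(F,W)$ is continuous on the space of graphons on $\Omega$ equipped with the cut-norm; that is, whenever graphons $W_n$ satisfy $\|W_n-W\|_\square\to0$, we have $\mathsf{til}_\epsilon(F,W_n)\to\mathsf{til}_\epsilon(F,W)$.
   Context: $(\Omega,\nu)$ is an atomless Borel probability space; a graphon is a symmetric measurable $W:\Omega^2\to[0,1]$. The cut-norm is $\|V\|_\square=\sup_{A,B\subset\Omega}|\int_{A\times B}V|$. Let $F$ have vertex set $[k]$; $W^{\otimes F}(x_1,\dots,x_k)=\prod_{ij\in E(F),i<j}W(x_i,x_j)$, $\mathcal{F}_F(W)=\{W^{\otimes F}\neq0\}$. An $F$-tiling in $W$ is a measurable $\mathfrak{t}:\Omega^k\to[0,\infty)$ with $\{\mathfrak{t}\neq0\}\subset\mathcal{F}_F(W)$ such that for each $x\in\Omega$, $\sum_{\ell=1}^k\int\mathfrak{t}(x_1,\dots,x_{\ell-1},x,x_{\ell+1},\dots,x_k)\,\mathrm{d}\nu^{k-1}\le1$ (integrating over all coordinates except the $\ell$-th); its size is $\int\mathfrak{t}\,\mathrm{d}\nu^k$, and $\mathsf{til}(F,W)$ is the supremum of sizes. The robust tiling number is $\mathsf{til}_\epsilon(F,W)=\inf_U\mathsf{til}(F,W-U)$, the infimum over all graphons $U$ with $U\le W$ and $\|U\|_{\mathcal{L}^1(\Omega^2)}\le\epsilon$. *)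

(* Defs.v *)
From HB Require Import structures.
From mathcomp Require Import all_boot all_order all_algebra.
From mathcomp Require Import all_classical all_reals all_analysis.
Set Implicit Arguments.
Unset Strict Implicit.
Unset Printing Implicit Defensive.
Import Order.TTheory GRing.Theory Num.Theory.
Local Open Scope classical_set_scope.
Local Open Scope ring_scope.

Section Defs.
Context (d : measure_display) (Omega : measurableType d) (R : realType).

Definition metric_open (dist : Omega -> Omega -> R) (A : set Omega) : Prop :=
  forall x, A x -> exists2 r : R, 0 < r & [set y | dist x y < r] `<=` A.

Definition is_polish_metric (dist : Omega -> Omega -> R) : Prop :=
  [/\ (forall x y, 0 <= dist x y) /\
      (forall x y, dist x y = 0 <-> x = y),
      (forall x y, dist x y = dist y x),
      (forall x y z, dist x z <= dist x y + dist y z),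
      (forall u : nat -> Omega,
          (forall e : R, 0 < e -> exists N, forall m n, (N <= m)%N -> (N <= n)%N ->
              dist (u m) (u n) < e) ->
          exists l, forall e : R, 0 < e -> exists N, forall n, (N <= n)%N ->
              dist (u n) l < e) &
      exists s : nat -> Omega, forall x (e : R), 0 < e -> exists n, dist x (s n) < e].

Definition standard_borel : Prop :=
  exists dist : Omega -> Omega -> R, is_polish_metric dist /\
    (@measurable d Omega) = <<s [set A | metric_open dist A] >>.

Definition atomless (nu : set Omega -> \bar R) : Prop :=
  forall A, measurable A -> (0 < nu A)%E ->
    exists2 B, measurable B /\ B `<=` A & (0 < nu B)%E /\ (nu B < nu A)%E.

Definition graphon (W : Omega -> Omega -> R) : Prop :=
  [/\ (forall x y, W x y = W y x),
      (forall x y, 0 <= W x y <= 1) &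
      measurable_fun [set: Omega * Omega] (fun z => W z.1 z.2)].

Variable nu : probability Omega R.

Definition cutnorm (V : Omega -> Omega -> R) : \bar R :=
  ereal_sup [set `| \int[(nu \x nu)%E]_(z in AB.1 `*` AB.2) (V z.1 z.2)%:E |%E
            | AB in [set AB : set Omega * set Omega | measurable AB.1 /\ measurable AB.2]
            ] .

Definition L1norm (V : Omega -> Omega -> R) : \bar R :=
  \int[(nu \x nu)%E]_z (`| V z.1 z.2 |)%:E.

(** ** Integration over Omega^k, realised as iterated integration with
    respect to nu (for nonnegative measurable functions this is the integral
    against the product measure nu^k, by Tonelli).  [iint s f y] integrates
    [f] over the coordinates listed in [s], the other coordinates being
    taken from [y]. *)
Variable k : nat.

Definition upd (y : 'I_k -> Omega) (i : 'I_k) (x : Omega) : 'I_k -> Omega :=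
  fun j => if j == i then x else y j.

Fixpoint iint (s : seq 'I_k) (f : ('I_k -> Omega) -> \bar R)
    (y : 'I_k -> Omega) : \bar R :=
  match s with
  | [::] => f y
  | i :: s' => (\int[nu]_x iint s' f (upd y i x))%E
  end.

Definition Wtensor (adj : rel 'I_k) (W : Omega -> Omega -> R)
    (x : 'I_k -> Omega) : R :=
  \prod_(i < k) \prod_(j < k | (i < j)%N && adj i j) W (x i) (x j).

Definition tiling (adj : rel 'I_k) (W : Omega -> Omega -> R)
    (t : ('I_k -> Omega) -> R) : Prop :=
  [/\ measurable_fun [set: k.-tuple Omega] (fun u => t (tnth u)),
      (forall x, 0 <= t x),
      (forall x, t x != 0 -> Wtensor adj W x != 0) &
      (forall x : Omega,
         (\sum_(l < k) iint (enum (predC1 l)) (fun y => (t y)%:E)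
                            (upd (fun _ => point) l x) <= 1)%E)].

Definition tiling_size (t : ('I_k -> Omega) -> R) : \bar R :=
  iint (enum 'I_k) (fun y => (t y)%:E) (fun _ => point).

Definition til (adj : rel 'I_k) (W : Omega -> Omega -> R) : \bar R :=
  ereal_sup [set tiling_size t | t in tiling adj W].

Definition til_eps (eps : R) (adj : rel 'I_k) (W : Omega -> Omega -> R)
    : \bar R :=
  ereal_inf [set til adj (fun x y => W x y - U x y)
            | U in [set U | graphon U /\ (forall x y, U x y <= W x y)
                            /\ (L1norm U <= eps%:E)%E]].

End Defs.

(* Main.v *)
Require Import Defs.
From HB Require Import structures.
From mathcomp Require Import all_boot all_order all_algebra.
From mathcomp Require Import all_classical all_reals all_analysis.
From mathcomp Require Import measurable_realfun ring lra.
Import Order.TTheory GRing.Theory Num.Theory.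
Import numFieldNormedType.Exports.
Local Open Scope classical_set_scope.
Local Open Scope ring_scope.

Set Implicit Arguments.
Unset Strict Implicit.
Unset Printing Implicit Defensive.

(** * Integration of bounded measurable functions *)

(** The two semicontinuities are proved separately. Both use that [til] depends only on where a
    kernel is nonzero ([eq_le_til]), and that a small overrun of the budget [eps] is cheap
    ([slack]): cut Omega into N+1 parts of equal measure and reset U to zero on all pairs meeting a
    part where U is heaviest. The norm of U drops by about eps/(N+1), while a tiling loses at most
    1/(N+1) by giving up the vertices of that part.

    Upper semicontinuity ([til_eps_upper]): take U' nearly optimal for W, with norm strictly below
    eps, and delete from Wn the same fraction of each edge, Un = Wn * (U'/W). Then Wn - Un vanishes
    wherever W - U' does, so its tiling number is no larger. The norm of Un tends to that of U',
    because the ratio U'/W is close in L1 to a step function and the cut norm controls integrals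
    against step functions.

    Lower semicontinuity ([til_eps_lower]): if it fails for infinitely many n, choose good Un for
    these n and put Vn = Wn - Un. A cut-norm compactness argument along an ultrafilter produces a
    limit kernel. Each Vn is regularised by successive refinements of a labelling of Omega by finite
    sets that do not depend on n; part masses and block densities then have limits, atomlessness
    realises the limit masses by labellings of Omega itself, and bounded energy makes the resulting
    step kernels converge in L1 to a kernel [lim_kernel], written Vh below. Two things are needed of
    Vh.

    First, Vh must be comparable with W. The labelling starts from one on which W is almost a step
    function, so the limit keeps its position relative to W: Vh is almost below W, and W - min(Vh,
    W) has norm at most eps plus a small error ([E2_residual]).

    Second, tilings of Vh must pass to Vn ([til_lim_kernel_near]). Averaging a bounded tiling over
    blocks gives a weight for each pattern of k labels ([gamma]), and multiplying the F-density of
    Vn by this weight gives a candidate tiling of Vn ([transferred]). The counting lemmas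
    [counting_cut] and [counting_L1] show that its size is right and that its vertex loads are right
    on average; deleting the few overloaded vertices and rescaling makes it a tiling
    ([til_transferred]).

    Hence til(Vh) is at most the tiling numbers of the Vn up to any small error, so min(Vh, W) has
    too small a tiling number, and [slack] turns this into a contradiction with the value of
    [til_eps] at W. *)

Section BoundedMeasurable.
Context (d : measure_display) (X : measurableType d) (R : realType).
Implicit Types f g : X -> R.

(** On a probability space these functions are integrable with finite integral, so the rules for
    [Ex] below hold in the reals without further side conditions. *)
Definition bm f := measurable_fun [set: X] f /\ exists M, forall x, `|f x| <= M.

Lemma bm_cst (c : R) : bm (fun=> c).
Proof. by split; [exact: measurable_cst | exists `|c|]. Qed.

Lemma bmD f g : bm f -> bm g -> bm (fun x => f x + g x).
Proof.
move=> [mf [M fM]] [mg [N gN]]; split; first exact: measurable_funD.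
by exists (M + N) => x; rewrite (le_trans (ler_normD _ _))// lerD.
Qed.

Lemma bmN f : bm f -> bm (fun x => - f x).
Proof.
move=> [mf [M fM]]; split; first exact: measurableT_comp.
by exists M => x; rewrite normrN.
Qed.

Lemma bmB f g : bm f -> bm g -> bm (fun x => f x - g x).
Proof. by move=> bf bg; apply: bmD => //; exact: bmN. Qed.

Lemma bmM f g : bm f -> bm g -> bm (fun x => f x * g x).
Proof.
move=> [mf [M fM]] [mg [N gN]]; split; first exact: measurable_funM.
by exists (M * N) => x; rewrite normrM ler_pM.
Qed.

Lemma bmZ (c : R) f : bm f -> bm (fun x => c * f x).
Proof. by move=> bf; apply: bmM => //; exact: bm_cst. Qed.

Lemma bm_norm f : bm f -> bm (fun x => `|f x|).
Proof.
move=> [mf [M fM]]; split; first exact: measurableT_comp.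
by exists M => x; rewrite normr_id.
Qed.

Lemma bm_max f g : bm f -> bm g -> bm (fun x => Num.max (f x) (g x)).
Proof.
move=> bf bg.
have -> : (fun x => Num.max (f x) (g x)) =
    (fun x => 2^-1 * (f x + g x + `|f x - g x|)).
  by apply/funext => x; rewrite maxr_absE mulrC.
by apply: bmZ; apply: bmD; [exact: bmD | apply: bm_norm; exact: bmB].
Qed.

Lemma bm_min f g : bm f -> bm g -> bm (fun x => Num.min (f x) (g x)).
Proof.
move=> bf bg.
have -> : (fun x => Num.min (f x) (g x)) =
    (fun x => 2^-1 * (f x + g x - `|f x - g x|)).
  by apply/funext => x; rewrite minr_absE mulrC.
by apply: bmZ; apply: bmB; [exact: bmD | apply: bm_norm; exact: bmB].
Qed.

Lemma bm_sum (I : Type) (s : seq I) (P : pred I) (F : I -> X -> R) :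
  (forall i, bm (F i)) -> bm (fun x => \sum_(i <- s | P i) F i x).
Proof.
move=> bF; elim: s => [|i s IH].
  by under eq_fun do rewrite big_nil; exact: bm_cst.
under eq_fun do rewrite big_cons.
by case: (P i) => //; apply: bmD.
Qed.

Lemma bm_prod (I : Type) (s : seq I) (P : pred I) (F : I -> X -> R) :
  (forall i, bm (F i)) -> bm (fun x => \prod_(i <- s | P i) F i x).
Proof.
move=> bF; elim: s => [|i s IH].
  by under eq_fun do rewrite big_nil; exact: bm_cst.
under eq_fun do rewrite big_cons.
by case: (P i) => //; apply: bmM.
Qed.

Lemma bm_ind (b : X -> bool) : measurable [set x | b x] -> bm (fun x => (b x)%:R).
Proof.
move=> mb; split; last by exists 1 => x; case: (b x); rewrite ?normr1 ?normr0.
rewrite (_ : (fun _ => _) = \1_[set x | b x]); first exact: measurable_indic.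
apply/funext => x; rewrite indicE (_ : (x \in _) = b x)//.
by apply/idP/idP => [/set_mem//|bx]; exact: mem_set.
Qed.

Lemma measurable_pred_ge f (c : R) : bm f -> measurable [set x | (c <= f x)%R].
Proof.
move=> [mf _]; rewrite -[X in measurable X]setTI.
rewrite (_ : [set x | (c <= f x)%R] = f @^-1` `[c, +oo[).
  by apply: mf => //; exact: measurable_itv.
by apply/seteqP; split => x /=; rewrite in_itv/= andbT.
Qed.

Lemma bm_ge f (c : R) : bm f -> bm (fun x => (c <= f x)%R%:R).
Proof. by move=> bf; apply: bm_ind; exact: measurable_pred_ge. Qed.

End BoundedMeasurable.
Arguments bm_cst {d X R} c.

Lemma bm_comp (d d' : measure_display) (X : measurableType d)
    (Y : measurableType d') (R : realType) (f : Y -> R) (g : X -> Y) :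
  bm f -> measurable_fun setT g -> bm (fun x => f (g x)).
Proof.
move=> [mf [M fM]] mg; split; last by exists M.
exact: (measurableT_comp mf mg).
Qed.

Section Expectation.
Context (d : measure_display) (X : measurableType d) (R : realType).
Variable P : probability X R.
Implicit Types f g : X -> R.

Definition Ex f : R := fine (\int[P]_x (f x)%:E)%E.

Lemma bm_integrable f : bm f -> P.-integrable setT (EFin \o f).
Proof.
move=> [mf [M fM]]; apply: (@le_integrable _ _ _ _ _ measurableT _ (EFin \o cst M)) => //.
- exact/measurable_EFinP.
- by move=> x _; rewrite /= lee_fin (le_trans (fM x))// ler_norm.
- apply/integrableP; split; first exact/measurable_EFinP.
  rewrite (eq_integral (cst `|M|%:E))// integral_cst//= probability_setT mule1.
  exact: ltry.
Qed.

Lemma ExE f : bm f -> (\int[P]_x (f x)%:E)%E = (Ex f)%:E.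
Proof.
by move=> bf; rewrite /Ex fineK//; apply: integrable_fin_num => //; exact: bm_integrable.
Qed.

Lemma ExD f g : bm f -> bm g -> Ex (fun x => f x + g x) = Ex f + Ex g.
Proof. by move=> bf bg; apply: RintegralD => //; exact: bm_integrable. Qed.

Lemma ExB f g : bm f -> bm g -> Ex (fun x => f x - g x) = Ex f - Ex g.
Proof. by move=> bf bg; apply: RintegralB => //; exact: bm_integrable. Qed.

Lemma ExZ c f : bm f -> Ex (fun x => c * f x) = c * Ex f.
Proof. by move=> bf; apply: RintegralZl => //; exact: bm_integrable. Qed.

Lemma ExZr c f : bm f -> Ex (fun x => f x * c) = Ex f * c.
Proof. by move=> bf; apply: RintegralZr => //; exact: bm_integrable. Qed.

Lemma Ex_cst c : Ex (fun=> c) = c.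
Proof. by rewrite /Ex integral_cst//= probability_setT mule1. Qed.

Lemma Ex_le f g : bm f -> bm g -> (forall x, f x <= g x) -> Ex f <= Ex g.
Proof. by move=> bf bg fg; apply: le_Rintegral => //; exact: bm_integrable. Qed.

Lemma Ex_ge0 f : (forall x, 0 <= f x) -> 0 <= Ex f.
Proof. by move=> f0; apply: Rintegral_ge0 => x _. Qed.

Lemma Ex_norm f : bm f -> `|Ex f| <= Ex (fun x => `|f x|).
Proof. by move=> bf; apply: le_normr_Rintegral => //; exact: bm_integrable. Qed.

Lemma Ex_le1 f : bm f -> (forall x, f x <= 1) -> Ex f <= 1.
Proof. by move=> bf f1; rewrite -[leRHS]Ex_cst; apply: Ex_le => //; exact: bm_cst. Qed.

Lemma Ex_sum (I : Type) (s : seq I) (Q : pred I) (F : I -> X -> R) :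
  (forall i, bm (F i)) ->
  Ex (fun x => \sum_(i <- s | Q i) F i x) = \sum_(i <- s | Q i) Ex (F i).
Proof.
move=> bF; elim: s => [|i s IH].
  by rewrite big_nil -[RHS]Ex_cst; congr Ex; apply/funext => x; rewrite big_nil.
rewrite big_cons -IH; under [in LHS]eq_fun do rewrite big_cons.
by case: (Q i) => //; rewrite ExD//; exact: bm_sum.
Qed.

Lemma Ex_prob (b : X -> bool) : measurable [set x | b x] ->
  P [set x | b x] = (Ex (fun x => (b x)%:R))%:E.
Proof.
move=> mb; rewrite -ExE; last exact: bm_ind.
rewrite -[P _](_ : \int[P]_x (\1_[set x | b x] x)%:E = _)%E; last first.
  by rewrite integral_indic// setIT.
apply: eq_integral => x _; rewrite indicE (_ : (x \in _) = b x)//.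
by apply/idP/idP => [/set_mem//|bx]; exact: mem_set.
Qed.

End Expectation.

Section Fubini.
Context (d : measure_display) (X : measurableType d) (R : realType).
Context (d' : measure_display) (Y : measurableType d').
Variable P : probability X R.

Lemma bm_Ex (f : Y * X -> R) : bm f -> bm (fun y => Ex P (fun x => f (y, x))).
Proof.
move=> bf; have [mf [M fM]] := bf.
have b1 y : bm (fun x => f (y, x)) by apply: bm_comp bf _.
split; last first.
  exists M => y; rewrite (le_trans (Ex_norm _ (b1 y)))//.
  rewrite -[leRHS](Ex_cst P); apply: Ex_le => //; [exact: bm_norm | exact: bm_cst].
(* Tonelli is stated for nonnegative functions; adding the bound M makes [f] nonnegative and is
   undone after integration. *)
have b2 : bm (fun z => f z + M) by apply: bmD => //; exact: bm_cst.
have -> : (fun y => Ex P (fun x => f (y, x))) =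
   (fun y => fine (\int[P]_x ((f (y, x) + M)%:E))%E - M).
  apply/funext => y; rewrite -/(Ex P (fun x => f (y, x) + M)) ExD ?Ex_cst ?addrK//.
  exact: bm_cst.
apply: measurable_funB => //; apply: measurableT_comp => //.
apply: (@measurable_fun_fubini_tonelli_F _ _ _ _ _ P (fun z => (f z + M)%:E)).
  by apply/measurable_EFinP; case: b2.
by move=> z; rewrite lee_fin -lerBlDr sub0r (le_trans _ (lerNnormlW (fM z)))//.
Qed.

End Fubini.

Section Fubini2.
Context (d : measure_display) (X : measurableType d) (R : realType).
Context (d' : measure_display) (Y : measurableType d').
Variables (P : probability X R) (Q : probability Y R).

Lemma Ex_prodE (f : Y * X -> R) : bm f ->
  (\int[(Q \x P)%E]_z (f z)%:E)%E = (Ex Q (fun y => Ex P (fun x => f (y, x))))%:E.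
Proof.
move=> bf; have [mf [M fM]] := bf.
have b1 y : bm (fun x => f (y, x)) by apply: bm_comp bf _.
have If : (Q \x P)%E.-integrable setT (EFin \o f).
  apply/integrable12ltyP; first exact/measurable_EFinP.
  apply: (@le_lt_trans _ _ (\int[Q]_y (M%:E))%E); last first.
    by rewrite integral_cst//= probability_setT mule1 ltry.
  have aE y : (\int[P]_x `|(EFin \o f) (y, x)|)%E = (Ex P (fun x => `|f (y, x)|))%:E.
    by rewrite -ExE//; exact: bm_norm.
  under eq_integral do rewrite aE.
  apply: ge0_le_integral => //.
  - by move=> y _; rewrite lee_fin; apply: Ex_ge0.
  - by apply/measurable_EFinP; case: (bm_Ex P (bm_norm bf)).
  - move=> y _; rewrite lee_fin -[leRHS](Ex_cst P); apply: Ex_le => //.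
      exact: bm_norm.
    exact: bm_cst.
rewrite -integral12_prod_meas1// /fubini_F -ExE; last exact: (bm_Ex P bf).
by apply: eq_integral => y _; rewrite -ExE.
Qed.

Lemma Ex_swap (f : Y * X -> R) : bm f ->
  Ex Q (fun y => Ex P (fun x => f (y, x))) = Ex P (fun x => Ex Q (fun y => f (y, x))).
Proof.
move=> bf; have [mf [M fM]] := bf.
have b1 y : bm (fun x => f (y, x)) by apply: bm_comp bf _.
have b2 x : bm (fun y => f (y, x)) by apply: bm_comp bf _.
pose g z := f z + M.
have bg : bm g by apply: bmD => //; exact: bm_cst.
have g0 z : 0 <= g z.
  by rewrite /g -lerBlDr sub0r (le_trans _ (lerNnormlW (fM z))).
have bgs : bm (fun z : X * Y => g (z.2, z.1)).
  by apply: bm_comp bg _; apply: measurable_fun_pair.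
have := @fubini_tonelli _ _ _ _ _ Q P (fun z => (g z)%:E).
have E1 : (\int[Q]_y \int[P]_x (g (y, x))%:E)%E = (Ex Q (fun y => Ex P (fun x => g (y, x))))%:E.
  rewrite -ExE; last exact: (bm_Ex P bg).
  by apply: eq_integral => y _; rewrite -ExE//; apply: bm_comp bg _.
have E2 : (\int[P]_x \int[Q]_y (g (y, x))%:E)%E = (Ex P (fun x => Ex Q (fun y => g (y, x))))%:E.
  rewrite -ExE; last exact: (bm_Ex Q bgs).
  by apply: eq_integral => x _; rewrite -ExE//; apply: bm_comp bg _.
rewrite E1 E2 => H0; have H mg hg := EFin_inj (H0 mg hg).
have {H} : Ex Q (fun y => Ex P (fun x => g (y, x))) = Ex P (fun x => Ex Q (fun y => g (y, x))).
  by apply: H => //; apply/measurable_EFinP; case: bg.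
have -> : (fun y => Ex P (fun x => g (y, x))) = (fun y => Ex P (fun x => f (y, x)) + M).
  by apply/funext => y; rewrite ExD ?Ex_cst//; exact: bm_cst.
have -> : (fun x => Ex Q (fun y => g (y, x))) = (fun x => Ex Q (fun y => f (y, x)) + M).
  by apply/funext => x; rewrite ExD ?Ex_cst//; exact: bm_cst.
have bs : bm (fun z : X * Y => f (z.2, z.1)).
  by apply: bm_comp bf _; apply: measurable_fun_pair.
have bQ := bm_Ex Q bs; have bP := bm_Ex P bf.
by rewrite (ExD P bQ (bm_cst _)) (ExD Q bP (bm_cst _)) !Ex_cst; move/addIr.
Qed.

End Fubini2.

(** * Iterated integrals over k coordinates *)

Section Coordinates.
Context (d : measure_display) (Omega : measurableType d) (R : realType).
Variable nu : probability Omega R.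
Variable k : nat.
Local Notation pts := ('I_k -> Omega).
Implicit Types f g : pts -> R.

(** Measurability is expressed through k-tuples, which carry the product sigma-algebra, while the
    functions themselves take points of type ['I_k -> Omega]. *)
Definition kbm f := bm (fun u : k.-tuple Omega => f (tnth u)).

Lemma kbm_comp (d' : measure_display) (Y : measurableType d') f (phi : Y -> pts) :
  kbm f -> (forall i, measurable_fun setT (phi^~ i)) -> bm (fun z => f (phi z)).
Proof.
move=> bf mphi.
have -> : (fun z => f (phi z)) = (fun z => f (tnth [tuple phi z i | i < k])).
  by apply/funext => z; congr f; apply/funext => i; rewrite tnth_mktuple.
apply: (bm_comp (g := fun z => [tuple phi z i | i < k]) bf).
apply/measurable_fun_tnthP => i.
by rewrite (_ : _ \o _ = phi^~ i)//; apply/funext => z; rewrite /= tnth_mktuple.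
Qed.

Lemma kbm_coord (f : Omega -> R) l : bm f -> kbm (fun x => f (x l)).
Proof. by move=> bf; apply: (bm_comp bf); exact: measurable_tnth. Qed.

Lemma kbm_coord2 (f : Omega * Omega -> R) l m : bm f -> kbm (fun x => f (x l, x m)).
Proof.
move=> bf; apply: (bm_comp (g := fun u : k.-tuple Omega => (tnth u l, tnth u m)) bf).
by apply: measurable_fun_pair; exact: measurable_tnth.
Qed.

Definition int_coord (i : 'I_k) f : pts -> R := fun y => Ex nu (fun x => f (upd y i x)).

Lemma kbm_upd f y i : kbm f -> bm (fun x => f (upd y i x)).
Proof.
move=> bf; apply: (kbm_comp (phi := fun x => upd y i x) bf) => j.
by rewrite /upd; case: (j == i); [exact: measurable_id | exact: measurable_cst].
Qed.

Lemma bm_upd2 f y i j : kbm f ->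
  bm (fun z : Omega * Omega => f (upd (upd y i z.1) j z.2)).
Proof.
move=> bf; apply: (kbm_comp (phi := fun z => upd (upd y i z.1) j z.2) bf) => l.
rewrite /upd; case: (l == j); first exact: measurable_snd.
by case: (l == i); [exact: measurable_fst | exact: measurable_cst].
Qed.

Lemma kbm_int_coord f i : kbm f -> kbm (int_coord i f).
Proof.
move=> bf.
apply: (@bm_Ex _ _ _ _ _ nu (fun z : k.-tuple Omega * Omega => f (upd (tnth z.1) i z.2))).
apply: (kbm_comp (phi := fun z : k.-tuple Omega * Omega => upd (tnth z.1) i z.2) bf) => l.
rewrite /upd; case: (l == i); first exact: measurable_snd.
apply: (measurableT_comp (f := fun u : k.-tuple Omega => tnth u l)) => //.
exact: measurable_tnth.
Qed.

Lemma upd_upd y i x x' : upd (upd y i x) i x' = upd y i x' :> pts.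
Proof. by apply/funext => l; rewrite /upd; case: eqP. Qed.

Lemma updC y i j x x' : i != j ->
  upd (upd y i x) j x' = upd (upd y j x') i x :> pts.
Proof.
move=> ij; apply/funext => l; rewrite /upd.
by case: (eqVneq l j) => // ->; rewrite eq_sym (negbTE ij).
Qed.

Lemma int_coordC f i j : kbm f -> int_coord i (int_coord j f) = int_coord j (int_coord i f).
Proof.
move=> bf; have [->//|ij] := eqVneq i j.
apply/funext => y; rewrite /int_coord.
have := @Ex_swap _ _ _ _ _ nu nu (fun z => f (upd (upd y i z.1) j z.2)) (bm_upd2 y i j bf).
move=> /= ->.
by congr Ex; apply/funext => x; congr Ex; apply/funext => x'; rewrite updC.
Qed.

Definition rint (s : seq 'I_k) f : pts -> R := foldr int_coord f s.

Lemma kbm_rint s f : kbm f -> kbm (rint s f).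
Proof. by move=> bf; elim: s => //= i s; exact: kbm_int_coord. Qed.

Lemma rint_int_coord s i f : kbm f -> rint s (int_coord i f) = int_coord i (rint s f).
Proof.
by move=> bf; elim: s => //= j s ->; rewrite int_coordC//; exact: kbm_rint.
Qed.

(** Fubini: any order of integration gives the same value, so chosen coordinates may be moved to the
    outermost or the innermost place. The last index of the list is integrated innermost. *)
Lemma rint_perm s s' f : kbm f -> perm_eq s s' -> rint s f = rint s' f.
Proof.
move=> bf; elim: s s' => [|i s IH] s' ss'.
  by move: ss'; rewrite perm_sym => /perm_nilP ->.
have is' : i \in s' by rewrite -(perm_mem ss') mem_head.
case/splitPr: is' ss' => s1 s2 ss'.
have {}ss' : perm_eq s (s1 ++ s2).
  by move: ss'; rewrite -[i :: s2]cat1s perm_sym perm_catCA /= perm_cons perm_sym.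
rewrite /= (IH _ ss') /rint !foldr_cat -/(rint s1 _) -/(rint s1 _) -/(rint s2 _) /=.
by rewrite -/(rint s2 f) rint_int_coord//; exact: kbm_rint.
Qed.

Lemma rint_ge0 s f : (forall x, 0 <= f x) -> forall y, 0 <= rint s f y.
Proof. by move=> f0; elim: s => //= i s IH y; apply: Ex_ge0. Qed.

Lemma rint_cst s c y : rint s (fun=> c) y = c.
Proof.
elim: s y => //= i s IH y; rewrite -[RHS](Ex_cst nu); congr Ex; exact/funext.
Qed.

Lemma rint_le s f g : kbm f -> kbm g -> (forall x, f x <= g x) ->
  forall y, rint s f y <= rint s g y.
Proof.
move=> bf bg fg; elim: s => //= i s IH y.
by apply: Ex_le => //; apply: kbm_upd; exact: kbm_rint.
Qed.

Lemma rintD s f g : kbm f -> kbm g ->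
  rint s (fun x => f x + g x) = fun y => rint s f y + rint s g y.
Proof.
move=> bf bg; elim: s => //= i s ->; apply/funext => y; rewrite /int_coord ExD//;
by apply: kbm_upd; exact: kbm_rint.
Qed.

Lemma rintZ s c f : kbm f -> rint s (fun x => c * f x) = fun y => c * rint s f y.
Proof.
move=> bf; elim: s => //= i s ->; apply/funext => y; rewrite /int_coord ExZ//.
by apply: kbm_upd; exact: kbm_rint.
Qed.

Lemma rintB s f g : kbm f -> kbm g ->
  rint s (fun x => f x - g x) = fun y => rint s f y - rint s g y.
Proof.
move=> bf bg; elim: s => //= i s ->; apply/funext => y; rewrite /int_coord ExB//;
by apply: kbm_upd; exact: kbm_rint.
Qed.

Lemma rint_sum s (I : Type) (r : seq I) (Q : pred I) (F : I -> pts -> R) :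
  (forall i, kbm (F i)) ->
  rint s (fun x => \sum_(i <- r | Q i) F i x) = fun y => \sum_(i <- r | Q i) rint s (F i) y.
Proof.
move=> bF; elim: s => //= i s ->; apply/funext => y; rewrite /int_coord Ex_sum//.
by move=> j; apply: kbm_upd; exact: kbm_rint.
Qed.

Definition indep (i : 'I_k) f := forall y x, f (upd y i x) = f y.

Lemma rintM s f g : kbm f -> (forall i, i \in s -> indep i g) ->
  rint s (fun x => g x * f x) = fun y => g y * rint s f y.
Proof.
move=> bf; elim: s => //= i s IH Hg.
rewrite IH; last by move=> j js; apply: Hg; rewrite inE js orbT.
apply/funext => y; rewrite /int_coord -ExZ; last by apply: kbm_upd; exact: kbm_rint.
by congr Ex; apply/funext => x; rewrite Hg ?mem_head.
Qed.

Lemma indep_rint s f i : kbm f -> i \in s -> indep i (rint s f).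
Proof.
move=> bf; elim: s => //= j s IH; rewrite inE => /predU1P[->|/IH H] y x.
  by rewrite /int_coord; congr Ex; apply/funext => z; rewrite upd_upd.
rewrite /int_coord; congr Ex; apply/funext => z.
have [->|ij] := eqVneq i j; first by rewrite upd_upd.
by rewrite updC// H.
Qed.

End Coordinates.

(** * Tilings, their loads, and reduction to bounded tilings *)

Section Tilings.
Context (d : measure_display) (Omega : measurableType d) (R : realType).
Variable nu : probability Omega R.
Variable k : nat.
Local Notation pts := ('I_k -> Omega).
Implicit Types f g t : pts -> R.
Implicit Types W U : Omega -> Omega -> R.

Lemma iint_rint s f y : kbm f -> iint nu s (fun y => (f y)%:E) y = (rint nu s f y)%:E.
Proof.
move=> bf; elim: s y => //= i s IH y.
rewrite /int_coord -ExE; last by apply: kbm_upd; exact: kbm_rint.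
by apply: eq_integral => x _; rewrite IH.
Qed.

(** Monotone convergence, one coordinate at a time. It gives access to the iterated integrals of an
    unbounded tiling through bounded functions. *)
Lemma iint_lim s f (F : nat -> pts -> R) :
  (forall n, kbm (F n)) -> (forall n x, 0 <= F n x) ->
  (forall x, nondecreasing_seq (F^~ x)) ->
  (forall x, F n x @[n --> \oo] --> f x) -> forall y,
  iint nu s (fun y => (f y)%:E) y = limn (fun n => (rint nu s (F n) y)%:E).
Proof.
move=> bF F0 ndF cF; elim: s => [|i s IH] y /=.
  by apply/esym/cvg_lim => //; apply: cvg_EFin; [exact: nearW | exact: cF].
under eq_integral do rewrite IH.
rewrite monotone_convergence//.
- congr (limn _); apply/funext => n; rewrite /int_coord -ExE//.
  by apply: kbm_upd; exact: kbm_rint.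
- move=> n; apply/measurable_EFinP.
  by case: (kbm_upd y i (kbm_rint nu s (bF n))).
- by move=> n x _; rewrite lee_fin; exact: rint_ge0.
- by move=> x _ m n mn; rewrite lee_fin; apply: rint_le => // z; exact: ndF.
Qed.

Definition kint f : R := rint nu (enum 'I_k) f (fun=> point).

Definition marg f (l : 'I_k) (x : Omega) : R :=
  rint nu (enum (predC1 l)) f (upd (fun=> point) l x).

Lemma bm_marg f l : kbm f -> bm (marg f l).
Proof. by move=> bf; apply: kbm_upd; exact: kbm_rint. Qed.

Lemma marg_ge0 f l x : (forall y, 0 <= f y) -> 0 <= marg f l x.
Proof. by move=> f0; apply: rint_ge0. Qed.

Lemma kint_ge0 f : (forall x, 0 <= f x) -> 0 <= kint f.
Proof. by move=> f0; exact: rint_ge0. Qed.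

Lemma kint_cst c : kint (fun=> c) = c.
Proof. exact: rint_cst. Qed.

Lemma kint_le f g : kbm f -> kbm g -> (forall x, f x <= g x) -> kint f <= kint g.
Proof. by move=> bf bg fg; exact: rint_le. Qed.

Lemma kintD f g : kbm f -> kbm g -> kint (fun x => f x + g x) = kint f + kint g.
Proof. by move=> bf bg; rewrite /kint rintD. Qed.

Lemma kintB f g : kbm f -> kbm g -> kint (fun x => f x - g x) = kint f - kint g.
Proof. by move=> bf bg; rewrite /kint rintB. Qed.

Lemma kintZ c f : kbm f -> kint (fun x => c * f x) = c * kint f.
Proof. by move=> bf; rewrite /kint rintZ. Qed.

Lemma kint_sum (J : Type) (r : seq J) (Q : pred J) (F : J -> pts -> R) :
  (forall i, kbm (F i)) ->
  kint (fun x => \sum_(i <- r | Q i) F i x) = \sum_(i <- r | Q i) kint (F i).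
Proof. by move=> bF; rewrite /kint rint_sum. Qed.

Lemma enum_predC1 (l : 'I_k) : perm_eq (enum 'I_k) (l :: enum (predC1 l)).
Proof.
apply: uniq_perm; first exact: enum_uniq.
  by rewrite /= enum_uniq mem_enum !inE eqxx.
by move=> i; rewrite inE !mem_enum !inE; case: eqP.
Qed.

(** Duality between loads and sizes: testing the load of coordinate [l] against [h] is integrating
    [f] against a function of the single coordinate [l]. Vertex constraints are handled throughout
    in this weak form. *)
Lemma Ex_marg (h : Omega -> R) f l : bm h -> kbm f ->
  Ex nu (fun x => h x * marg f l x) = kint (fun y => h (y l) * f y).
Proof.
move=> bh bf; have bhf : kbm (fun y => h (y l) * f y).
  by apply: bmM => //; exact: (kbm_coord l bh).
rewrite /kint (rint_perm nu bhf (enum_predC1 l)) /= /int_coord.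
congr Ex; apply/funext => x; rewrite rintM// /marg /upd ?eqxx//.
move=> i; rewrite mem_enum !inE => il y z.
by rewrite /upd eq_sym (negbTE il).
Qed.

Lemma kint_pair (h : Omega * Omega -> R) l m : l != m -> bm h ->
  kint (fun y => h (y l, y m)) = Ex nu (fun x => Ex nu (fun z => h (x, z))).
Proof.
move=> lm bh; have bf := kbm_coord2 l m bh.
rewrite /kint (rint_perm nu bf (enum_predC1 l)) /= /int_coord.
have E : perm_eq (enum (predC1 l)) (rcons (enum [predD1 predC1 l & m]) m).
  apply: uniq_perm; first exact: enum_uniq.
    by rewrite rcons_uniq enum_uniq mem_enum !inE eqxx.
  move=> i; rewrite mem_rcons inE !mem_enum !inE.
  by case: (eqVneq i m) => [->|]//=; rewrite eq_sym lm.
congr Ex; apply/funext => x.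
rewrite (rint_perm nu bf E) -cats1 /rint foldr_cat /= -/(rint nu _ _).
rewrite (_ : int_coord nu m _ = fun y : pts => Ex nu (fun z => h (y l, z))); last first.
  apply/funext => y; rewrite /int_coord; congr Ex; apply/funext => z.
  by rewrite /upd eqxx (negbTE lm).
have b2 : kbm (fun y : pts => Ex nu (fun z => h (y l, z))).
  by apply: (kbm_coord (f := fun x => Ex nu (fun z => h (x, z)))); exact: bm_Ex.
(* What remains depends on the coordinate [l] alone, so it comes out of the integral of the constant
   1 over the other coordinates. *)
have := @rintM _ _ _ nu k (enum [predD1 predC1 l & m]) (fun=> 1)
  (fun y : pts => Ex nu (fun z => h (y l, z))) (bm_cst 1).
rewrite (_ : (fun x => _ * 1) = (fun y : pts => Ex nu (fun z => h (y l, z)))); last first.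
  by apply/funext => y; rewrite mulr1.
move=> ->; first by rewrite rint_cst mulr1 /upd eqxx.
move=> i; rewrite mem_enum !inE => /andP[_ il] y z; rewrite /upd.
by rewrite eq_sym (negbTE il).
Qed.

Lemma graphon_bm W : graphon W -> bm (fun z => W z.1 z.2).
Proof.
move=> [_ W01 mW]; split => //; exists 1 => z.
by have /andP[W0 W1] := W01 z.1 z.2; rewrite ger0_norm.
Qed.

Lemma graphonB W U : graphon W -> graphon U -> (forall x y, U x y <= W x y) ->
  graphon (fun x y => W x y - U x y).
Proof.
move=> [sW W01 mW] [sU U01 mU] UW; split.
- by move=> x y; rewrite sW sU.
- move=> x y; rewrite subr_ge0 UW /=.
  have /andP[_ W1] := W01 x y; have /andP[U0 _] := U01 x y.
  by rewrite lerBlDr (le_trans W1)// lerDl.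
- exact: measurable_funB.
Qed.

Variable adj : rel 'I_k.

Lemma Wtensor_ge0 W x : graphon W -> 0 <= Wtensor adj W x.
Proof.
move=> [_ W01 _]; apply: prodr_ge0 => i _; apply: prodr_ge0 => j _.
by have /andP[] := W01 (x i) (x j).
Qed.

Lemma Wtensor_le1 W x : graphon W -> Wtensor adj W x <= 1.
Proof.
move=> [_ W01 _]; apply: prodr_ile1 => i _; apply/andP; split.
  by apply: prodr_ge0 => j _; have /andP[] := W01 (x i) (x j).
by apply: prodr_ile1 => j _.
Qed.

Lemma kbm_Wtensor W : graphon W -> kbm (Wtensor adj W).
Proof.
move=> gW; apply: bm_prod => i; apply: bm_prod => j.
exact: (kbm_coord2 i j (graphon_bm gW)).
Qed.

Definition btiling W t := [/\ kbm t, forall x, 0 <= t x,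
  forall x, t x != 0 -> Wtensor adj W x != 0 &
  forall x, \sum_(l < k) marg t l x <= 1].

Lemma btilingP W t : btiling W t -> tiling nu adj W t.
Proof.
move=> [bt t0 tW tm]; split => //; first by case: bt.
move=> x; under eq_bigr do rewrite (iint_rint _ _ bt).
by rewrite sumEFin lee_fin; exact: tm.
Qed.

Lemma tiling_size_kint t : kbm t -> tiling_size nu t = (kint t)%:E.
Proof. by move=> bt; exact: iint_rint. Qed.

Lemma kint_le_til W t : btiling W t -> ((kint t)%:E <= til nu adj W)%E.
Proof.
move=> Bt; rewrite -tiling_size_kint; last by case: Bt.
by apply: ereal_sup_ubound; exists t => //; exact: btilingP.
Qed.

(** To bound [til] it is enough to treat tilings dominated by a multiple of the F-density. The
    truncations min(t, n * W^F) of a tiling t are again tilings, and they increase to t because t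
    vanishes where W^F does; the size of t is the supremum of their sizes. *)
Lemma til_le W (L : \bar R) : graphon W ->
  (forall t C, btiling W t -> (forall x, t x <= C * Wtensor adj W x) -> ((kint t)%:E <= L)%E) ->
  (til nu adj W <= L)%E.
Proof.
move=> gW H; apply: ge_ereal_sup => _ [t [mt t0 tW tm] <-].
pose F n x := Num.min (t x) (n%:R * Wtensor adj W x).
have W0 x : 0 <= Wtensor adj W x by exact: Wtensor_ge0.
have F0 n x : 0 <= F n x by rewrite le_min t0 mulr_ge0.
have bF n : kbm (F n).
  split.
    apply: measurable_minr => //; apply: measurable_funM => //.
    by case: (kbm_Wtensor gW).
  exists n%:R => u; rewrite ger0_norm// ge_min; apply/orP; right.
  by rewrite ler_piMr// Wtensor_le1.
have ndF x : nondecreasing_seq (F^~ x).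
  move=> m n mn; rewrite le_min ge_min lexx /= ge_min; apply/orP; right.
  by rewrite ler_wpM2r// ler_nat.
have cF x : F n x @[n --> \oo] --> t x.
  have [tx0|tx0] := eqVneq (t x) 0.
    rewrite (_ : (fun n => F n x) = cst 0) ?tx0; first exact: cvg_cst.
    by apply/funext => n; rewrite /F tx0 min_l// mulr_ge0.
  have Wp : 0 < Wtensor adj W x by rewrite lt_neqAle eq_sym tW/=.
  apply: (@cvg_near_cst _ _ (t x)).
  near=> n; rewrite /F min_l//.
  rewrite -ler_pdivrMr//; near: n; exact: nbhs_infty_ger.
have limE s y : iint nu s (fun y => (t y)%:E) y =
    ereal_sup (range (fun n => (rint nu s (F n) y)%:E)).
  rewrite (iint_lim s bF F0 ndF cF).
  apply/cvg_lim => //; apply: ereal_nondecreasing_cvgn => m n mn.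
  by rewrite lee_fin; apply: rint_le => // z; exact: ndF.
have BF n : btiling W (F n).
  split => // [x|x].
    apply: contra => /eqP Wx; rewrite /F Wx mulr0 min_r//.
  rewrite -lee_fin -sumEFin; apply: le_trans (tm x).
  apply: lee_sum => l _; rewrite limE; apply: ereal_sup_ubound.
  by exists n.
rewrite /tiling_size limE; apply: ge_ereal_sup => _ [n _ <-].
apply: (H _ n%:R (BF n)) => x.
by rewrite /F ge_min lexx orbT.
Unshelve. all: by end_near. Qed.

End Tilings.

(** * Splitting an atomless space *)

Section Atomless.
Context (d : measure_display) (Omega : measurableType d) (R : realType).
Variable nu : probability Omega R.
Implicit Types A B C : set Omega.

Local Notation m A := (fine (nu A)).

Lemma fprob_fin A : measurable A -> nu A = (m A)%:E.
Proof. by move=> mA; rewrite fineK// fin_num_measure. Qed.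

Lemma fprob_ge0 A : 0 <= m A.
Proof. by apply: fine_ge0. Qed.

Lemma fprobU A B : measurable A -> measurable B -> A `&` B = set0 ->
  m (A `|` B) = m A + m B.
Proof. by move=> mA mB AB; rewrite measureU// fineD// fin_num_measure. Qed.

Lemma fprobD A B : measurable A -> measurable B -> B `<=` A ->
  m (A `\` B) = m A - m B.
Proof.
move=> mA mB BA.
rewrite -{2}(setDUK BA) fprobU//; last exact: setDIK.
  by rewrite addrAC subrr add0r.
exact: measurableD.
Qed.

Lemma fprob_le A B : measurable A -> measurable B -> A `<=` B -> m A <= m B.
Proof.
move=> mA mB AB; rewrite -subr_ge0 -fprobD//; exact: fprob_ge0.
Qed.

Lemma measurable_prop (Q : Prop) : measurable [set _ : Omega | Q].
Proof.
have [q|q] := pselect Q.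
  by rewrite (_ : [set _ | _] = setT)//; apply/seteqP; split.
by rewrite (_ : [set _ | _] = set0)//; apply/seteqP; split.
Qed.

Hypothesis atomless_nu : atomless nu.

Lemma atomless_half A : measurable A -> 0 < m A ->
  exists B, [/\ measurable B, B `<=` A, 0 < m B & m B <= m A / 2].
Proof.
move=> mA A0; have [|B [mB BA] []] := atomless_nu mA.
  by rewrite (fprob_fin mA) lte_fin.
rewrite (fprob_fin mA) (fprob_fin mB) !lte_fin => B0 BltA.
have [Bh|Bh] := leP (m B) (m A / 2); first by exists B.
exists (A `\` B); split => //; first exact: measurableD.
  by rewrite fprobD// subr_gt0.
by rewrite fprobD//; lra.
Qed.

Lemma atomless_small A (e : R) : measurable A -> 0 < m A -> 0 < e ->
  exists B, [/\ measurable B, B `<=` A, 0 < m B & m B <= e].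
Proof.
move=> mA A0 e0.
have H n : exists B, [/\ measurable B, B `<=` A, 0 < m B & m B <= m A / 2 ^+ n].
  elim: n => [|n [B [mB BA B0 Bn]]]; first by exists A; split=> //; rewrite expr0 divr1.
  have [C [mC CB C0 Ch]] := atomless_half mB B0.
  exists C; split => //; first exact: (subset_trans CB).
  by rewrite (le_trans Ch)// exprS invfM [2^-1 * _]mulrC mulrA ler_pM2r ?invr_gt0.
have [n nP] : exists n, m A / 2 ^+ n <= e.
  exists (Num.truncn (m A / e)).+1.
  rewrite ler_pdivrMr ?exprn_gt0// -ler_pdivrMl// mulrC.
  have /andP[_ /ltW h] := truncn_itv (divr_ge0 (ltW A0) (ltW e0)).
  by rewrite (le_trans h)// -natrX ler_nat ltnW// ltn_expl.
have [B [mB BA B0 Bn]] := H n.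
by exists B; split => //; exact: le_trans nP.
Qed.

(** Greedy exhaustion: each set in an increasing sequence gains at least half of what any admissible
    extension could gain. If the union had measure below p, a small set D of positive measure
    outside it could be added at every stage, so every gain would be at least half the measure of D,
    although the gains tend to 0. *)
Lemma sierpinski A (p : R) : measurable A -> 0 <= p <= m A ->
  exists B, [/\ measurable B, B `<=` A & m B = p].
Proof.
move=> mA /andP[p0 pA].
pose good B := [/\ measurable B, B `<=` A & m B <= p].
pose step B B' := good B -> [/\ good B', B `<=` B' &
  forall C, good C -> B `<=` C -> m C - m B <= 2 * (m B' - m B)].
have /choice[f fP] : forall B, exists B', step B B'.
  move=> B; have [gB|ngB] := pselect (good B); last by exists B => /ngB.
  pose S := [set m C | C in [set C | good C /\ B `<=` C]].
  have SI C : good C -> B `<=` C -> S (m C) by move=> gC BC; exists C.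
  have S0 : S (m B) by exact: SI.
  have supS : has_sup S.
    by split; [exists (m B) | exists p => _ [C [[]]] _ _ + _ <-].
  have [Bs|Bs] := leP (sup S) (m B).
    exists B => _; split => // C gC BC; rewrite subrr mulr0 subr_le0.
    by rewrite (le_trans _ Bs)//; apply: ub_le_sup; [case: supS | exact: SI].
  have e0 : 0 < (sup S - m B) / 2 by rewrite divr_gt0 ?subr_gt0.
  have [_ [C [gC BC] <-] hC] := sup_adherent e0 supS.
  exists C => _; split => // C' gC' BC'.
  have h : m C' <= sup S by apply: ub_le_sup; [case: supS | exact: SI].
  by lra.
pose Bn n := iter n f set0.
have gB n : good (Bn n).
  elim: n => [|n IH]; first by split => //=; rewrite measure0.
  by case: (fP _ IH).
have stepB n := fP _ (gB n).
have subB n : Bn n `<=` Bn n.+1 by case: (stepB n).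
have mBn n : measurable (Bn n) by case: (gB n).
pose B := \bigcup_n Bn n.
have mB : measurable B by exact: bigcupT_measurable.
have BA : B `<=` A by move=> x [n _]; case: (gB n) => _ + _; exact.
have cvB : m (Bn n) @[n --> \oo] --> m B.
  apply: fine_cvg; rewrite -(fprob_fin mB).
  apply: nondecreasing_cvg_mu => //.
  by apply/nondecreasing_seqP => n; apply/subsetPset.
exists B; split => //; apply/eqP; rewrite eq_le; apply/andP; split.
  rewrite -(cvg_lim _ cvB)//; apply: limr_le; first by apply/cvg_ex; exists (m B).
  by apply: nearW => n; case: (gB n).
rewrite leNgt; apply/negP => Bp.
have AB0 : 0 < m (A `\` B) by rewrite fprobD// subr_gt0 (lt_le_trans Bp).
have pB0 : 0 < p - m B by rewrite subr_gt0.
have [D [mD DAB D0 Dp]] := atomless_small (measurableD mA mB) AB0 pB0.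
(* Adding [D] to [Bn n] stays admissible, since [Bn n] lies in [B] and [D] fits into the room p - m
   B. *)
have key n : m D <= 2 * (m (Bn n.+1) - m (Bn n)).
  have BnB : Bn n `<=` B by move=> x; exists n.
  have dj : Bn n `&` D = set0.
    by apply/seteqP; split => // x [/BnB Bx /DAB[]].
  have [_ _ /(_ (Bn n `|` D))] := stepB n.
  rewrite fprobU// addrAC subrr add0r; apply; last exact: subsetUl.
  split; first exact: measurableU.
    by rewrite subUset; split; [exact: subset_trans BA | move=> x /DAB[]].
  rewrite fprobU//; have := fprob_le (mBn n) mB BnB; lra.
have cv0 : 2 * (m (Bn n.+1) - m (Bn n)) @[n --> \oo] --> 2 * (m B - m B).
  by apply: cvgM; [exact: cvg_cst | ]; apply: cvgB => //; rewrite (cvg_shiftS (fun n => m (Bn n))).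
have : m D <= 2 * (m B - m B).
  rewrite -(cvg_lim _ cv0)//; apply: limr_ge; first by apply/cvg_ex; eexists; exact: cv0.
  exact: nearW.
by rewrite subrr mulr0 leNgt D0.
Qed.

(** Carve the prescribed measures off one after another; the label [t0] receives what is left at the
    end. *)
Lemma atomless_split (T : finType) (t0 : T) (s : seq T) (q : T -> R) A :
  measurable A -> (forall b, 0 <= q b) -> uniq (t0 :: s) ->
  \sum_(b <- t0 :: s) q b = m A ->
  exists h : Omega -> T, [/\ forall b, measurable [set x | h x = b],
    forall x, h x \in t0 :: s &
    forall b, b \in t0 :: s -> m (A `&` [set x | h x = b]) = q b].
Proof.
move=> + q0; elim: s A => [|b s IH] A mA us sq.
  exists (fun=> t0); split => [b|x|b].
  - exact: measurable_prop.
  - by rewrite mem_head.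
  - rewrite inE => /eqP ->; rewrite (_ : [set _ | _] = setT) ?setIT; last by apply/seteqP; split.
    by rewrite -sq big_seq1.
have [|B [mB BA Bb]] := @sierpinski A (q b) mA.
  rewrite q0 -sq !big_cons addrCA lerDl addr_ge0// sumr_ge0//.
have us' : uniq (t0 :: s).
  move: us; rewrite /= inE negb_or => /andP[/andP[_ ->]] /andP[_ ->] //.
have bs : b \notin t0 :: s.
  by move: us; rewrite /= !inE !negb_or eq_sym => /andP[/andP[-> _]] /andP[-> _].
have [|h [mh hs hq]] := IH (A `\` B) (measurableD mA mB) us'.
  by rewrite fprobD// Bb -sq !big_cons; lra.
exists (fun x => if x \in B then b else h x); split => [c|x|c].
- rewrite (_ : [set _ | _] = (B `&` [set x | b = c]) `|` (~` B `&` [set x | h x = c])).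
    apply: measurableU; apply: measurableI => //; last exact: measurableC.
    exact: measurable_prop.
  apply/seteqP; split => x /=.
    by case: ifPn => [/set_mem|/negP xB] e; [left | right; split => // /mem_set].
  by move=> [[/mem_set -> //]|[xB]]; rewrite memNset.
- case: ifP => _; first by rewrite !inE eqxx orbT.
  by have := hs x; rewrite !inE => /orP[->//|->]; rewrite !orbT.
- have [->|cb] := eqVneq c b.
    move=> _; rewrite -Bb; congr (fine (nu _)); apply/seteqP; split => x /=.
      case: ifPn => [/set_mem//|_] [_ hb].
      by have := hs x; rewrite hb (negbTE bs).
    by move=> Bx; split; [exact: BA | rewrite mem_set].
  move=> cs; rewrite -hq.
    congr (fine (nu _)); apply/seteqP; split => x /=.
      case: ifPn => [_ [_ /esym/eqP]|/negP xB [Ax hx]]; first by rewrite (negbTE cb).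
      by split => //; split => // /mem_set.
    by move=> [[Ax Bx] hx]; rewrite memNset.
  by move: cs; rewrite !inE (negbTE cb).
Qed.

End Atomless.

(** * Kernels, cut norm and counting *)

Section Kernels.
Context (d : measure_display) (Omega : measurableType d) (R : realType).
Variable nu : probability Omega R.
Implicit Types V W U : Omega -> Omega -> R.

Definition bm2 V := bm (fun z : Omega * Omega => V z.1 z.2).

Definition E2 V : R := Ex nu (fun x => Ex nu (V x)).

Lemma bm2_section V x : bm2 V -> bm (V x).
Proof. by move=> bV; exact: (bm_comp bV (pair1_measurable x)). Qed.

Lemma bm2_Ex V : bm2 V -> bm (fun x => Ex nu (V x)).
Proof. by move=> bV; exact: (bm_Ex nu bV). Qed.

Lemma bm_fst (f : Omega -> R) : bm f -> bm2 (fun x _ => f x).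
Proof. by move=> bf; exact: (bm_comp bf measurable_fst). Qed.

Lemma bm_snd (f : Omega -> R) : bm f -> bm2 (fun _ x => f x).
Proof. by move=> bf; exact: (bm_comp bf measurable_snd). Qed.

Lemma bm2_swap V : bm2 V -> bm2 (fun x y => V y x).
Proof.
move=> bV; apply: (bm_comp (g := fun z : Omega * Omega => (z.2, z.1)) bV).
exact: measurable_fun_pair.
Qed.

Lemma E2_swap V : bm2 V -> E2 V = E2 (fun x y => V y x).
Proof. by move=> bV; exact: (@Ex_swap _ _ _ _ _ nu nu (fun z => V z.1 z.2)). Qed.

Lemma E2_prod V : bm2 V -> (\int[(nu \x nu)%E]_z (V z.1 z.2)%:E)%E = (E2 V)%:E.
Proof. by move=> bV; exact: (Ex_prodE nu nu bV). Qed.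

Lemma E2D V W : bm2 V -> bm2 W -> E2 (fun x y => V x y + W x y) = E2 V + E2 W.
Proof.
move=> bV bW; rewrite -ExD; [|exact: bm2_Ex|exact: bm2_Ex].
by congr Ex; apply/funext => x; rewrite ExD//; exact: bm2_section.
Qed.

Lemma E2B V W : bm2 V -> bm2 W -> E2 (fun x y => V x y - W x y) = E2 V - E2 W.
Proof.
move=> bV bW; rewrite -ExB; [|exact: bm2_Ex|exact: bm2_Ex].
by congr Ex; apply/funext => x; rewrite ExB//; exact: bm2_section.
Qed.

Lemma E2Z c V : bm2 V -> E2 (fun x y => c * V x y) = c * E2 V.
Proof.
move=> bV; rewrite -ExZ; last exact: bm2_Ex.
by congr Ex; apply/funext => x; rewrite ExZ//; exact: bm2_section.
Qed.

Lemma E2_sum (J : Type) (r : seq J) (Q : pred J) (F : J -> Omega -> Omega -> R) :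
  (forall i, bm2 (F i)) ->
  E2 (fun x y => \sum_(i <- r | Q i) F i x y) = \sum_(i <- r | Q i) E2 (F i).
Proof.
move=> bF; rewrite -Ex_sum; last by move=> i; exact: bm2_Ex.
by congr Ex; apply/funext => x; rewrite Ex_sum// => i; exact: bm2_section.
Qed.

Lemma E2_le V W : bm2 V -> bm2 W -> (forall x y, V x y <= W x y) -> E2 V <= E2 W.
Proof.
move=> bV bW VW; apply: Ex_le; [exact: bm2_Ex|exact: bm2_Ex|move=> x].
by apply: Ex_le => //; exact: bm2_section.
Qed.

Lemma E2_ge0 V : (forall x y, 0 <= V x y) -> 0 <= E2 V.
Proof. by move=> V0; apply: Ex_ge0 => x; exact: Ex_ge0. Qed.

Lemma E2_cst c : E2 (fun _ _ => c) = c.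
Proof. by rewrite /E2 !Ex_cst. Qed.

Lemma E2_norm V : bm2 V -> `|E2 V| <= E2 (fun x y => `|V x y|).
Proof.
move=> bV; rewrite (le_trans (Ex_norm _ (bm2_Ex bV)))//; apply: Ex_le.
- by apply: bm_norm; exact: bm2_Ex.
- by apply: bm2_Ex; exact: bm_norm.
- by move=> x; apply: Ex_norm; exact: bm2_section.
Qed.

Lemma E2_prodfun (f g : Omega -> R) : bm f -> bm g ->
  E2 (fun x y => f x * g y) = Ex nu f * Ex nu g.
Proof.
move=> bf bg; rewrite -ExZr//; congr Ex; apply/funext => x; exact: ExZ.
Qed.

Lemma graphon_bm2 W : graphon W -> bm2 W.
Proof. exact: graphon_bm. Qed.

Lemma L1norm_E2 W : graphon W -> L1norm nu W = (E2 W)%:E.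
Proof.
move=> gW; rewrite -E2_prod; last exact: graphon_bm2.
by apply: eq_integral => z _; case: gW => _ /(_ z.1 z.2)/andP[? _] _; rewrite ger0_norm.
Qed.

Lemma bm_indic (A : set Omega) : measurable A -> bm (\1_A : Omega -> R).
Proof.
move=> mA; split; first exact: measurable_indic.
by exists 1 => x; rewrite indicE; case: (x \in A); rewrite ?normr1 ?normr0.
Qed.

Definition cut_bounded V (c : R) := forall A B, measurable A -> measurable B ->
  `|E2 (fun x y => V x y * (\1_A x * \1_B y))| <= c.

(** Among [0,1]-valued f, the integral of phi * f is largest for the indicator of {phi >= 0} and
    smallest for that of {phi <= 0}, so sets suffice as tests. *)
Lemma test_fun_bound (phi : Omega -> R) c : bm phi ->
  (forall A, measurable A -> `|Ex nu (fun x => phi x * \1_A x)| <= c) ->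
  forall f, bm f -> (forall x, 0 <= f x <= 1) -> `|Ex nu (fun x => phi x * f x)| <= c.
Proof.
move=> bphi H f bf f01.
have mA : measurable [set x | (0 <= phi x)%R] by exact: measurable_pred_ge.
have mB : measurable [set x | (0 <= - phi x)%R].
  by apply: (@measurable_pred_ge _ _ _ (fun x => - phi x)); exact: bmN.
have b1 : bm (fun x => phi x * f x) by exact: bmM.
rewrite ler_norml; apply/andP; split.
  have := H _ mB; rewrite ler_norml => /andP[h _]; rewrite (le_trans h)//.
  apply: Ex_le => //; first by apply: bmM => //; exact: bm_indic.
  move=> x; rewrite indicE; have /andP[f0 f1] := f01 x.
  case: (boolP (x \in _)) => [/set_mem/=|/negP xB].
    by rewrite mulr1 oppr_ge0 => p0; rewrite ler_niMr.
  rewrite mulr0 mulr_ge0//; rewrite leNgt; apply/negP => p0.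
  by apply: xB; rewrite mem_set//= oppr_ge0 ltW.
have := H _ mA; rewrite ler_norml => /andP[_ h]; rewrite (le_trans _ h)//.
apply: Ex_le => //; first by apply: bmM => //; exact: bm_indic.
move=> x; rewrite indicE; have /andP[f0 f1] := f01 x.
case: (boolP (x \in _)) => [/set_mem/=|/negP xB].
  by rewrite mulr1 => p0; rewrite ler_piMr.
rewrite mulr0 mulr_le0_ge0//; rewrite leNgt; apply/negP => p0.
by apply: xB; rewrite mem_set//= ltW.
Qed.

(** Pass from sets to [0,1]-valued functions in one variable at a time, by [test_fun_bound] with the
    other variable integrated out. *)
Lemma cut_bounded_fun V c : bm2 V -> cut_bounded V c ->
  forall f g, bm f -> bm g -> (forall x, 0 <= f x <= 1) -> (forall x, 0 <= g x <= 1) ->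
  `|E2 (fun x y => V x y * (f x * g y))| <= c.
Proof.
move=> bV cV f g bf bg f01 g01.
have bVf : bm2 (fun x y => V y x * f y) by apply: bm2_swap; apply: bmM => //; exact: bm_fst.
have E h : bm h -> E2 (fun x y => V x y * (f x * h y)) =
    Ex nu (fun y => Ex nu (fun x => V x y * f x) * h y).
  move=> bh; rewrite E2_swap; last first.
    by apply: bmM => //; apply: bmM; [exact: bm_fst | exact: bm_snd].
  congr Ex; apply/funext => y; rewrite -ExZr; last exact: (bm2_section y bVf).
  by congr Ex; apply/funext => x; rewrite mulrA.
rewrite E//; apply: test_fun_bound => //; first exact: (bm2_Ex bVf).
move=> B mB; rewrite -E; last exact: bm_indic.
have bVB : bm2 (fun x y => V x y * \1_B y) by apply: bmM => //; apply: bm_snd; exact: bm_indic.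
have E' h : bm h -> E2 (fun x y => V x y * (h x * \1_B y)) =
    Ex nu (fun x => Ex nu (fun y => V x y * \1_B y) * h x).
  move=> bh; congr Ex; apply/funext => x; rewrite -ExZr; last exact: (bm2_section x bVB).
  by congr Ex; apply/funext => y; rewrite mulrAC mulrA.
rewrite E'//; apply: test_fun_bound => //; first exact: (bm2_Ex bVB).
by move=> A mA; rewrite -E'; [exact: cV | exact: bm_indic].
Qed.

Lemma cutnorm_bound V A B : bm2 V -> measurable A -> measurable B ->
  (`|E2 (fun x y => V x y * (\1_A x * \1_B y))|%:E <= cutnorm nu V)%E.
Proof.
move=> bV mA mB; apply: ereal_sup_ubound; exists (A, B) => //=.
rewrite integral_mkcond -[in RHS]abse_EFin -E2_prod; last first.
  by apply: bmM => //; apply: bmM; [apply: bm_fst | apply: bm_snd]; exact: bm_indic.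
congr abse; apply: eq_integral => z _; rewrite patchE !indicE.
have [/set_mem[/= zA zB]|zAB] := boolP (z \in A `*` B).
  by rewrite !mem_set// !mulr1.
have [zA|zA] := boolP (z.1 \in A); have [zB|zB] := boolP (z.2 \in B); rewrite ?(mulr0, mul0r)//.
by exfalso; move/negP: zAB; apply; apply: mem_set; split; apply: set_mem.
Qed.

Lemma cutnorm_cvg0 (V : nat -> Omega -> Omega -> R) : (forall n, bm2 (V n)) ->
  cutnorm nu (V n) @[n --> \oo] --> 0%E ->
  forall e, 0 < e -> \forall n \near \oo, cut_bounded (V n) e.
Proof.
move=> bV cV e e0; have /fine_cvgP[fV /cvgr0Pnorm_lt/(_ _ e0)] := cV.
move=> H; near=> n => A B mA mB; rewrite -lee_fin.
rewrite (le_trans (cutnorm_bound (bV n) mA mB))//.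
have fn : cutnorm nu (V n) \is a fin_num by near: n.
rewrite -(fineK fn) lee_fin (le_trans (ler_norm _))// ltW//.
by near: n.
Unshelve. all: by end_near. Qed.

End Kernels.

(** * Counting lemmas in cut norm and in L1 *)

Section Counting.
Context (d : measure_display) (Omega : measurableType d) (R : realType).
Variable nu : probability Omega R.
Variable k : nat.
Local Notation pts := ('I_k -> Omega).
Implicit Types (K V : Omega -> Omega -> R) (f g : pts -> R).

Definition hom_density (s : seq ('I_k * 'I_k)) K (x : pts) : R :=
  \prod_(e <- s) K (x e.1) (x e.2).

Definition unit_kbm f := kbm f /\ forall x, 0 <= f x <= 1.
Definition unit_bm2 K := bm2 K /\ forall x y, 0 <= K x y <= 1.

Lemma graphon_unit W : graphon W -> unit_bm2 W.
Proof. by move=> gW; split; [exact: graphon_bm2 | case: gW]. Qed.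

Lemma unit_kbmM f g : unit_kbm f -> unit_kbm g -> unit_kbm (fun x => f x * g x).
Proof.
move=> [bf f01] [bg g01]; split; first exact: bmM.
move=> x; have /andP[f0 f1] := f01 x; have /andP[g0 g1] := g01 x.
by rewrite mulr_ge0// mulr_ile1.
Qed.

Lemma unit_kbm_pair K l m : unit_bm2 K -> unit_kbm (fun x : pts => K (x l) (x m)).
Proof. by move=> [bK K01]; split => //; exact: (kbm_coord2 l m bK). Qed.

Lemma unit_hom_density s K : unit_bm2 K -> unit_kbm (hom_density s K).
Proof.
move=> uK; elim: s => [|e s IH].
  rewrite /hom_density; under eq_fun do rewrite big_nil.
  by split; [exact: bm_cst | move=> x; rewrite ler01 lexx].
rewrite /hom_density; under eq_fun do rewrite big_cons.
by apply: unit_kbmM => //; exact: unit_kbm_pair.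
Qed.

(* As a function of the coordinates [a] and [b] alone, [f] is a product g(x_a) h(x_b): *)
(* this is what makes [f] an admissible test function for the cut norm. *)
Definition separated (e : 'I_k * 'I_k) f := forall y, exists g h : Omega -> R,
  [/\ bm g, bm h, forall x, 0 <= g x <= 1, forall x, 0 <= h x <= 1 &
      forall x x', f (upd (upd y e.1 x) e.2 x') = g x * h x'].

Lemma separatedM e f g : separated e f -> separated e g ->
  separated e (fun x => f x * g x).
Proof.
move=> sf sg y; have [g1 [h1 [bg1 bh1 g1b h1b E1]]] := sf y.
have [g2 [h2 [bg2 bh2 g2b h2b E2]]] := sg y.
exists (fun x => g1 x * g2 x), (fun x => h1 x * h2 x); split.
- exact: bmM.
- exact: bmM.
- move=> x; have /andP[a0 a1] := g1b x; have /andP[b0 b1] := g2b x.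
  by rewrite mulr_ge0// mulr_ile1.
- move=> x; have /andP[a0 a1] := h1b x; have /andP[b0 b1] := h2b x.
  by rewrite mulr_ge0// mulr_ile1.
- by move=> x x'; rewrite E1 E2 mulrACA.
Qed.

Lemma separated_cst e : separated e (fun=> 1).
Proof.
move=> y; exists (fun=> 1), (fun=> 1); split; rewrite ?mulr1//; try exact: bm_cst.
- by move=> x; rewrite ler01 lexx.
- by move=> x; rewrite ler01 lexx.
Qed.

Lemma separated_coord e (f : Omega -> R) l : bm f -> (forall x, 0 <= f x <= 1) ->
  separated e (fun x => f (x l)).
Proof.
move=> bf f01 y.
have one01 (x : Omega) : 0 <= (1 : R) <= 1 by rewrite ler01 lexx.
have [lb|lb] := eqVneq l e.2.
  exists (fun=> 1), f; split => //; first exact: bm_cst.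
  by move=> x x'; rewrite /upd lb eqxx mul1r.
have [la|la] := eqVneq l e.1.
  exists f, (fun=> 1); split => //; first exact: bm_cst.
  by move=> x x'; rewrite /upd (negbTE lb) la eqxx mulr1.
exists (fun=> f (y l)), (fun=> 1); split => //; [exact: bm_cst|exact: bm_cst|].
by move=> x x'; rewrite /upd (negbTE lb) (negbTE la) mulr1.
Qed.

(** Two distinct edges share at most one vertex, so the factor of [e'] involves at most one of the
    two coordinates of [e]. *)
Lemma separated_pair (e e' : 'I_k * 'I_k) K : unit_bm2 K ->
  (e.1 < e.2)%N -> (e'.1 < e'.2)%N -> e != e' ->
  separated e (fun x => K (x e'.1) (x e'.2)).
Proof.
case: e e' => [a b] [l m] [bK K01] /= ab lm ne y.
have one01 (x : Omega) : 0 <= (1 : R) <= 1 by rewrite ler01 lexx.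
have nlm : l != m by rewrite neq_ltn lm.
rewrite /upd; case: (eqVneq l b) => [lb|lb].
  have mb : m != b by rewrite eq_sym -lb.
  have ma : m != a by apply/eqP => ma; move: ab lm; rewrite lb ma => /ltn_trans h /h; rewrite ltnn.
  exists (fun=> 1), (fun x => K x (y m)); split => //; first exact: bm_cst.
    exact: (bm2_section (y m) (bm2_swap bK)).
  by move=> x x'; rewrite /= (negbTE mb) (negbTE ma) mul1r.
case: (eqVneq l a) => [la|la].
  have ma : m != a by rewrite eq_sym -la.
  have mb : m != b by apply: contraNneq ne => mb; rewrite la mb.
  exists (fun x => K x (y m)), (fun=> 1); split => //;
    [exact: (bm2_section (y m) (bm2_swap bK))|exact: bm_cst|].
  by move=> x x'; rewrite /= (negbTE mb) (negbTE ma) mulr1.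
case: (eqVneq m b) => [mb|mb].
  exists (fun=> 1), (fun x => K (y l) x); split => //; first exact: bm_cst.
    exact: bm2_section.
  by move=> x x' /=; rewrite mul1r.
case: (eqVneq m a) => [ma|ma].
  exists (fun x => K (y l) x), (fun=> 1); split => //; [exact: bm2_section|exact: bm_cst|].
  by move=> x x' /=; rewrite mulr1.
exists (fun=> K (y l) (y m)), (fun=> 1); split => //; [exact: bm_cst|exact: bm_cst|].
by move=> x x' /=; rewrite mulr1.
Qed.

Lemma separated_hom_density (e : 'I_k * 'I_k) (s : seq ('I_k * 'I_k)) K : unit_bm2 K -> (e.1 < e.2)%N ->
  (forall e', e' \in s -> (e'.1 < e'.2)%N) -> e \notin s ->
  separated e (hom_density s K).
Proof.
move=> uK le; elim: s => [|e' s IH] ls.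
  rewrite /hom_density; under eq_fun do rewrite big_nil.
  by move=> _; exact: separated_cst.
rewrite inE negb_or => /andP[ee' es].
rewrite /hom_density; under eq_fun do rewrite big_cons.
apply: (@separatedM e (fun x => K (x e'.1) (x e'.2)) (hom_density s K)).
  by apply: separated_pair => //; apply: ls; rewrite mem_head.
by apply: IH => // x xs; apply: ls; rewrite inE xs orbT.
Qed.

Lemma rint_norm_le s f c : kbm f -> (forall x, `|f x| <= c) -> forall y, `|rint nu s f y| <= c.
Proof.
move=> bf fc y; rewrite ler_norml; apply/andP; split.
  rewrite -[leLHS](rint_cst nu s _ y); apply: rint_le => //; first exact: bm_cst.
  by move=> x; have := fc x; rewrite ler_norml => /andP[].
rewrite -[leRHS](rint_cst nu s _ y); apply: rint_le => //; first exact: bm_cst.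
by move=> x; have := fc x; rewrite ler_norml => /andP[].
Qed.

Lemma edge_bound V c (e : 'I_k * 'I_k) f : bm2 V -> cut_bounded nu V c -> e.1 != e.2 ->
  kbm f -> separated e f -> `|kint nu (fun x => V (x e.1) (x e.2) * f x)| <= c.
Proof.
move=> bV cV ne bf sf.
have bVf : kbm (fun x : pts => V (x e.1) (x e.2) * f x).
  by apply: bmM => //; exact: (kbm_coord2 e.1 e.2 bV).
(* The ends of the edge are placed last, hence integrated innermost. *)
have E : perm_eq (enum 'I_k) (enum [predD1 predC1 e.1 & e.2] ++ [:: e.1; e.2]).
  apply: uniq_perm; first exact: enum_uniq.
    by rewrite cat_uniq enum_uniq /= !mem_enum !inE !eqxx ?andbF ?orbF /= ?inE ?ne.
  move=> i; rewrite mem_cat !mem_enum !inE /=.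
  by case: eqP => // _; case: eqP.
rewrite /kint (rint_perm nu bVf E) /rint foldr_cat /= -/(rint nu _ _).
apply: rint_norm_le; first by do 2 apply: kbm_int_coord.
move=> y; have [g [h [bg bh g01 h01 gh]]] := sf y.
rewrite /int_coord (_ : Ex _ _ = E2 nu (fun x x' => V x x' * (g x * h x'))).
  exact: cut_bounded_fun.
congr Ex; apply/funext => x; congr Ex; apply/funext => x'.
by rewrite gh /upd eqxx (negbTE ne) eqxx.
Qed.

(** Replace [K] by [K'] one edge at a time. Each exchange costs at most [c] by [edge_bound], because
    all other factors are separated for the exchanged edge; the factors not being compared are
    absorbed into [f]. *)
Lemma counting_cut (s : seq ('I_k * 'I_k)) K K' c f : unit_bm2 K -> unit_bm2 K' ->
  cut_bounded nu (fun x y => K x y - K' x y) c ->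
  uniq s -> (forall e, e \in s -> (e.1 < e.2)%N) ->
  unit_kbm f -> (forall e, e \in s -> separated e f) ->
  `|kint nu (fun x => hom_density s K x * f x) - kint nu (fun x => hom_density s K' x * f x)|
    <= (size s)%:R * c.
Proof.
move=> uK uK' cKK'; elim: s f => [|e s IH] f us ls uf sf.
  by rewrite /hom_density; under eq_fun do rewrite big_nil; under [X in _ - kint nu X]eq_fun do rewrite big_nil; rewrite subrr normr0 mul0r.
move: us => /= /andP[es us].
have le := ls e (mem_head _ _); have se := sf e (mem_head _ _).
have {}ls e' : e' \in s -> (e'.1 < e'.2)%N by move=> h; apply: ls; rewrite inE h orbT.
have {}sf e' : e' \in s -> separated e' f by move=> h; apply: sf; rewrite inE h orbT.
have b K1 : unit_bm2 K1 -> kbm (hom_density s K1) by case/(unit_hom_density s).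
have [bf _] := uf.
have bp K1 : unit_bm2 K1 -> kbm (fun x : pts => K1 (x e.1) (x e.2)).
  by case/(unit_kbm_pair e.1 e.2).
pose mid := kint nu (fun x => hom_density s K' x * (K (x e.1) (x e.2) * f x)).
have -> : kint nu (fun x => hom_density (e :: s) K x * f x) =
    kint nu (fun x => hom_density s K x * (K (x e.1) (x e.2) * f x)).
  by congr kint; apply/funext => x; rewrite /hom_density big_cons mulrCA mulrA.
have -> : kint nu (fun x => hom_density (e :: s) K' x * f x) =
    mid - kint nu (fun x => (K (x e.1) (x e.2) - K' (x e.1) (x e.2)) * (hom_density s K' x * f x)).
  rewrite -kintB.
  - by congr kint; apply/funext => x; rewrite /hom_density big_cons; ring.
  - by apply: bmM; [exact: b | apply: bmM => //; exact: bp].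
  - by apply: bmM; [apply: bmB; exact: bp | apply: bmM => //; exact: b].
rewrite opprB addrCA (le_trans (ler_normD _ _))//= mulrSr mulrDl mul1r [leRHS]addrC lerD//.
  apply: (@edge_bound (fun x y => K x y - K' x y)) => //.
  - by case: uK; case: uK' => bK' _ bK _; exact: bmB.
  - by rewrite neq_ltn le.
  - by apply: bmM => //; exact: b.
  - by apply: separatedM => //; exact: separated_hom_density.
apply: IH => //; first by apply: unit_kbmM => //; exact: unit_kbm_pair.
move=> e' e's; apply: separatedM; last exact: sf.
apply: separated_pair => //; first exact: ls.
by apply: contraNneq es => <-.
Qed.

(** Here the difference of the two products is bounded pointwise by the sum of the differences over
    the edges, so, unlike in [counting_cut], [f] may be any bounded weight. *)
Lemma counting_L1 (s : seq ('I_k * 'I_k)) K K' f M : unit_bm2 K -> unit_bm2 K' ->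
  (forall e, e \in s -> (e.1 < e.2)%N) ->
  kbm f -> (forall x, 0 <= f x <= M) ->
  `|kint nu (fun x => hom_density s K x * f x) - kint nu (fun x => hom_density s K' x * f x)|
    <= M * (size s)%:R * E2 nu (fun x y => `|K x y - K' x y|).
Proof.
move=> uK uK' ls bf fM.
have [bK _] := uK; have [bK' _] := uK'.
have b K1 : unit_bm2 K1 -> kbm (hom_density s K1) by case/(unit_hom_density s).
have bD : bm2 (fun x y => `|K x y - K' x y|) by apply: bm_norm; exact: bmB.
pose Dl (x : pts) := \sum_(e <- s) `|K (x e.1) (x e.2) - K' (x e.1) (x e.2)|.
have bDl : kbm Dl by apply: bm_sum => e; exact: (kbm_coord2 e.1 e.2 bD).
have ptw x : `|hom_density s K x - hom_density s K' x| <= Dl x.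
  rewrite /hom_density /Dl; elim: s {ls b Dl bDl} => [|e s IH].
    by rewrite !big_nil subrr normr0.
  rewrite !big_cons.
  have [_ /(_ x)/andP[p0 p1]] := unit_hom_density s uK.
  case: uK => _ /(_ (x e.1) (x e.2))/andP[k0 k1].
  case: uK' => _ /(_ (x e.1) (x e.2))/andP[k0' k1'].
  set P := \prod_(_ <- _) K _ _ in IH *; set P' := \prod_(_ <- _) K' _ _ in IH *.
  set u := K _ _ in k0 k1 *; set u' := K' _ _ in k0' k1' *.
  have -> : u * P - u' * P' = (u - u') * P + u' * (P - P') by ring.
  rewrite (le_trans (ler_normD _ _))// !normrM lerD//.
    by rewrite ler_piMr// ger0_norm.
  by rewrite (le_trans _ IH)// ler_piMl// ger0_norm.
rewrite -kintB; [|by apply: bmM => //; exact: b|by apply: bmM => //; exact: b].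
have bd : kbm (fun x => hom_density s K x * f x - hom_density s K' x * f x).
  by apply: bmB; apply: bmM => //; exact: b.
have -> : M * (size s)%:R * E2 nu (fun x y => `|K x y - K' x y|) = kint nu (fun x => M * Dl x).
  rewrite kintZ// -mulrA; congr (_ * _); rewrite kint_sum; last first.
    by move=> e; exact: (kbm_coord2 e.1 e.2 bD).
  rewrite big_seq (eq_bigr (fun=> E2 nu (fun x y => `|K x y - K' x y|))).
    by rewrite -big_seq big_const_seq count_predT iter_addr_0 mulr_natl.
  move=> e /ls le; rewrite (@kint_pair _ _ _ nu k (fun z => `|K z.1 z.2 - K' z.1 z.2|))//.
  by rewrite neq_ltn le.
have bM : kbm (fun x => M * Dl x) by exact: bmZ.
have h x : `|hom_density s K x * f x - hom_density s K' x * f x| <= M * Dl x.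
  rewrite -mulrBl normrM mulrC; have /andP[f0 f1] := fM x.
  by rewrite ler_pM// ger0_norm.
rewrite ler_norml; apply/andP; split; last first.
  by apply: kint_le => // x; rewrite (le_trans (ler_norm _)).
rewrite -mulN1r -kintZ//; apply: kint_le => //; first exact: bmZ.
by move=> x; rewrite mulN1r; have := h x; rewrite ler_norml => /andP[].
Qed.

Variable adj : rel 'I_k.

Definition edges := [seq e : 'I_k * 'I_k <- enum {: 'I_k * 'I_k} |
  (e.1 < e.2)%N && adj e.1 e.2].

Lemma Wtensor_edges K x : Wtensor adj K x = hom_density edges K x.
Proof.
rewrite /Wtensor /hom_density big_filter big_enum_cond /=.
by rewrite pair_big_dep /=; apply: eq_bigl.
Qed.

Lemma edges_lt e : e \in edges -> (e.1 < e.2)%N.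
Proof. by rewrite mem_filter => /andP[/andP[]]. Qed.

Lemma uniq_edges : uniq edges.
Proof. by rewrite filter_uniq// enum_uniq. Qed.

End Counting.

(** * Slack and step approximation *)

Section Restriction.
Context (d : measure_display) (Omega : measurableType d) (R : realType).
Variable nu : probability Omega R.
Variable k : nat.
Local Notation pts := ('I_k -> Omega).
Implicit Types t : pts -> R.
Variable b : Omega -> bool.
Hypothesis mb : measurable [set x | b x].

Definition avoid t : pts -> R := fun x => t x * \prod_(l < k) (~~ b (x l))%:R.

Let bmb : bm (fun x => (b x)%:R : R). Proof. exact: bm_ind. Qed.

Let bmnb : bm (fun x => (~~ b x)%:R : R).
Proof.
apply: bm_ind; rewrite (_ : [set x | ~~ b x] = ~` [set x | b x]).
  exact: measurableC.
by apply/seteqP; split => x /= /negP.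
Qed.

Lemma avoid_ge0 t x : (forall x, 0 <= t x) -> 0 <= avoid t x.
Proof. by move=> t0; rewrite mulr_ge0// prodr_ge0. Qed.

Lemma avoid_le t x : (forall x, 0 <= t x) -> avoid t x <= t x.
Proof.
move=> t0; rewrite ler_piMr// prodr_ile1// => l _.
by case: (b _); rewrite ?lexx ler01 ?lexx.
Qed.

Lemma kbm_avoid t : kbm t -> kbm (avoid t).
Proof.
move=> bt; apply: bmM => //; apply: bm_prod => l.
exact: (kbm_coord l bmnb).
Qed.

Lemma avoid_neq0 t x : avoid t x != 0 -> t x != 0 /\ forall l, ~~ b (x l).
Proof.
rewrite mulf_eq0 negb_or => /andP[-> /prodf_neq0 H]; split=> // l.
by have := H l isT; case: (b _); rewrite ?eqxx.
Qed.

Lemma marg_avoid0 t l x : kbm t -> b x -> marg nu (avoid t) l x = 0.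
Proof.
move=> bt bx.
have -> : avoid t = fun y => (~~ b (y l))%:R * avoid t y.
  apply/funext => y; case: (boolP (b (y l))) => byl; last by rewrite mul1r.
  by rewrite mul0r /avoid (bigD1 l)//= byl mul0r mulr0.
rewrite /marg rintM; first by rewrite /upd eqxx bx mul0r.
  exact: kbm_avoid.
move=> i; rewrite mem_enum !inE => il y z.
by rewrite /upd eq_sym (negbTE il).
Qed.

Lemma marg_avoid_le t l x : kbm t -> (forall x, 0 <= t x) ->
  marg nu (avoid t) l x <= marg nu t l x.
Proof.
move=> bt t0; apply: rint_le => //; first exact: kbm_avoid.
by move=> y; exact: avoid_le.
Qed.

(** Union bound: a tile that is discarded has a vertex in [b], so the discarded size is at most the
    total load carried by [b]. *)
Lemma kint_avoid t : kbm t -> (forall x, 0 <= t x) ->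
  kint nu t <= kint nu (avoid t) + Ex nu (fun x => (b x)%:R * \sum_(l < k) marg nu t l x).
Proof.
move=> bt t0.
have bl l : kbm (fun x : pts => (b (x l))%:R * t x).
  by apply: bmM => //; exact: (kbm_coord l bmb).
have -> : Ex nu (fun x => (b x)%:R * \sum_(l < k) marg nu t l x) =
    kint nu (fun x => \sum_(l < k) (b (x l))%:R * t x).
  rewrite kint_sum//; under eq_fun do rewrite mulr_sumr.
  rewrite Ex_sum; first by apply: eq_bigr => l _; rewrite (Ex_marg nu l bmb bt).
  by move=> l; apply: bmM => //; exact: bm_marg.
have bs : kbm (fun x : pts => \sum_(l < k) (b (x l))%:R * t x) by apply: bm_sum.
rewrite -kintD//; last exact: kbm_avoid.
apply: kint_le => //; first by apply: bmD => //; exact: kbm_avoid.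
move=> x; rewrite /avoid -mulr_suml [X in _ <= _ + X]mulrC -mulrDr ler_peMr//.
elim: (index_enum _) => [|l s IH]; first by rewrite !big_nil addr0.
rewrite !big_cons; case: (b (x l)) => /=; last by rewrite mul1r add0r.
by rewrite mul0r add0r lerDl sumr_ge0.
Qed.

End Restriction.

Section LabelSplit.
Context (d : measure_display) (Omega : measurableType d) (R : realType).
Variable nu : probability Omega R.

Lemma fprob_Ex (b : Omega -> bool) : measurable [set x | b x] ->
  fine (nu [set x | b x]) = Ex nu (fun x => (b x)%:R).
Proof. by move=> mb; rewrite Ex_prob. Qed.

Lemma atomless_fsplit (T : finType) (t0 : T) (q : T -> R) (A : set Omega) :
  atomless nu -> measurable A -> (forall b, 0 <= q b) ->
  \sum_b q b = fine (nu A) ->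
  exists h : Omega -> T, (forall b, measurable [set x | h x == b]) /\
    forall b, fine (nu (A `&` [set x | h x == b])) = q b.
Proof.
move=> anu mA q0 sq; case E : (index_enum T) => [|t1 s].
  by have := mem_index_enum t0; rewrite E.
have [||h [mh _ hq]] := @atomless_split _ _ _ nu anu T t1 s q A mA q0.
- by rewrite -E index_enum_uniq.
- by rewrite -E.
have eT b : [set x | h x == b] = [set x | h x = b].
  by apply/seteqP; split => x /= /eqP.
by exists h; split => b; rewrite eT//; apply: hq; rewrite -E mem_index_enum.
Qed.

End LabelSplit.

(** * Trading a small excess in the budget for a small loss in size *)

Section Slack.
Context (d : measure_display) (Omega : measurableType d) (R : realType).
Variable nu : probability Omega R.
Hypothesis atomless_nu : atomless nu.
Variable k : nat.
Variable adj : rel 'I_k.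

(** The kernel enters the definition of a tiling only through the support of its F-density, and this
    is monotone in the support of the kernel. *)
Lemma eq_le_til (V V' : Omega -> Omega -> R) :
  (forall x y, V x y != 0 -> V' x y != 0) -> (til nu adj V <= til nu adj V')%E.
Proof.
move=> VV'; apply: ge_ereal_sup => _ [t [mt t0 tV tm] <-].
apply: ereal_sup_ubound; exists t => //; split => // x /tV.
rewrite !Wtensor_edges /hom_density !prodf_seq_neq0 => /allP H.
by apply/allP => e es; apply: VV'; exact: H.
Qed.

(** Split Omega into N+1 parts of measure 1/(N+1) and let U' vanish on all pairs meeting the part
    [b] of largest U-degree. A tiling of W - U' that avoids [b] is a tiling of W - U, and avoiding
    [b] costs at most the measure of [b], since the load at each vertex is at most 1. *)
Lemma slack W U (eps : R) N : graphon W -> graphon U ->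
  (forall x y, U x y <= W x y) -> 0 < eps ->
  E2 nu U <= eps + eps / (4 * N.+1%:R) ->
  exists U', [/\ graphon U', forall x y, U' x y <= W x y,
    E2 nu U' <= eps - eps / (4 * N.+1%:R) &
    (til nu adj (fun x y => (W x y - U' x y)%R) <=
     til nu adj (fun x y => (W x y - U x y)%R) + (N.+1%:R^-1)%:E)%E].
Proof.
move=> gW gU UW eps0 Ueps.
have N0 : 0 < N.+1%:R :> R by rewrite ltr0n.
have [Usmall|Ubig] := leP (E2 nu U) (eps - eps / (4 * N.+1%:R)).
  by exists U; split => //; rewrite leeDl// lee_fin invr_ge0 ltW.
have [||h [mh hq]] := @atomless_fsplit _ _ _ nu 'I_N.+1 ord0 (fun=> N.+1%:R^-1) setT atomless_nu measurableT.
- by move=> _; rewrite invr_ge0 ltW.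
- by rewrite sumr_const card_ord -[LHS]mulr_natl mulfV ?gt_eqF// probability_setT.
have {}hq b : Ex nu (fun x => (h x == b)%:R) = N.+1%:R^-1.
  by rewrite -fprob_Ex// -(hq b) setTI.
have bU := graphon_bm2 gU.
have bhb b : bm (fun x => (h x == b)%:R : R) by exact: bm_ind.
have bhn b : bm (fun x => (h x != b)%:R : R).
  apply: bm_ind; rewrite (_ : [set x | h x != b] = ~` [set x | h x == b]).
    exact: measurableC.
  by apply/seteqP; split => x /= /negP.
pose deg b := E2 nu (fun x y => U x y * (h x == b)%:R).
have bdeg b : bm2 (fun x y => U x y * (h x == b)%:R).
  by apply: bmM => //; exact: (bm_fst (bhb b)).
have sdeg : \sum_b deg b = E2 nu U.
  rewrite -E2_sum//; congr E2; apply/funext => x; apply/funext => y.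
  rewrite -mulr_sumr (bigD1 (h x))//= eqxx big1 ?addr0 ?mulr1// => i.
  by rewrite eq_sym => /negbTE ->.
(* Some part has at least the average degree. *)
have [b hb] : exists b, E2 nu U / N.+1%:R <= deg b.
  apply/not_existsP => /= H; have : \sum_b deg b < \sum_(b < N.+1) E2 nu U / N.+1%:R.
    apply: ltr_sum; last by move=> i _; rewrite ltNge; apply/negP; exact: H.
    by apply/hasP; exists ord0 => //; rewrite mem_index_enum.
  by rewrite sdeg sumr_const card_ord -[X in _ < X]mulr_natr divfK ?gt_eqF// ltxx.
pose U' x y := U x y * ((h x != b)%:R * (h y != b)%:R).
have [sU U01 mU] := gU.
have U'U x y : 0 <= U' x y <= U x y.
  have /andP[u0 _] := U01 x y; rewrite /U'.
  by case: (h x == b); case: (h y == b); rewrite /= ?(mulr0, mul0r, mulr1) u0 ?lexx.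
have gU' : graphon U'.
  split.
  - by move=> x y; rewrite /U' sU [X in _ * X]mulrC.
  - move=> x y; have /andP[-> h1] := U'U x y; have /andP[_ h2] := U01 x y.
    exact: le_trans h2.
  - have [] // : bm2 U'.
    by apply: bmM => //; apply: bmM; [exact: (bm_fst (bhn b)) | exact: (bm_snd (bhn b))].
exists U'; split => //.
- by move=> x y; have /andP[_ h1] := U'U x y; exact: le_trans (UW x y).
- have le1 : E2 nu U' <= E2 nu U - deg b.
    rewrite -E2B//; apply: E2_le; [exact: graphon_bm2 | exact: (bmB bU (bdeg b))|].
    move=> x y; have /andP[u0 _] := U01 x y; rewrite /U'.
    by case: (h x == b); case: (h y == b); rewrite /= ?(mulr0, mul0r, mulr1, subrr, subr0).
  rewrite (le_trans le1)//.
  (* With w = eps/(N+1): the norm of U is above eps - w/4, so the deleted degree is at least 3w/4,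
     and eps + w/4 - 3w/4 is below eps - w/4. *)
  pose w := eps / N.+1%:R.
  have e1 : eps / (4 * N.+1%:R) = w / 4 by rewrite /w invfM; ring.
  have e2 : E2 nu U / N.+1%:R >= (eps - w / 4) / N.+1%:R.
    by rewrite ler_pM2r ?invr_gt0// ltW// -e1.
  have e3 : w <= eps by rewrite /w ler_pdivrMr// ler_peMr ?(ltW eps0)// ler1n.
  have e4 : (eps - w / 4) / N.+1%:R >= (eps * 3 / 4) / N.+1%:R.
    by rewrite ler_pM2r ?invr_gt0//; move: (w) e3 => w' e3; lra.
  have e5 : eps * 3 / 4 / N.+1%:R = 3 * (w / 4) by rewrite /w; ring.
  have w0 : 0 <= w by rewrite divr_ge0 ?ltW.
  move: w0 Ueps hb; rewrite e1; move: e2 e4; rewrite e5.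
  set A := E2 nu U / _; set B := (eps - _) / _; move: (w) => w' *; lra.
have gWU' : graphon (fun x y => W x y - U' x y).
  by apply: graphonB => // x y; have /andP[_ h1] := U'U x y; exact: le_trans (UW x y).
apply: til_le => // t C [bt t0 tW tm] _.
have mhb : measurable [set x | (fun x => h x == b) x] by exact: mh.
have BT : btiling nu adj (fun x y => W x y - U x y) (avoid (fun x => h x == b) t).
  split.
  - exact: kbm_avoid.
  - by move=> x; exact: avoid_ge0.
  - move=> x /avoid_neq0[tx hx]; have := tW _ tx; congr (_ != 0).
    rewrite /Wtensor; apply: eq_bigr => i _; apply: eq_bigr => j _.
    by rewrite /U' (negbTE (hx i)) (negbTE (hx j)) !mulr1.
  - move=> x; rewrite (le_trans _ (tm x))//; apply: ler_sum => l _.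
    exact: marg_avoid_le.
have h2 := kint_avoid nu mhb bt t0.
apply: le_trans (leeD2r _ (kint_le_til BT)).
rewrite -EFinD lee_fin (le_trans h2)// lerD2l -(hq b).
have bsm : bm (fun x => \sum_(l < k) marg nu t l x) by apply: bm_sum => l; exact: bm_marg.
apply: Ex_le => //; first exact: bmM.
by move=> x; rewrite ler_piMr.
Qed.

End Slack.

(** * Step functions are dense in L1 *)

Section StepApproximation.
Context (d : measure_display) (Omega : measurableType d) (R : realType).
Variable nu : probability Omega R.
Implicit Types V W : Omega -> Omega -> R.

Definition label_measurable (T : finType) (c : Omega -> T) :=
  forall a, measurable [set x | c x == a].

Lemma label_sum (T : finType) (c : Omega -> T) (f : T -> R) x :
  f (c x) = \sum_a f a * (c x == a)%:R.
Proof.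
rewrite (bigD1 (c x))//= eqxx mulr1 big1 ?addr0// => a.
by rewrite eq_sym => /negbTE ->; rewrite mulr0.
Qed.

Lemma bm_label (T : finType) (c : Omega -> T) (f : T -> R) :
  label_measurable c -> bm (fun x => f (c x)).
Proof.
move=> mc; under eq_fun do rewrite (label_sum c f).
by apply: bm_sum => a; apply: bmZ; exact: bm_ind.
Qed.

Lemma label_sum2 (T : finType) (c : Omega -> T) (f : T -> T -> R) x y :
  f (c x) (c y) = \sum_a \sum_b f a b * ((c x == a)%:R * (c y == b)%:R).
Proof.
rewrite (label_sum c (fun a => f a (c y))); apply: eq_bigr => a _.
rewrite (label_sum c (f a)) mulr_suml; apply: eq_bigr => b _.
by rewrite mulrAC mulrA.
Qed.

Lemma bm2_ind2 (T : finType) (c : Omega -> T) a b : label_measurable c ->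
  bm2 (fun x y => (c x == a)%:R * (c y == b)%:R : R).
Proof.
by move=> mc; apply: bmM; [apply: (@bm_fst _ _ _ (fun x => (c x == a)%:R)) |
  apply: (@bm_snd _ _ _ (fun x => (c x == b)%:R))]; exact: bm_ind.
Qed.

Lemma bm2_label (T : finType) (c : Omega -> T) (f : T -> T -> R) :
  label_measurable c -> bm2 (fun x y => f (c x) (c y)).
Proof.
move=> mc; rewrite /bm2; under eq_fun do rewrite (label_sum2 c f).
by apply: bm_sum => a; apply: bm_sum => b; apply: bmZ; exact: bm2_ind2.
Qed.

Lemma label_pair (T T' : finType) (c : Omega -> T) (c' : Omega -> T') :
  label_measurable c -> label_measurable c' -> label_measurable (fun x => (c x, c' x)).
Proof.
move=> mc mc' [a b].
rewrite (_ : [set _ | _] = [set x | c x == a] `&` [set x | c' x == b]).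
  exact: measurableI.
by apply/seteqP; split => x /=; rewrite xpair_eqE => /andP.
Qed.

Lemma label_set (A : set Omega) : measurable A -> label_measurable (fun x => x \in A).
Proof.
move=> mA [].
  rewrite (_ : [set _ | _] = A)//; apply/seteqP; split => x /=.
    by move=> /eqP/set_mem.
  by move=> Ax; apply/eqP; exact: mem_set.
rewrite (_ : [set _ | _] = ~` A); first exact: measurableC.
apply/seteqP; split => x /=; rewrite eqbF_neg.
  by move=> /negP xA Ax; apply: xA; exact: mem_set.
by move=> xA; apply/negP => /set_mem.
Qed.

Definition step_approx V := forall e : R, 0 < e ->
  exists (T : finType) (c : Omega -> T) (f : T -> T -> R),
    label_measurable c /\ E2 nu (fun x y => `|V x y - f (c x) (c y)|) <= e.

Lemma step_approx_lim V : bm2 V -> (forall e, 0 < e -> exists V',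
   [/\ bm2 V', step_approx V' & E2 nu (fun x y => `|V x y - V' x y|) <= e]) -> step_approx V.
Proof.
move=> bV H e e0; have e2 : 0 < e / 2 by rewrite divr_gt0.
have [V' [bV' aV' VV']] := H _ e2.
have [T [c [f [mc hf]]]] := aV' _ e2.
exists T, c, f; split => //.
have bf := bm2_label f mc.
rewrite (splitr e) (le_trans _ (lerD VV' hf))// -E2D; last 2 first.
- by apply: bm_norm; exact: bmB.
- by apply: bm_norm; exact: bmB.
apply: E2_le; first by apply: bm_norm; exact: bmB.
  by apply: bmD; apply: bm_norm; exact: bmB.
by move=> x y; exact: ler_distD.
Qed.

Lemma step_approx_lin V W (a b : R) : bm2 V -> bm2 W -> step_approx V -> step_approx W ->
  step_approx (fun x y => a * V x y + b * W x y).
Proof.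
move=> bV bW aV aW e e0.
pose k := `|a| + `|b| + 1.
have k0 : 0 < k by rewrite ltr_wpDl// addr_ge0.
have ek : 0 < e / k by rewrite divr_gt0.
have [T [c [f [mc hf]]]] := aV _ ek.
have [T' [c' [f' [mc' hf']]]] := aW _ ek.
exists (T * T')%type, (fun x => (c x, c' x)), (fun s t => a * f s.1 t.1 + b * f' s.2 t.2).
split; first exact: label_pair.
have bf := bm2_label f mc; have bf' := bm2_label f' mc'.
have b1 : bm2 (fun x y => `|V x y - f (c x) (c y)|) by apply: bm_norm; exact: bmB.
have b2 : bm2 (fun x y => `|W x y - f' (c' x) (c' y)|) by apply: bm_norm; exact: bmB.
have : E2 nu (fun x y => `|a| * `|V x y - f (c x) (c y)| + `|b| * `|W x y - f' (c' x) (c' y)|) <= e.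
  rewrite E2D; [|exact: bmZ|exact: bmZ]; rewrite !E2Z//.
  apply: (@le_trans _ _ (`|a| * (e / k) + `|b| * (e / k))).
    by rewrite lerD// ler_wpM2l.
  by rewrite -mulrDl mulrCA ler_piMr ?ltW// ltr_pdivrMr// mul1r /k ltrDl.
apply: le_trans; apply: E2_le => /=.
- apply: bm_norm; apply: bmB; first by apply: bmD; exact: bmZ.
  by apply: bmD; apply: bmZ.
- by apply: bmD; exact: bmZ.
move=> x y; rewrite -!normrM (le_trans _ (ler_normD _ _))//.
by rewrite le_eqVlt; apply/orP; left; apply/eqP; congr `|_|; ring.
Qed.

(** Rectangles are step functions and form a pi-system generating the product sigma-algebra; the
    approximable sets form a lambda-system, being closed under proper differences and increasing
    unions. *)
Lemma step_approx_set (D : set (Omega * Omega)) : measurable D ->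
  step_approx (fun x y => \1_D (x, y)).
Proof.
have bD X : measurable X -> bm2 (fun x y => \1_X (x, y) : R).
  move=> mX; have := bm_indic R mX.
  by rewrite /bm2; congr bm; apply/funext => -[].
move: D; pose G := [set D | measurable D /\ step_approx (fun x y => \1_D (x, y))].
suff : measurable `<=` G by move=> + D mD => /(_ D mD)[].
rewrite measurable_prod_measurableType.
set C := [set A1 `*` A2 | A1 in measurable & A2 in measurable].
have CI : setI_closed C.
  move=> X Y [X1 mX1 [X2 mX2 <-{X}]] [Y1 mY1 [Y2 mY2 <-{Y}]].
  exists (X1 `&` Y1); first exact: measurableI.
  by exists (X2 `&` Y2); [exact: measurableI|rewrite setXI].
have CT : C setT by exists setT => //; exists setT => //; rewrite setXTT.
have CG : C `<=` G.
  move=> _ [A mA [B mB <-]]; split; first exact: measurableX.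
  move=> e e0; exists (bool * bool)%type, (fun x => (x \in A, x \in B)),
    (fun s t => (s.1 && t.2)%:R); split.
    by apply: label_pair; exact: label_set.
  rewrite (_ : (fun x y => _) = fun _ _ => 0) ?E2_cst ?ltW//.
  apply/funext => x; apply/funext => y /=; rewrite indicE in_setX/=.
  by rewrite subrr normr0.
suff lsG : lambda_system setT G by exact: lambda_system_subset.
split => //; first exact: CG.
- move=> X Y YX [mX aX] [mY aY]; split; first exact: measurableD.
  rewrite (_ : (fun x y => _) = fun x y => 1 * \1_X (x, y) + (-1) * \1_Y (x, y)).
    by apply: step_approx_lin => //; exact: bD.
  apply/funext => x; apply/funext => y; rewrite !indicE in_setD mul1r mulN1r.
  have [yY|] := boolP ((x, y) \in Y); last by rewrite subr0 andbT.
  by rewrite mem_set; [rewrite subrr | apply: YX; exact: set_mem].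
- move=> F ndF GF.
  have mF n : measurable (F n) by case: (GF n).
  have mU : measurable (\bigcup_n F n) by exact: bigcupT_measurable.
  split => //; apply: step_approx_lim; first exact: bD.
  move=> e e0.
  pose mm := (nu \x nu)%E.
  have Em X : measurable X -> mm X = (E2 nu (fun x y => \1_X (x, y)))%:E.
    move=> mX; rewrite -E2_prod; last exact: bD.
    rewrite -[mm X](_ : \int[mm]_z (\1_X z)%:E = _)%E.
      by apply: eq_integral => -[].
    by rewrite integral_indic// setIT.
  have cF : mm (F n) @[n --> \oo] --> mm (\bigcup_n F n).
    exact: nondecreasing_cvg_mu.
  have {}cF : E2 nu (fun x y => \1_(F n) (x, y)) @[n --> \oo] -->
      E2 nu (fun x y => \1_(\bigcup_n F n) (x, y)).
    move: cF; rewrite (Em _ mU) => /fine_cvg; apply: cvg_trans; apply: near_eq_cvg.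
    by apply: nearW => n /=; rewrite Em.
  have /cvgrPdist_le/(_ _ e0)[n _ /(_ n (leqnn n)) hn] := cF.
  exists (fun x y => \1_(F n) (x, y)); split; [exact: bD | by case: (GF n) | ].
  apply: le_trans hn; rewrite -E2B; [|exact: bD|exact: bD].
  rewrite (le_trans _ (ler_norm _))// le_eqVlt; apply/orP; left; apply/eqP.
  congr E2; apply/funext => x; apply/funext => y; rewrite ger0_norm// !indicE.
  have [h|] := boolP ((x, y) \in F n); last by rewrite subr0.
  by rewrite mem_set ?subrr//; exists n => //; exact: set_mem.
Qed.

(** Binary expansion: with D = {V >= 1/2} one has V = (1_D + V1)/2 where V1 = 2V - 1_D again takes
    values in [0,1]. Each round halves the error and uses one more set. *)
Lemma step_approx_unit V : unit_bm2 V -> step_approx V.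
Proof.
move=> uV; apply: step_approx_lim; first by case: uV.
suff H n : forall V, unit_bm2 V -> exists V', [/\ bm2 V', step_approx V' &
    E2 nu (fun x y => `|V x y - V' x y|) <= (2 ^+ n)^-1].
  move=> e e0; have [V' [bV' aV' hV']] := H (Num.truncn e^-1).+1 V uV.
  exists V'; split => //; rewrite (le_trans hV')// -[leRHS]invrK lef_pV2 ?posrE ?exprn_gt0 ?invr_gt0//.
  have ei : 0 < e^-1 by rewrite invr_gt0.
  have /andP[_ /ltW h] := truncn_itv (ltW ei).
  by rewrite (le_trans h)// -natrX ler_nat ltnW// ltn_expl.
elim: n => [|n IH] {uV}V [bV V01].
  exists (fun _ _ => 0); split.
  - exact: bm_cst.
  - move=> e e0; exists unit, (fun=> tt), (fun _ _ => 0); split.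
      by move=> []; rewrite (_ : [set _ | _] = setT)//; apply/seteqP; split.
    by rewrite (_ : (fun x y => _) = fun _ _ => 0) ?E2_cst ?ltW//; apply/funext => x; apply/funext => y; rewrite subrr normr0.
  - rewrite expr0 invr1 -[leRHS](E2_cst nu); apply: E2_le.
    + by apply: bm_norm; apply: bmB => //; exact: bm_cst.
    + exact: bm_cst.
    + by move=> x y; rewrite subr0 ger0_norm; have /andP[] := V01 x y.
pose D := [set z : Omega * Omega | (2^-1 <= V z.1 z.2)%R].
have mD : measurable D by exact: (measurable_pred_ge _ bV).
have bD : bm2 (fun x y => \1_D (x, y) : R).
  by have := bm_indic R mD; rewrite /bm2; congr bm; apply/funext => -[].
have DE x y : \1_D (x, y) = (2^-1 <= V x y)%R%:R :> R.
  rewrite indicE; congr (nat_of_bool _)%:R; apply/idP/idP => [/set_mem//|h].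
  exact: mem_set.
have bV2 : bm2 (fun x y => 2 * V x y - \1_D (x, y)) by apply: bmB => //; exact: bmZ.
have [|V' [bV' aV' hV']] := IH (fun x y => 2 * V x y - \1_D (x, y)).
  split => // x y; rewrite DE; have /andP[v0 v1] := V01 x y.
  by case: (leP 2^-1 (V x y)) => h /=; apply/andP; split; lra.
exists (fun x y => 2^-1 * \1_D (x, y) + 2^-1 * V' x y); split.
- by apply: bmD; exact: bmZ.
- by apply: step_approx_lin => //; exact: step_approx_set.
rewrite exprS invfM (_ : (fun x y => _) =
    fun x y => 2^-1 * `|2 * V x y - \1_D (x, y) - V' x y|).
  rewrite E2Z; last by apply: bm_norm; exact: bmB.
  by rewrite ler_wpM2l.
apply/funext => x; apply/funext => y.
by rewrite -[X in X * `|_|]ger0_norm// -normrM; congr `|_|; field.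
Qed.

(** Each block of the step function is one cut test. The constant depends on the values [f] alone
    and not on the labelling [c], so the same bound serves labellings that vary with n. *)
Lemma cut_bounded_label V (T : finType) (c : Omega -> T) (f : T -> T -> R) r :
  bm2 V -> label_measurable c -> cut_bounded nu V r ->
  `|E2 nu (fun x y => V x y * f (c x) (c y))| <= (\sum_a \sum_b `|f a b|) * r.
Proof.
move=> bV mc cV.
have bi a b : bm2 (fun x y => V x y * ((c x == a)%:R * (c y == b)%:R)).
  by apply: bmM => //; exact: bm2_ind2.
rewrite (_ : (fun x y => _) = fun x y =>
    \sum_a \sum_b f a b * (V x y * ((c x == a)%:R * (c y == b)%:R))); last first.
  apply/funext => x; apply/funext => y; rewrite (label_sum2 c f) mulr_sumr.
  by apply: eq_bigr => a _; rewrite mulr_sumr; apply: eq_bigr => b _; rewrite mulrCA.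
rewrite E2_sum; last by move=> a; apply: bm_sum => b; exact: (bmZ (f a b) (bi a b)).
rewrite (le_trans (ler_norm_sum _ _ _))// mulr_suml; apply: ler_sum => a _.
rewrite E2_sum; last by move=> b; exact: (bmZ (f a b) (bi a b)).
rewrite (le_trans (ler_norm_sum _ _ _))// mulr_suml; apply: ler_sum => b _.
rewrite E2Z// normrM ler_wpM2l//.
have := cV _ _ (mc a) (mc b); congr (`|E2 _ _| <= _).
apply/funext => x; apply/funext => y; rewrite !indicE; congr (_ * (_%:R * _%:R)).
  by congr nat_of_bool; apply/idP/idP => [/set_mem//|]; exact: mem_set.
by congr nat_of_bool; apply/idP/idP => [/set_mem//|]; exact: mem_set.
Qed.

End StepApproximation.

(** * Upper semicontinuity *)

Section UpperSemicontinuity.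
Context (d : measure_display) (Omega : measurableType d) (R : realType).
Variable nu : probability Omega R.
Hypothesis atomless_nu : atomless nu.
Variable k : nat.
Variable adj : rel 'I_k.
Implicit Types W U : Omega -> Omega -> R.

Lemma ex_inv_le (e : R) : 0 < e -> exists N, N.+1%:R^-1 <= e.
Proof.
move=> e0; have ei : 0 < e^-1 by rewrite invr_gt0.
exists (Num.truncn e^-1).
have /andP[_ /ltW h] := truncn_itv (ltW ei).
by rewrite -[leRHS]invrK lef_pV2 ?posrE ?invr_gt0 ?ltr0n.
Qed.

Lemma bm2_ratio W U : graphon W -> graphon U -> (forall x y, U x y <= W x y) ->
  bm2 (fun x y => if (W x y <= U x y)%R then 1 else U x y / W x y).
Proof.
move=> gW gU UW; have bW := graphon_bm2 gW; have bU := graphon_bm2 gU.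
have [_ W01 mW] := gW; have [_ U01 mU] := gU.
split; last first.
  exists 1 => z /=; case: (leP (W z.1 z.2) (U z.1 z.2)) => [_|UltW]; first by rewrite normr1.
  have /andP[u0 _] := U01 z.1 z.2.
  have w0 : 0 < W z.1 z.2 by exact: le_lt_trans UltW.
  by rewrite ger0_norm ?(divr_ge0 u0 (ltW w0))// ler_pdivrMr// mul1r ltW.
have mD : measurable [set z : Omega * Omega | (0 <= U z.1 z.2 - W z.1 z.2)%R].
  by apply: measurable_pred_ge; exact: bmB.
have mI := (bm_ind R mD).1.
(* The quotient is rewritten with the real power -1, which is known to be measurable, and an
   indicator of the set where U reaches W. *)
have -> : (fun z : Omega * Omega => if W z.1 z.2 <= U z.1 z.2 then 1 else U z.1 z.2 / W z.1 z.2) =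
  (fun z => (0 <= U z.1 z.2 - W z.1 z.2)%R%:R + (1 - (0 <= U z.1 z.2 - W z.1 z.2)%R%:R) *
     (U z.1 z.2 * (W z.1 z.2 `^ (-1)))).
  apply/funext => z; rewrite subr_ge0; case: leP => h.
    by rewrite subrr mul0r addr0.
  rewrite subr0 mul1r add0r powR_inv1//; by have /andP[] := W01 z.1 z.2.
apply: measurable_funD => //; apply: measurable_funM.
  by apply: measurable_funB => //; exact: measurable_cst.
apply: measurable_funM => //.
have h := measurableT_comp (@measurable_powR R (-1)) bW.1.
exact: h.
Qed.

(** Transplant a nearly optimal U' from W to Wn proportionally. The slack [eta] in the norm of U'
    absorbs the error in the norm of Un: half of it pays for approximating the ratio by a step
    function, half for the cut distance tested on that step function. *)
Lemma til_eps_upper W (Wn : nat -> Omega -> Omega -> R) (eps e : R) :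
  0 < eps -> 0 < e -> graphon W -> (forall n, graphon (Wn n)) ->
  cutnorm nu (fun x y => Wn n x y - W x y) @[n --> \oo] --> 0%E ->
  til_eps nu eps adj W \is a fin_num ->
  \forall n \near \oo, (til_eps nu eps adj (Wn n) <= til_eps nu eps adj W + e%:E)%E.
Proof.
move=> eps0 e0 gW gWn cW finW.
have e2 : 0 < e / 2 by rewrite divr_gt0.
have [_ [U [gU [UW Ueps]] <-] tU] := lb_ereal_inf_adherent e2 finW.
have [N hN] := ex_inv_le e2.
have N0 : 0 < N.+1%:R :> R by rewrite ltr0n.
pose eta := eps / (4 * N.+1%:R).
have eta0 : 0 < eta by rewrite divr_gt0// mulr_gt0.
have UE : E2 nu U <= eps + eta.
  by move: Ueps; rewrite L1norm_E2// lee_fin => /le_trans -> //; rewrite lerDl ltW.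
have [U' [gU' U'W U'eps tU']] := slack atomless_nu adj gW gU UW eps0 UE.
rewrite -/eta in U'eps.
(* The value 1 where W <= U' covers the zeros of W, and it makes Wn - Wn * r vanish wherever W - U'
   vanishes. *)
pose r x y := if (W x y <= U' x y)%R then 1 else U' x y / W x y.
have br : bm2 r by exact: bm2_ratio.
have [sW W01 mW] := gW; have [sU U01 mU] := gU'.
have r01 x y : 0 <= r x y <= 1.
  rewrite /r; case: (leP (W x y) (U' x y)) => [_|UltW]; first by rewrite ler01 lexx.
  have /andP[u0 _] := U01 x y.
  have w0 : 0 < W x y by exact: le_lt_trans UltW.
  by rewrite (divr_ge0 u0 (ltW w0))/= ler_pdivrMr// mul1r ltW.
have Wr x y : W x y * r x y = U' x y.
  rewrite /r; case: leP => [h|UltW].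
    by rewrite mulr1; apply/eqP; rewrite eq_le h U'W.
  have /andP[u0 _] := U01 x y.
  have w0 : 0 < W x y by exact: le_lt_trans UltW.
  by rewrite mulrC divfK// gt_eqF.
have eta4 : 0 < eta / 2 by rewrite divr_gt0.
have [T [c [f [mc hf]]]] := @step_approx_unit _ _ _ nu r (conj br r01) _ eta4.
pose S := \sum_a \sum_b `|f a b|.
have S0 : 0 <= S by apply: sumr_ge0 => a _; apply: sumr_ge0.
have S1 : 0 < S + 1 by rewrite ltr_wpDl.
have e3 : 0 < (eta / 2) / (S + 1) by rewrite divr_gt0.
have bWn n := graphon_bm2 (gWn n); have bW := graphon_bm2 gW.
have bD n : bm2 (fun x y => Wn n x y - W x y) by exact: (bmB (bWn n) bW).
have bf := bm2_label f mc.
have := cutnorm_cvg0 bD cW e3; apply: filterS => n cn.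
have [sWn Wn01 mWn] := gWn n.
pose Un x y := Wn n x y * r x y.
have gUn : graphon Un.
  split.
  - by move=> x y; rewrite /Un sWn /r sW sU.
  - move=> x y; have /andP[a0 a1] := Wn01 x y; have /andP[b0 b1] := r01 x y.
    by rewrite mulr_ge0// mulr_ile1.
  - by have [] : bm2 Un by exact: (bmM (bWn n) br).
have UnW x y : Un x y <= Wn n x y.
  have /andP[a0 a1] := Wn01 x y; have /andP[b0 b1] := r01 x y.
  by rewrite ler_piMr.
have bDr := bmM (bD n) br; have bDf := bmM (bD n) bf.
have brf := bm_norm (bmB br bf).
have Uneps : E2 nu Un <= eps.
  have h1 : E2 nu Un = E2 nu U' + E2 nu (fun x y => (Wn n x y - W x y) * r x y).
    rewrite -E2D; [|exact: graphon_bm2|exact: bDr].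
    by congr E2; apply/funext => x; apply/funext => y; rewrite -Wr /Un; ring.
  have h2 : E2 nu (fun x y => (Wn n x y - W x y) * r x y) <=
      E2 nu (fun x y => (Wn n x y - W x y) * f (c x) (c y)) +
      E2 nu (fun x y => `|r x y - f (c x) (c y)|).
    rewrite -E2D; [|exact: bDf|exact: brf].
    apply: E2_le; [exact: bDr | exact: (bmD bDf brf)|].
    move=> x y; rewrite -lerBlDl -mulrBr (le_trans (ler_norm _))// normrM ler_piMl//.
    have /andP[a0 a1] := Wn01 x y; have /andP[b0 b1] := W01 x y.
    by rewrite ler_norml; apply/andP; split; lra.
  have h3 : E2 nu (fun x y => (Wn n x y - W x y) * f (c x) (c y)) <= eta / 2.
    rewrite (le_trans (ler_norm _))// (le_trans (cut_bounded_label f (bD n) mc cn))//.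
    rewrite -/S mulrCA ler_piMr ?(ltW eta4)// ler_pdivrMr// mul1r lerDl//.
  by lra.
apply: (@le_trans _ _ (til nu adj (fun x y => Wn n x y - Un x y))).
  apply: ereal_inf_lbound; exists Un => //; split => //; split => //.
  by rewrite L1norm_E2.
apply: (@le_trans _ _ (til nu adj (fun x y => W x y - U' x y))).
  apply: eq_le_til => x y; apply: contra; rewrite subr_eq0 => /eqP WU.
  by rewrite /Un /r WU lexx mulr1 subrr.
apply: (le_trans tU'); rewrite (splitr e) EFinD addeA; apply: leeD; first exact: ltW.
by rewrite lee_fin.
Qed.

End UpperSemicontinuity.

(** * Block densities and energy *)

Section Weights.
Context (R : realType).

Lemma sqr_weighted_mean (S : finType) (w x : S -> R) : (forall s, 0 <= w s) ->
  \sum_s w s = 1 -> (\sum_s w s * `|x s|) ^+ 2 <= \sum_s w s * x s ^+ 2.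
Proof.
move=> w0 w1; set m := \sum_s _ * `|_|.
have : 0 <= \sum_s w s * (`|x s| - m) ^+ 2.
  by apply: sumr_ge0 => s _; rewrite mulr_ge0// sqr_ge0.
rewrite (eq_bigr (fun s => w s * x s ^+ 2 - 2 * m * (w s * `|x s|) + m ^+ 2 * w s)).
  rewrite !big_split/= sumrN -!mulr_sumr w1 -/m; lra.
by move=> s _; rewrite -[x s ^+ 2]real_normK ?num_real//; ring.
Qed.

(** Pythagoras: [f] is the conditional mean of [f'] on the fibres of [pi], so [f' - f] is orthogonal
    to functions of the coarse label. *)
Lemma energy_step (S' S : finType) (pi : S' -> S) (w' f' : S' -> R) (w f : S -> R) :
  (forall s, \sum_(s' | pi s' == s) w' s' = w s) ->
  (forall s, \sum_(s' | pi s' == s) w' s' * f' s' = w s * f s) ->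
  \sum_s' w' s' * (f' s' - f (pi s')) ^+ 2 =
  \sum_s' w' s' * f' s' ^+ 2 - \sum_s w s * f s ^+ 2.
Proof.
move=> ww wf.
rewrite (eq_bigr (fun s' => w' s' * f' s' ^+ 2 +
    (w' s' * f (pi s') ^+ 2 - 2 * (w' s' * f' s' * f (pi s'))))); last first.
  by move=> s' _; ring.
rewrite big_split/=; congr (_ + _).
rewrite (partition_big pi xpredT)//= -sumrN; apply: eq_bigr => s _.
rewrite (eq_bigr (fun s' => w' s' * f s ^+ 2 - w' s' * f' s' * (2 * f s))).
  by rewrite big_split/= sumrN -!mulr_suml ww wf; ring.
by move=> s' /eqP <-; ring.
Qed.

Variables (T' T : finType) (pi : T' -> T).

Definition energy (S : finType) (p : S -> R) (D : S -> S -> R) : R :=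
  \sum_a \sum_b p a * p b * D a b ^+ 2.

Definition step_dist (p' : T' -> R) (D' : T' -> T' -> R) (D : T -> T -> R) : R :=
  \sum_a \sum_b p' a * p' b * `|D' a b - D (pi a) (pi b)|.

(** The coarse data are obtained from the fine ones by adding masses and averaging densities over
    the fibres of [pi]. These are polynomial identities, so they pass to limits. *)
Definition refines (p' : T' -> R) D' (p : T -> R) D :=
  (forall a, \sum_(a' | pi a' == a) p' a' = p a) /\
  (forall a b, \sum_(a' | pi a' == a) \sum_(b' | pi b' == b) p' a' * p' b' * D' a' b' =
     p a * p b * D a b).

(** Jensen bounds the squared L1 distance of the two step kernels by their squared L2 distance,
    which is the energy increment. *)
Lemma step_dist_energy p' D' p D : (forall a, 0 <= p' a) -> \sum_a p' a = 1 ->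
  refines p' D' p D -> step_dist p' D' D ^+ 2 <= energy p' D' - energy p D.
Proof.
move=> p0 p1 [rp rD].
pose w' (s : T' * T') := p' s.1 * p' s.2.
pose f' (s : T' * T') := D' s.1 s.2.
pose w (s : T * T) := p s.1 * p s.2.
pose f (s : T * T) := D s.1 s.2.
pose pi2 (s : T' * T') := (pi s.1, pi s.2).
have ww s : \sum_(s' | pi2 s' == s) w' s' = w s.
  case: s => a b; rewrite /w /= -!rp big_distrlr /= pair_big.
  by apply: eq_bigl => -[a' b'] /=; rewrite xpair_eqE.
have wf s : \sum_(s' | pi2 s' == s) w' s' * f' s' = w s * f s.
  case: s => a b; rewrite /w /f /= -rD pair_big.
  by apply: eq_bigl => -[a' b'] /=; rewrite xpair_eqE.
have e1 : energy p' D' = \sum_s w' s * f' s ^+ 2 by rewrite /energy pair_big.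
have e2 : energy p D = \sum_s w s * f s ^+ 2 by rewrite /energy pair_big.
rewrite e1 e2 -(energy_step ww wf) /step_dist pair_big /=.
apply: (@sqr_weighted_mean _ w' (fun s => f' s - f (pi2 s))).
  by move=> s; rewrite mulr_ge0.
by rewrite /w' -(pair_big xpredT xpredT (fun a b => p' a * p' b)) /= -big_distrlr /= p1 mulr1.
Qed.

End Weights.

Lemma refines_comp (R : realType) (T2 T1 T0 : finType) (pi2 : T2 -> T1) (pi1 : T1 -> T0)
  (p2 : T2 -> R) D2 p1 D1 p0 D0 :
  refines pi2 p2 D2 p1 D1 -> refines pi1 p1 D1 p0 D0 ->
  refines (pi1 \o pi2) p2 D2 p0 D0.
Proof.
move=> [rp2 rD2] [rp1 rD1]; split => [a|a b].
  rewrite -rp1 (partition_big pi2 (fun a1 => pi1 a1 == a))//=.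
  apply: eq_bigr => a1 /eqP e1; rewrite -rp2; apply: eq_bigl => a2.
  by case: (eqVneq (pi2 a2) a1) => [->|]; rewrite ?andbF// e1 eqxx.
rewrite -rD1 (partition_big pi2 (fun a1 => pi1 a1 == a))//=.
apply: eq_bigr => a1 /eqP e1.
rewrite (eq_bigr (fun a2 => \sum_(b1 | pi1 b1 == b) \sum_(b2 | pi2 b2 == b1)
    p2 a2 * p2 b2 * D2 a2 b2)).
  rewrite exchange_big /=; apply: eq_bigr => b1 _; rewrite -rD2.
  by apply: eq_bigl => a2; case: (eqVneq (pi2 a2) a1) => [->|]; rewrite ?andbF// e1 eqxx.
move=> a2 _; rewrite (partition_big pi2 (fun b1 => pi1 b1 == b))//=.
apply: eq_bigr => b1 /eqP e2; apply: eq_bigl => b2.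
by case: (eqVneq (pi2 b2) b1) => [->|]; rewrite ?andbF// e2 eqxx.
Qed.

(** * Block densities and weak regularity *)

Section Densities.
Context (d : measure_display) (Omega : measurableType d) (R : realType).
Variable nu : probability Omega R.
Implicit Types V W : Omega -> Omega -> R.

Section OneLabelling.
Variables (T : finType) (c : Omega -> T).
Hypothesis mc : label_measurable c.

Definition mass a : R := Ex nu (fun x => (c x == a)%:R).

Definition block_int V a b : R :=
  E2 nu (fun x y => V x y * ((c x == a)%:R * (c y == b)%:R)).

(** On a block of mass zero the quotient is 0, and [mass_dens] still holds because the block
    integral vanishes too. *)
Definition dens V a b : R := block_int V a b / (mass a * mass b).

Definition avg V x y : R := dens V (c x) (c y).

Let bi a : bm (fun x => (c x == a)%:R : R). Proof. exact: bm_ind. Qed.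

Lemma mass_ge0 a : 0 <= mass a. Proof. exact: Ex_ge0. Qed.

Lemma sum_mass : \sum_a mass a = 1.
Proof.
rewrite -Ex_sum// -[RHS](Ex_cst nu); congr Ex; apply/funext => x.
rewrite [RHS](label_sum c (fun=> 1 : R) x).
by apply: eq_bigr => a _; rewrite mul1r.
Qed.

Lemma mass_le1 a : mass a <= 1.
Proof.
by rewrite -sum_mass (bigD1 a)//= lerDl sumr_ge0// => b _; exact: mass_ge0.
Qed.

Lemma Ex_label_fun (f : T -> R) g : bm g ->
  Ex nu (fun x => f (c x) * g x) = \sum_a f a * Ex nu (fun x => (c x == a)%:R * g x).
Proof.
move=> bg; have b a : bm (fun x => (c x == a)%:R * g x) by exact: bmM.
rewrite (eq_bigr (fun a => Ex nu (fun x => f a * ((c x == a)%:R * g x)))).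
  rewrite -Ex_sum; last by move=> a; exact: (bmZ (f a) (b a)).
  congr Ex; apply/funext => x; rewrite (label_sum c f x) mulr_suml.
  by apply: eq_bigr => a _; rewrite mulrA.
by move=> a _; rewrite ExZ.
Qed.

Variable V : Omega -> Omega -> R.
Hypothesis uV : unit_bm2 V.

Let bV : bm2 V. Proof. by case: uV. Qed.

Let bVi a b : bm2 (fun x y => V x y * ((c x == a)%:R * (c y == b)%:R)).
Proof. by apply: bmM => //; exact: bm2_ind2. Qed.

Lemma block_int_bounds a b : 0 <= block_int V a b <= mass a * mass b.
Proof.
have [_ V01] := uV; apply/andP; split.
  by apply: E2_ge0 => x y; have /andP[v0 _] := V01 x y; rewrite !mulr_ge0.
rewrite -E2_prodfun//; apply: E2_le => //; first exact: bm2_ind2.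
by move=> x y; have /andP[v0 v1] := V01 x y; rewrite ler_piMl// mulr_ge0.
Qed.

Lemma mass_dens a b : mass a * mass b * dens V a b = block_int V a b.
Proof.
rewrite /dens; have [m0|m0] := eqVneq (mass a * mass b) 0.
  have := block_int_bounds a b; rewrite m0 mul0r => h.
  by apply/esym/eqP; rewrite eq_le andbC.
by rewrite mulrC divfK.
Qed.

Lemma dens_bounds a b : 0 <= dens V a b <= 1.
Proof.
have /andP[b0 b1] := block_int_bounds a b.
have m0 : 0 <= mass a * mass b by rewrite mulr_ge0// mass_ge0.
rewrite divr_ge0//=.
move: m0; rewrite le_eqVlt => /predU1P[m0|m0].
  by rewrite /dens -m0 invr0 mulr0.
by rewrite ler_pdivrMr// mul1r.
Qed.

Lemma dens_sym a b : (forall x y, V x y = V y x) -> dens V a b = dens V b a.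
Proof.
move=> sV; rewrite /dens [mass a * _]mulrC; congr (_ / _).
rewrite /block_int E2_swap//; congr E2; apply/funext => x; apply/funext => y.
by rewrite sV [X in _ * X]mulrC.
Qed.

Lemma E2_step (f : T -> T -> R) :
  E2 nu (fun x y => V x y * f (c x) (c y)) = \sum_a \sum_b mass a * mass b * dens V a b * f a b.
Proof.
have bz a b : bm2 (fun x y => f a b * (V x y * ((c x == a)%:R * (c y == b)%:R))).
  exact: (bmZ (f a b) (bVi a b)).
rewrite (_ : (fun x y => _) = fun x y =>
    \sum_a \sum_b f a b * (V x y * ((c x == a)%:R * (c y == b)%:R))); last first.
  apply/funext => x; apply/funext => y; rewrite (label_sum2 c f) mulr_sumr.
  by apply: eq_bigr => a _; rewrite mulr_sumr; apply: eq_bigr => b _; rewrite mulrCA.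
rewrite E2_sum; last by move=> a; apply: bm_sum => b; exact: bz.
apply: eq_bigr => a _; rewrite E2_sum//; apply: eq_bigr => b _.
by rewrite E2Z// mass_dens mulrC.
Qed.

Lemma unit_avg : unit_bm2 (avg V).
Proof.
split; first exact: (bm2_label (dens V) mc).
by move=> x y; exact: dens_bounds.
Qed.

End OneLabelling.

Lemma E2_label (T : finType) (c : Omega -> T) (f : T -> T -> R) : label_measurable c ->
  E2 nu (fun x y => f (c x) (c y)) = \sum_a \sum_b mass c a * mass c b * f a b.
Proof.
move=> mc; have u1 : unit_bm2 (fun _ _ : Omega => 1 : R).
  by split; [exact: bm_cst | move=> x y; rewrite ler01 lexx].
rewrite -[LHS](_ : E2 nu (fun x y => 1 * f (c x) (c y)) = _); last first.
  by congr E2; apply/funext => x; apply/funext => y; rewrite mul1r.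
rewrite (E2_step mc u1); apply: eq_bigr => a _; apply: eq_bigr => b _.
rewrite mass_dens//; congr (_ * _); rewrite /block_int -E2_prodfun; try exact: bm_ind.
by congr E2; apply/funext => x; apply/funext => y; rewrite mul1r.
Qed.

Lemma refines_label (T' T : finType) (pi : T' -> T) (c' : Omega -> T') (c : Omega -> T) V :
  label_measurable c' -> label_measurable c -> (forall x, pi (c' x) = c x) -> unit_bm2 V ->
  refines pi (mass c') (dens c' V) (mass c) (dens c V).
Proof.
move=> mc' mc pic uV; have [bV _] := uV.
have fibre a x : (c x == a)%:R = \sum_(a' | pi a' == a) (c' x == a')%:R :> R.
  rewrite -pic; have [e|e] := eqVneq (pi (c' x)) a.
    rewrite (bigD1 (c' x)) ?e//= eqxx big1 ?addr0// => a' /andP[_].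
    by rewrite eq_sym => /negbTE ->.
  rewrite big1// => a' /eqP pa; case: eqP => // ca.
  by move: e; rewrite ca pa eqxx.
split => [a|a b].
  rewrite -Ex_sum; last by move=> a'; exact: bm_ind.
  by congr Ex; apply/funext => x; rewrite fibre.
rewrite mass_dens//; under eq_bigr do under eq_bigr do rewrite mass_dens//.
have bi a' b' : bm2 (fun x y => V x y * ((c' x == a')%:R * (c' y == b')%:R)).
  by apply: bmM => //; exact: bm2_ind2.
under eq_bigr do rewrite -E2_sum//.
rewrite -E2_sum; last by move=> a'; apply: bm_sum => b'; exact: bi.
congr E2; apply/funext => x; apply/funext => y.
rewrite !fibre big_distrlr/= mulr_sumr; apply: eq_bigr => a' _.
by rewrite mulr_sumr.
Qed.

(** The supremum defining the cut norm need not be attained, so a rectangle reaching at least half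
    of it is taken; when the supremum is zero, any rectangle serves. *)
Lemma cut_witness V : bm2 V -> exists A B, [/\ measurable A, measurable B &
  cut_bounded nu V (2 * `|E2 nu (fun x y => V x y * (\1_A x * \1_B y))|)].
Proof.
move=> bV; pose S := [set r | exists A B, [/\ measurable A, measurable B &
  r = `|E2 nu (fun x y => V x y * (\1_A x * \1_B y))|]].
have bVi A B : measurable A -> measurable B -> bm2 (fun x y => V x y * (\1_A x * \1_B y)).
  by move=> mA mB; apply: bmM => //; apply: bmM;
    [exact: (bm_fst (bm_indic _ mA)) | exact: (bm_snd (bm_indic _ mB))].
have supS : has_sup S.
  split.
    by exists `|E2 nu (fun x y => V x y * (\1_setT x * \1_setT y))|; exists setT, setT.
  have [_ [M VM]] := bV.
  exists M => _ [A [B [mA mB ->]]]; rewrite (le_trans (E2_norm nu (bVi _ _ mA mB)))//.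
  rewrite -[leRHS](E2_cst nu); apply: E2_le.
  - by apply: bm_norm; exact: bVi.
  - exact: bm_cst.
  - move=> x y; rewrite !normrM !indicE; have := VM (x, y) => /=.
    by case: (x \in A); case: (y \in B); rewrite /= ?(normr1, normr0, mulr1, mulr0)//; exact: le_trans.
have S0 : 0 <= sup S.
  have [[r Sr] ubS] := supS.
  by have [A [B [_ _ rE]]] := Sr; apply: le_trans (ub_le_sup ubS Sr); rewrite rE.
move: S0; rewrite le_eqVlt => /predU1P[S0|S0].
  exists setT, setT; split => // A B mA mB.
  have : `|E2 nu (fun x y => V x y * (\1_A x * \1_B y))| <= sup S.
    by apply: ub_le_sup; [case: supS | exists A, B].
  by rewrite -S0 => /le_trans -> //; rewrite mulr_ge0.
have h2 : 0 < sup S / 2 by rewrite divr_gt0.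
have [_ [A [B [mA mB ->]]] hAB] := sup_adherent h2 supS.
exists A, B; split => // A' B' mA' mB'.
have : `|E2 nu (fun x y => V x y * (\1_A' x * \1_B' y))| <= sup S.
  by apply: ub_le_sup; [case: supS | exists A', B'].
lra.
Qed.

Definition refine_by (T : finType) (c : Omega -> T) (AB : set Omega * set Omega) :
  Omega -> T * (bool * bool) := fun x => (c x, (x \in AB.1, x \in AB.2)).

Definition regular_pair (T : finType) (V : Omega -> Omega -> R) (c : Omega -> T) :
    set Omega * set Omega :=
  xget (set0, set0) [set AB | [/\ measurable AB.1, measurable AB.2 &
    cut_bounded nu (fun x y => V x y - avg c V x y)
      (2 * `|E2 nu (fun x y => (V x y - avg c V x y) * (\1_(AB.1) x * \1_(AB.2) y))|)]].

(** The regularity step. After refining by the witnessing sets, their rectangle is a union of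
    blocks, so the integral of V - avg over it is a sum over refined blocks of the change in
    density, at most the step distance. A small energy increment therefore means that the old
    averages are close to V in cut norm. *)
Lemma regular_pairP (T : finType) V (c : Omega -> T) : label_measurable c -> unit_bm2 V ->
  let c' := refine_by c (regular_pair V c) in
  label_measurable c' /\ cut_bounded nu (fun x y => V x y - avg c V x y)
    (2 * step_dist fst (mass c') (dens c' V) (dens c V)).
Proof.
move=> mc uV c'.
have [bV _] := uV; have [bA _] := unit_avg mc uV.
have [mA mB cV] : [set AB | [/\ measurable AB.1, measurable AB.2 &
    cut_bounded nu (fun x y => V x y - avg c V x y)
      (2 * `|E2 nu (fun x y => (V x y - avg c V x y) * (\1_(AB.1) x * \1_(AB.2) y))|)]]
    (regular_pair V c).
  apply: xgetPex; have [A [B H]] := @cut_witness (fun x y => V x y - avg c V x y) (bmB bV bA).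
  by exists (A, B).
have mc' : label_measurable c'.
  by apply: label_pair => //; apply: label_pair; exact: label_set.
split => // A B mA' mB'; rewrite (le_trans (cV _ _ mA' mB'))// ler_wpM2l//.
pose f (s t : T * (bool * bool)) : R := (s.2.1)%:R * (t.2.2)%:R.
have bf := bm2_label f mc'.
have -> : (fun x y => (V x y - avg c V x y) *
    (\1_((regular_pair V c).1) x * \1_((regular_pair V c).2) y)) =
  (fun x y => V x y * f (c' x) (c' y) - dens c V (c' x).1 (c' y).1 * f (c' x) (c' y)).
  by apply/funext => x; apply/funext => y; rewrite /f /= -!indicE mulrBl.
rewrite E2B; last 2 first.
- exact: (bmM bV bf).
- exact: (bm2_label (fun s t => dens c V s.1 t.1 * f s t) mc').
rewrite (E2_step mc' uV) (E2_label (fun s t => dens c V s.1 t.1 * f s t) mc').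
rewrite -sumrB (le_trans (ler_norm_sum _ _ _))//; apply: ler_sum => a _.
rewrite -sumrB (le_trans (ler_norm_sum _ _ _))//; apply: ler_sum => b _.
have m0 : 0 <= mass c' a * mass c' b by rewrite mulr_ge0// mass_ge0.
rewrite -mulrA -mulrBr normrM (ger0_norm m0) ler_wpM2l// -mulrBl normrM ler_piMr//.
by rewrite /f; case: a.2.1; case: b.2.2; rewrite /= ?(mulr0, mul0r, mulr1) ?normr0 ?normr1.
Qed.

(** The label set at level [i] depends on neither the kernel nor n, so for a fixed label the masses
    and densities form sequences in n whose limits can be taken. *)
Fixpoint ltype (T0 : finType) (i : nat) : finType :=
  if i is i'.+1 then (ltype T0 i' * (bool * bool))%type else T0.

Fixpoint reglab (T0 : finType) (V : Omega -> Omega -> R) (c0 : Omega -> T0) (i : nat) :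
    Omega -> ltype T0 i :=
  match i with
  | 0 => c0
  | i'.+1 => refine_by (reglab V c0 i') (regular_pair V (reglab V c0 i'))
  end.

Fixpoint lproj (T0 : finType) (m i : nat) : ltype T0 (m + i) -> ltype T0 i :=
  match m with
  | 0 => fun a => a
  | m'.+1 => fun a => lproj (m := m') a.1
  end.

Lemma reglab_measurable (T0 : finType) V (c0 : Omega -> T0) i : label_measurable c0 ->
  unit_bm2 V -> label_measurable (reglab V c0 i).
Proof.
by move=> mc uV; elim: i => //= i IH; have [] := regular_pairP IH uV.
Qed.

End Densities.

(** * Limits along an ultrafilter *)

Section FastLimit.
Context (d : measure_display) (Omega : measurableType d) (R : realType).
Variable nu : probability Omega R.

Lemma limn_sup_bounds (u : nat -> R) r a b : (forall n, 0 <= u n <= 1) ->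
  (forall n, (r <= n)%N -> a <= u n <= b) -> a <= limn_sup u <= b.
Proof.
move=> u01 uab.
have bu : bounded_fun u.
  exists 1; split; rewrite ?num_real// => M M1 n _.
  by have /andP[h0 h1] := u01 n; rewrite /= ger0_norm// (le_trans h1)// ltW.
have ubu n : has_ubound (sdrop u n).
  by exists 1 => _ [m _ <-]; have /andP[] := u01 m.
have sup_ge n m : (n <= m)%N -> u m <= sups u n.
  by move=> nm; apply: ub_le_sup => //; exists m.
have lbs : has_lbound (range (sups u)).
  by exists 0 => _ [n _ <-]; rewrite (le_trans _ (sup_ge n n (leqnn n)))//; have /andP[] := u01 n.
rewrite limn_supE//; apply/andP; split.
  apply: lb_le_inf; first by exists (sups u 0%N), 0%N.
  move=> _ [n _ <-]; rewrite (le_trans _ (sup_ge n (maxn n r) (leq_maxl _ _)))//.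
  by have /andP[] := uab _ (leq_maxr n r).
apply: (@le_trans _ _ (sups u r)).
  by apply: ge_inf => //; exists r.
apply: ge_sup; first by exists (u r), r => //=.
by move=> _ [n /= rn <-]; have /andP[] := uab _ rn.
Qed.

Variable f : nat -> Omega -> Omega -> R.
Hypothesis uf : forall n, unit_bm2 (f n).
Hypothesis fast : forall n, E2 nu (fun x y => `|f n.+1 x y - f n x y|) <= (2 ^+ n)^-1.

(** The limit superior is defined at every point and keeps symmetry and bounds, with no exceptional
    null set to treat. *)
Definition fast_lim x y : R := limn_sup (fun n => f n x y).

Lemma unit_fast_lim : unit_bm2 fast_lim.
Proof.
have f01 n x y : 0 <= f n x y <= 1 by case: (uf n).
have b01 x y : 0 <= fast_lim x y <= 1 by apply: (@limn_sup_bounds _ 0).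
split => //; split; last first.
  by exists 1 => z; have /andP[h0 h1] := b01 z.1 z.2; rewrite ger0_norm.
apply: measurable_fun_limn_sup.
- by move=> z _; exists 1 => _ [n _ <-]; have /andP[] := f01 n z.1 z.2.
- by move=> z _; exists 0 => _ [n _ <-]; have /andP[] := f01 n z.1 z.2.
- by move=> n; case: (uf n) => -[].
Qed.

(** Pointwise, the distance from [f r] is at most the sum of the later increments, possibly
    infinite; integrating the series termwise gives a geometric tail. *)
Lemma fast_lim_dist r : E2 nu (fun x y => `|fast_lim x y - f r x y|) <= 2 * (2 ^+ r)^-1.
Proof.
have f01 n x y : 0 <= f n x y <= 1 by case: (uf n).
have bf n : bm2 (f n) by case: (uf n).
have [bl _] := unit_fast_lim.
pose g s x y := `|f (r + s).+1 x y - f (r + s)%N x y|.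
have g0 s x y : 0 <= g s x y by exact: normr_ge0.
have bg s : bm2 (g s) by exact: (bm_norm (bmB (bf _) (bf _))).
have bd : bm2 (fun x y => `|fast_lim x y - f r x y|) by exact: (bm_norm (bmB bl (bf _))).
rewrite -lee_fin -(E2_prod nu bd).
have ptw z : ((`|fast_lim z.1 z.2 - f r z.1 z.2|)%:E <= \sum_(s <oo) (g s z.1 z.2)%:E)%E.
  case: z => x y /=; set S := (\sum_(s <oo) _)%E.
  have S0 : (0 <= S)%E by apply: nneseries_ge0 => n _ _; rewrite lee_fin g0.
  have part m : ((\sum_(0 <= s < m) g s x y)%:E <= S)%E.
    rewrite -sumEFin; apply: (@nneseries_lim_ge R (fun s => (g s x y)%:E) xpredT 0%N m).
    by move=> n _ _; rewrite lee_fin g0.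
  have tele m : `|f (r + m)%N x y - f r x y| <= \sum_(0 <= s < m) g s x y.
    elim: m => [|m IH]; first by rewrite big_geq// addn0 subrr normr0.
    rewrite big_nat_recr//= addnS (le_trans (ler_distD (f (r + m)%N x y) _ _))// addrC lerD//.
  have [Sfin|] := boolP (S \is a fin_num); last first.
    by rewrite ge0_fin_numE// -leNgt leye_eq => /eqP ->; rewrite leey.
  rewrite -(fineK Sfin) lee_fin ler_norml.
  have /andP[h1 h2] : f r x y - fine S <= fast_lim x y <= f r x y + fine S.
    apply: (@limn_sup_bounds _ r) => // n rn.
    have h : `|f n x y - f r x y| <= fine S.
      rewrite -(subnKC rn) (le_trans (tele _))// -lee_fin fineK//.
    by rewrite -ler_distl.
  by apply/andP; split; lra.
apply: (@le_trans _ _ (\int[(nu \x nu)%E]_z (\sum_(s <oo) (g s z.1 z.2)%:E))%E).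
  apply: ge0_le_integral => //.
  - by apply/measurable_EFinP; case: bd.
  - apply: ge0_emeasurable_sum => //; first by move=> s z _ _; rewrite lee_fin g0.
    by move=> s _; apply/measurable_EFinP; case: (bg s).
rewrite integral_nneseries//; last 2 first.
- by move=> s; apply/measurable_EFinP; case: (bg s).
- by move=> s z _; rewrite lee_fin g0.
rewrite (eq_eseriesr (g := fun s => (E2 nu (g s))%:E)); last first.
  by move=> s _; exact: E2_prod.
apply: lime_le.
  by apply: is_cvg_nneseries => s _ _; rewrite lee_fin; exact: E2_ge0.
apply: nearW => n; rewrite sumEFin lee_fin.
apply: (@le_trans _ _ (\sum_(0 <= s < n) (2 ^+ r)^-1 * (2 ^+ s)^-1)).
  by apply: ler_sum => s _; rewrite (le_trans (fast _))// exprD invfM.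
rewrite -mulr_sumr mulrC ler_pM2r ?invr_gt0 ?exprn_gt0//.
suff -> : \sum_(0 <= s < n) (2 ^+ s : R)^-1 = 2 - 2 * (2 ^+ n)^-1.
  by rewrite lerBlDr lerDl mulr_ge0// invr_ge0 exprn_ge0.
elim: n => [|n IH]; first by rewrite big_geq// expr0 invr1 mulr1 subrr.
rewrite big_nat_recr//= IH exprS invfM mulrA divff// mul1r.
by rewrite -addrA; congr (_ + _); ring.
Qed.

End FastLimit.

(** * Limits along an ultrafilter *)

Section UltraLimits.
Context (R : realType) (F : set_system nat).
Hypothesis UF : UltraFilter F.

Let PF : ProperFilter F. Proof. exact: ultra_proper. Qed.

Definition ulim (u : nat -> R) : R := lim (u n @[n --> F]).

(** Compactness of [0,1]: the image of an ultrafilter is an ultrafilter and so converges. Countably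
    many sequences thus converge along one filter, without diagonal extraction. *)
Lemma ulim_cvg u : (forall n, 0 <= u n <= 1) -> u n @[n --> F] --> ulim u.
Proof.
move=> u01; have UuF : UltraFilter (u n @[n --> F]).
  split; first exact: fmap_proper_filter.
  move=> G PG sG; apply/seteqP; split; last exact: sG.
  move=> A GA; have [//|FnA] := in_ultra_setVsetC (u @^-1` A) UF.
  have : G (~` A) by apply: sG.
  move=> /(filterI GA); rewrite setICr => /filter_ex[]. by [].
have := @segment_compact R 0 1; rewrite compact_ultra => /(_ _ UuF)[].
  by apply: nearW => n /=; rewrite in_itv/= u01.
move=> l [_ ul]; suff -> : ulim u = l by exact: ul.
exact: cvg_lim ul.
Qed.

Lemma ulim01 u : (forall n, 0 <= u n <= 1) -> 0 <= ulim u <= 1.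
Proof.
move=> u01; have cu := ulim_cvg u01; apply/andP; split.
  by apply: (cvgr_to_ge cu); apply: nearW => n; have /andP[] := u01 n.
by apply: (cvgr_to_le cu); apply: nearW => n; have /andP[] := u01 n.
Qed.

Lemma cvg_fsum (I : Type) (s : seq I) (P : pred I) (u : I -> nat -> R) (l : I -> R) :
  (forall i, u i n @[n --> F] --> l i) ->
  \sum_(i <- s | P i) u i n @[n --> F] --> \sum_(i <- s | P i) l i.
Proof.
move=> cu; elim: s => [|i s IH].
  rewrite big_nil; under eq_cvg do rewrite big_nil; exact: cvg_cst.
rewrite big_cons; under eq_cvg do rewrite big_cons.
by case: (P i) => //; apply: cvgD.
Qed.

Lemma cvg_fprod (I : Type) (s : seq I) (P : pred I) (u : I -> nat -> R) (l : I -> R) :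
  (forall i, u i n @[n --> F] --> l i) ->
  \prod_(i <- s | P i) u i n @[n --> F] --> \prod_(i <- s | P i) l i.
Proof.
move=> cu; elim: s => [|i s IH].
  rewrite big_nil; under eq_cvg do rewrite big_nil; exact: cvg_cst.
rewrite big_cons; under eq_cvg do rewrite big_cons.
by case: (P i) => //; apply: cvgM.
Qed.

Variables (T' T : finType) (pi : T' -> T).
Variables (p' : nat -> T' -> R) (D' : nat -> T' -> T' -> R).
Variables (p : nat -> T -> R) (D : nat -> T -> T -> R).
Variables (q' : T' -> R) (G' : T' -> T' -> R) (q : T -> R) (G : T -> T -> R).
Hypothesis cp' : forall a, p' n a @[n --> F] --> q' a.
Hypothesis cD' : forall a b, D' n a b @[n --> F] --> G' a b.
Hypothesis cp : forall a, p n a @[n --> F] --> q a.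
Hypothesis cD : forall a b, D n a b @[n --> F] --> G a b.

Lemma cvg_energy : energy (p' n) (D' n) @[n --> F] --> energy q' G'.
Proof.
apply: cvg_fsum => a; apply: cvg_fsum => b; apply: cvgM; first exact: cvgM.
by under eq_cvg do rewrite expr2; rewrite expr2; apply: cvgM.
Qed.

Lemma refines_lim : (forall n, refines pi (p' n) (D' n) (p n) (D n)) -> refines pi q' G' q G.
Proof.
move=> Hr; split => [a|a b].
  have h1 : \sum_(a' | pi a' == a) p' n a' @[n --> F] --> \sum_(a' | pi a' == a) q' a'.
    by apply: cvg_fsum.
  have h2 : \sum_(a' | pi a' == a) p' n a' @[n --> F] --> q a.
    by under eq_cvg do rewrite (Hr _).1; exact: cp.
  by rewrite -(cvg_lim _ h1)// (cvg_lim _ h2).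
have h1 : \sum_(a' | pi a' == a) \sum_(b' | pi b' == b) p' n a' * p' n b' * D' n a' b' @[n --> F]
    --> \sum_(a' | pi a' == a) \sum_(b' | pi b' == b) q' a' * q' b' * G' a' b'.
  by apply: cvg_fsum => a'; apply: cvg_fsum => b'; apply: cvgM => //; exact: cvgM.
have h2 : \sum_(a' | pi a' == a) \sum_(b' | pi b' == b) p' n a' * p' n b' * D' n a' b' @[n --> F]
    --> q a * q b * G a b.
  by under eq_cvg do rewrite (Hr _).2; apply: cvgM => //; exact: cvgM.
by rewrite -(cvg_lim _ h1)// (cvg_lim _ h2).
Qed.

End UltraLimits.

(** * Realising prescribed masses by a refined labelling *)

Section Realization.
Context (d : measure_display) (Omega : measurableType d) (R : realType).
Variable nu : probability Omega R.
Hypothesis atomless_nu : atomless nu.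

Lemma split_label (T T2 : finType) (t2 : T2) (c : Omega -> T) (q : T * T2 -> R) :
  label_measurable c -> (forall s, 0 <= q s) ->
  (forall a, \sum_b q (a, b) = mass nu c a) ->
  exists h : Omega -> T2, label_measurable h /\
    forall s, mass nu (fun x => (c x, h x)) s = q s.
Proof.
move=> mc q0 qc.
have /choice[h hP] : forall a, exists h : Omega -> T2, label_measurable h /\
    forall b, fine (nu ([set x | c x == a] `&` [set x | h x == b])) = q (a, b).
  move=> a; apply: (atomless_fsplit t2 atomless_nu (mc a)) => //.
  by rewrite qc fprob_Ex.
have mh a : label_measurable (h a) by case: (hP a).
have bi (S : finType) (g : Omega -> S) b : label_measurable g ->
    bm (fun x => (g x == b)%:R : R) by move=> mg; exact: bm_ind.
have mh' : label_measurable (fun x => h (c x) x).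
  move=> b.
  pose ind (x : Omega) : R := \sum_a (c x == a)%:R * (h a x == b)%:R.
  have bind : bm ind by apply: bm_sum => a; apply: bmM; exact: bi.
  have indE x : ind x = (h (c x) x == b)%:R.
    rewrite /ind (bigD1 (c x))//= eqxx mul1r big1 ?addr0// => a.
    by rewrite eq_sym => /negbTE ->; rewrite mul0r.
  rewrite (_ : [set _ | _] = [set x | (1 <= ind x)%R]); first exact: measurable_pred_ge.
  by apply/seteqP; split => x /=; rewrite indE; case: eqP => //=; rewrite ler10.
exists (fun x => h (c x) x); split => // -[a b].
have mcb : label_measurable (fun x => (c x, h (c x) x)) by exact: label_pair.
have [_ <-] := hP a; rewrite /mass -fprob_Ex//; congr (fine (nu _)).
apply/seteqP; split => x /=; rewrite xpair_eqE.
  by move=> /andP[/eqP ca]; rewrite ca => hb; split => //; rewrite eqxx.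
by move=> [/eqP ca hb]; rewrite ca eqxx.
Qed.

End Realization.

(** * The limit kernel of a sequence of graphons *)

Section LimitKernel.
Context (d : measure_display) (Omega : measurableType d) (R : realType).
Variable nu : probability Omega R.
Hypothesis atomless_nu : atomless nu.
Variables (F : set_system nat) (V : nat -> Omega -> Omega -> R).
Hypotheses (UF : UltraFilter F) (gV : forall n, graphon (V n)).
Variables (T0 : finType) (c0 : Omega -> T0).
Hypothesis mc0 : label_measurable c0.

Let PF : ProperFilter F. Proof. exact: ultra_proper. Qed.

Let uV n : unit_bm2 (V n). Proof. exact: graphon_unit. Qed.

Definition nlab n i : Omega -> ltype T0 i := reglab nu (V n) c0 i.
Definition nmass n i : ltype T0 i -> R := mass nu (nlab n i).
Definition ndens n i : ltype T0 i -> ltype T0 i -> R := dens nu (nlab n i) (V n).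

Arguments nmass : clear implicits.
Arguments ndens : clear implicits.

Lemma nlab_measurable n i : label_measurable (nlab n i).
Proof. exact: reglab_measurable. Qed.

Arguments nlab_measurable : clear implicits.

Definition lmass i a : R := ulim F (fun n => nmass n i a).
Definition ldens i a b : R := ulim F (fun n => ndens n i a b).

Arguments lmass : clear implicits.
Arguments ldens : clear implicits.

Lemma nmass01 n i a : 0 <= nmass n i a <= 1.
Proof.
rewrite mass_ge0 mass_le1//; exact: nlab_measurable.
Qed.

Lemma ndens01 n i a b : 0 <= ndens n i a b <= 1.
Proof. by apply: dens_bounds; [exact: nlab_measurable | exact: uV]. Qed.

Lemma lmass_cvg i a : nmass n i a @[n --> F] --> lmass i a.
Proof. by apply: ulim_cvg => // n; exact: nmass01. Qed.

Lemma ldens_cvg i a b : ndens n i a b @[n --> F] --> ldens i a b.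
Proof. by apply: ulim_cvg => // n; exact: ndens01. Qed.

Arguments lmass_cvg : clear implicits.
Arguments ldens_cvg : clear implicits.

Lemma lmass_ge0 i a : 0 <= lmass i a.
Proof. by have /andP[] : 0 <= lmass i a <= 1 by apply: ulim01 => // n; exact: nmass01. Qed.

Lemma ldens01 i a b : 0 <= ldens i a b <= 1.
Proof. by apply: ulim01 => // n; exact: ndens01. Qed.

Arguments ldens01 : clear implicits.

Lemma ldens_sym i a b : ldens i a b = ldens i b a.
Proof.
congr (ulim F _); apply/funext => n; rewrite /ndens.
by apply: dens_sym; [exact: nlab_measurable | exact: (uV n) | case: (gV n)].
Qed.

Lemma sum_lmass i : \sum_a lmass i a = 1.
Proof.
have h1 : \sum_a nmass n i a @[n --> F] --> \sum_a lmass i a.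
  by apply: cvg_fsum => a; exact: lmass_cvg.
have h2 : \sum_a nmass n i a @[n --> F] --> (1 : R).
  under eq_cvg do rewrite (sum_mass nu (nlab_measurable _ i)).
  exact: cvg_cst.
by rewrite -(cvg_lim _ h1)// (cvg_lim _ h2).
Qed.

Lemma lrefines i : refines fst (lmass i.+1) (ldens i.+1) (lmass i) (ldens i).
Proof.
apply: (refines_lim UF (p' := fun n => nmass n i.+1) (D' := fun n => ndens n i.+1)
   (p := fun n => nmass n i) (D := fun n => ndens n i)).
- by move=> a; exact: lmass_cvg.
- by move=> a b; exact: ldens_cvg.
- by move=> a; exact: lmass_cvg.
- by move=> a b; exact: ldens_cvg.
move=> n; apply: refines_label => //.
- exact: (nlab_measurable n i.+1).
- exact: nlab_measurable.
Qed.

(** A tower of labellings of Omega with the limit masses, built over the same [c0] as the labellings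
    of the [V n]. Each level splits the previous parts in the proportions given by the limit masses;
    the choice is justified in [llabP]. *)
Fixpoint llab i : Omega -> ltype T0 i :=
  match i with
  | 0 => c0
  | i'.+1 => fun x => (llab i' x, xget (fun=> (true, true))
      [set h | label_measurable h /\
         forall s, mass nu (fun x => (llab i' x, h x)) s = lmass i'.+1 s] x)
  end.

Lemma llabP i : label_measurable (llab i) /\ forall a, mass nu (llab i) a = lmass i a.
Proof.
elim: i => [|i [mc IH]].
  split => // a; have h1 := lmass_cvg 0 a.
  have h2 : nmass n 0 a @[n --> F] --> mass nu c0 a by exact: cvg_cst.
  by rewrite -(cvg_lim _ h1)// (cvg_lim _ h2).
have [mh hE] : [set h | label_measurable h /\
    forall s, mass nu (fun x => (llab i x, h x)) s = lmass i.+1 s]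
    (xget (fun=> (true, true)) [set h | label_measurable h /\
    forall s, mass nu (fun x => (llab i x, h x)) s = lmass i.+1 s]).
  apply: xgetPex; have [|a|h hP] := split_label atomless_nu (true, true) (q := lmass i.+1) mc.
  - by move=> s; exact: (@lmass_ge0 i.+1 s).
  - rewrite IH -(lrefines i).1 (partition_big fst (fun x => x == a))/=; last by [].
    rewrite big_pred1_eq; apply/esym.
    rewrite (reindex (fun b => (a, b)))/=.
      by apply: eq_bigl => b; rewrite !eqxx.
    exists snd => [b _ //|[a' b]]; rewrite inE /= => /andP[/eqP -> _] //.
  - by exists h.
by split; [exact: label_pair | exact: hE].
Qed.

Lemma llab_measurable i : label_measurable (llab i).
Proof. by case: (llabP i). Qed.

Arguments llab_measurable : clear implicits.

Lemma llab_mass i a : mass nu (llab i) a = lmass i a.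
Proof. by case: (llabP i). Qed.

Definition lkernel i x y : R := ldens i (llab i x) (llab i y).

Lemma unit_lkernel i : unit_bm2 (lkernel i).
Proof.
split; first exact: (bm2_label (ldens i) (llab_measurable i)).
by move=> x y; exact: ldens01.
Qed.

Definition lenergy i : R := energy (lmass i) (ldens i).

Lemma nlproj n m i x : lproj (nlab n (m + i) x) = nlab n i x.
Proof. by elim: m => //= m; apply. Qed.

Lemma llproj m i x : lproj (llab (m + i) x) = llab i x.
Proof. by elim: m => //= m; apply. Qed.

Lemma lrefines_iter m i : refines (@lproj T0 m i) (lmass (m + i)) (ldens (m + i))
  (lmass i) (ldens i).
Proof.
elim: m => [|m IH]; last exact: (refines_comp (lrefines (m + i)) IH).
split => [a|a b] /=; first by rewrite big_pred1_eq.
by rewrite big_pred1_eq big_pred1_eq.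
Qed.

Lemma lenergy_mono m i : lenergy i <= lenergy (m + i).
Proof.
rewrite -subr_ge0; apply: le_trans (step_dist_energy _ _ (lrefines_iter m i)).
- exact: sqr_ge0.
- exact: lmass_ge0.
- exact: sum_lmass.
Qed.

Lemma lenergy_le1 i : lenergy i <= 1.
Proof.
have -> : 1 = \sum_a \sum_b lmass i a * lmass i b.
  by rewrite -big_distrlr /= sum_lmass mulr1.
apply: ler_sum => a _; apply: ler_sum => b _.
have /andP[d0 d1] := ldens01 i a b.
by rewrite ler_piMr ?mulr_ge0 ?lmass_ge0// expr_le1.
Qed.

Lemma lenergy_cauchy (e : R) : 0 < e -> exists N, forall i m, (N <= i)%N ->
  lenergy (m + i) - lenergy i <= e.
Proof.
move=> e0.
have supE : has_sup (range lenergy).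
  split; first by exists (lenergy 0%N), 0%N.
  by exists 1 => _ [i _ <-]; exact: lenergy_le1.
have [_ [N _ <-] hN] := sup_adherent e0 supE.
exists N => i m Ni.
have h1 : lenergy (m + i) <= sup (range lenergy).
  by apply: ub_le_sup; [case: supE | exists (m + i)%N].
have h2 : lenergy N <= lenergy i by rewrite -(subnK Ni); exact: lenergy_mono.
lra.
Qed.

Lemma lkernel_dist m i :
  E2 nu (fun x y => `|lkernel (m + i) x y - lkernel i x y|) ^+ 2 <= lenergy (m + i) - lenergy i.
Proof.
have -> : (fun x y => `|lkernel (m + i) x y - lkernel i x y|) =
    (fun x y => (fun a b => `|ldens (m + i) a b - ldens i (lproj a) (lproj b)|)
        (llab (m + i) x) (llab (m + i) y)).
  by apply/funext => x; apply/funext => y; rewrite /lkernel !llproj.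
rewrite (E2_label nu (fun a b => `|ldens (m + i) a b - ldens i (lproj a) (lproj b)|)
  (llab_measurable (m + i))).
apply: le_trans (step_dist_energy _ _ (lrefines_iter m i)).
- rewrite /step_dist (eq_bigr (fun a => \sum_b lmass (m + i) a * lmass (m + i) b *
    `|ldens (m + i) a b - ldens i (lproj a) (lproj b)|))// => a _.
  by apply: eq_bigr => b _; rewrite !llab_mass.
- exact: lmass_ge0.
- exact: sum_lmass.
Qed.

(** A square, because an energy increment bounds the square of the L1 distance. *)
Definition fast_gap r : R := ((2 ^+ r)^-1) ^+ 2.

Let gap_ex r : exists N, forall i m, (N <= i)%N -> lenergy (m + i) - lenergy i <= fast_gap r.
Proof. by apply: lenergy_cauchy; rewrite exprn_gt0// invr_gt0 exprn_gt0. Qed.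

Definition gap_index r : nat := projT1 (cid (gap_ex r)).

Fixpoint fast_index r : nat :=
  if r is r'.+1 then (gap_index r + fast_index r')%N else gap_index 0.

Lemma fast_indexP r m : lenergy (m + fast_index r) - lenergy (fast_index r) <= fast_gap r.
Proof.
have h : (gap_index r <= fast_index r)%N by case: r => //= r; exact: leq_addr.
by rewrite /gap_index in h; case: (cid (gap_ex r)) h => N /= HN h; exact: HN.
Qed.

Definition lim_kernel : Omega -> Omega -> R := fast_lim (fun r => lkernel (fast_index r)).

Lemma fast_lkernel r : E2 nu (fun x y =>
  `|lkernel (fast_index r.+1) x y - lkernel (fast_index r) x y|) <= (2 ^+ r)^-1.
Proof.
have h := le_trans (lkernel_dist (gap_index r.+1) (fast_index r)) (fast_indexP r _).
rewrite -(ler_pXn2r (n := 2%N)) ?nnegrE//; exact: E2_ge0.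
Qed.

Lemma graphon_lim_kernel : graphon lim_kernel.
Proof.
have [bl l01] := unit_fast_lim (fun r => unit_lkernel (fast_index r)).
split; [|exact: l01|exact: bl.1].
move=> x y; rewrite /lim_kernel /fast_lim; apply: (congr1 (@limn_sup R)).
by apply/funext => r; exact: (ldens_sym (i := fast_index r)).
Qed.

(** One level serves both purposes of the transfer: its step kernel is close to the limit kernel,
    and all further refinement gains little energy. *)
Lemma lim_kernel_approx (e : R) : 0 < e -> exists i,
  E2 nu (fun x y => `|lim_kernel x y - lkernel i x y|) <= e /\
  forall m, lenergy (m + i) - lenergy i <= e.
Proof.
move=> e0; have [N hN] := ex_inv_le (divr_gt0 e0 (ltr0n R 2 : 0 < 2%:R)).
have h2 : (2 ^+ N.+1 : R)^-1 <= e / 2.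
  rewrite (le_trans _ hN)// lef_pV2 ?posrE ?exprn_gt0 ?ltr0n// -natrX ler_nat.
  by rewrite ltnW// ltn_expl.
exists (fast_index N.+1); split.
  rewrite (le_trans (fast_lim_dist (fun r => unit_lkernel (fast_index r)) fast_lkernel _))//.
  by rewrite mulrC -ler_pdivlMr.
move=> m; rewrite (le_trans (fast_indexP _ _))// /fast_gap expr2.
apply: (@le_trans _ _ (2 ^+ N.+1)^-1); last by lra.
by rewrite ler_piMr ?invr_ge0 ?exprn_ge0// invf_le1 ?exprn_gt0// exprn_ege1// ler1n.
Qed.

End LimitKernel.

(** * Transfer of tilings *)

Section Words.
Context (d : measure_display) (Omega : measurableType d) (R : realType).
Variable nu : probability Omega R.
Variable k : nat.
Local Notation pts := ('I_k -> Omega).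

Lemma kint_vprod (h : 'I_k -> Omega -> R) : (forall v, bm (h v)) ->
  kint nu (fun x => \prod_v h v (x v)) = \prod_v Ex nu (h v).
Proof.
move=> bh.
have H s : uniq s -> rint nu s (fun x : pts => \prod_v h v (x v)) =
    fun y => \prod_v (if v \in s then Ex nu (h v) else h v (y v)).
  elim: s => [|i s IH] //= /andP[is_ us]; rewrite IH//; apply/funext => y.
  rewrite /int_coord [RHS](bigD1 i)//= mem_head.
  rewrite -ExZr//; congr Ex; apply/funext => x.
  rewrite (bigD1 i)//= (negbTE is_) /upd eqxx; congr (_ * _).
  by apply: eq_bigr => v vi; rewrite inE (negbTE vi).
rewrite /kint H ?enum_uniq//; apply: eq_bigr => v _.
by rewrite mem_enum.
Qed.

Variables (T : finType) (c : Omega -> T).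
Hypothesis mc : label_measurable c.

(** The label pattern of a k-tuple of vertices; [box c w] is the indicator of the tuples with
    pattern [w]. *)
Definition word (x : pts) : {ffun 'I_k -> T} := [ffun v => c (x v)].

Definition box (w : {ffun 'I_k -> T}) (x : pts) : R := \prod_v (c (x v) == w v)%:R.

Lemma boxE w x : box w x = (word x == w)%:R.
Proof.
rewrite /box; case: (eqVneq (word x) w) => [<-|xw].
  by rewrite big1// => v _; rewrite ffunE eqxx.
have /existsP[v hv] : [exists v, c (x v) != w v].
  rewrite -negb_forall; apply: contra xw => /forallP H.
  by apply/eqP/ffunP => v; rewrite ffunE; exact/eqP.
by rewrite (bigD1 v)//= (negbTE hv) mul0r.
Qed.

Lemma unit_box w : unit_kbm (box w).
Proof.
split; last by move=> x; rewrite boxE; case: eqP; rewrite ?ler01 ?lexx.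
apply: bm_prod => v; apply: (kbm_coord (f := fun x => (c x == w v)%:R) v).
exact: bm_ind.
Qed.

Lemma word_sum (g : {ffun 'I_k -> T} -> R) x : g (word x) = \sum_w g w * box w x.
Proof.
rewrite (bigD1 (word x))//= boxE eqxx mulr1 big1 ?addr0// => w.
by rewrite boxE eq_sym => /negbTE ->; rewrite mulr0.
Qed.

Lemma kbm_word (g : {ffun 'I_k -> T} -> R) : kbm (fun x => g (word x)).
Proof.
rewrite /kbm; under eq_fun do rewrite word_sum.
apply: bm_sum => w; apply: bmZ; by case: (unit_box w).
Qed.

Lemma separated_box e w : separated e (box w).
Proof.
rewrite /box; elim: (index_enum _) => [|v s IH].
  by under eq_fun do rewrite big_nil; exact: separated_cst.
under eq_fun do rewrite big_cons.
apply: (@separatedM _ _ _ _ e (fun x : pts => (c (x v) == w v)%:R)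
  (fun x => \prod_(j <- s) (c (x j) == w j)%:R)) => //.
apply: (@separated_coord _ _ _ _ e (fun x => (c x == w v)%:R)).
  exact: bm_ind.
by move=> x; case: eqP; rewrite ?ler01 ?lexx.
Qed.

Definition word_density (s : seq ('I_k * 'I_k)) (D : T -> T -> R) (w : {ffun 'I_k -> T}) : R :=
  \prod_(e <- s) D (w e.1) (w e.2).

Lemma hom_density_word s D x :
  hom_density s (fun x y => D (c x) (c y)) x = word_density s D (word x).
Proof. by apply: eq_bigr => e _; rewrite !ffunE. Qed.

Lemma kint_box w : kint nu (box w) = \prod_v mass nu c (w v).
Proof. by rewrite /box (kint_vprod (h := fun v x => (c x == w v)%:R))// => v; exact: bm_ind. Qed.

Lemma kint_box_coord w l (f : Omega -> R) : bm f ->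
  kint nu (fun x => box w x * f (x l)) =
  Ex nu (fun x => (c x == w l)%:R * f x) * \prod_(v | v != l) mass nu c (w v).
Proof.
move=> bf; pose h v x : R := (c x == w v)%:R * (if v == l then f x else 1).
have bh v : bm (h v).
  apply: bmM; first exact: bm_ind.
  by case: (v == l) => //; exact: bm_cst.
have -> : (fun x => box w x * f (x l)) = fun x : pts => \prod_v h v (x v).
  apply/funext => x; rewrite /h big_split/=; congr (_ * _).
  by rewrite -big_mkcond/= big_pred1_eq.
rewrite kint_vprod// (bigD1 l)//= /h eqxx; congr (_ * _); apply: eq_bigr => v vl.
by rewrite (negbTE vl) /mass; congr Ex; apply/funext => x; rewrite mulr1.
Qed.

End Words.
Arguments box {d Omega R k T} c w x.

(** * Block weights extracted from a bounded tiling *)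

Section BlockWeights.
Context (d : measure_display) (Omega : measurableType d) (R : realType).
Variable nu : probability Omega R.
Variable k : nat.
Local Notation pts := ('I_k -> Omega).
Variable s : seq ('I_k * 'I_k).
Hypothesis ls : forall e, e \in s -> (e.1 < e.2)%N.
Variables (T : finType) (c : Omega -> T).
Hypothesis mc : label_measurable c.
Variable D : T -> T -> R.
Hypothesis D01 : forall a b, 0 <= D a b <= 1.
Variables (K : Omega -> Omega -> R) (t : pts -> R) (C beta : R).
Hypotheses (uK : unit_bm2 K) (bt : kbm t) (t0 : forall x, 0 <= t x).
Hypothesis tK : forall x, t x <= C * hom_density s K x.
Hypothesis tm : forall x, \sum_(l < k) marg nu t l x <= 1.
Hypotheses (C0 : 0 <= C) (beta0 : 0 < beta).
Local Notation words := {ffun 'I_k -> T}.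
Local Notation p := (mass nu c).
Local Notation Dw := (word_density s D).

Definition tau (w : words) : R := kint nu (fun x => t x * box c w x).

(** The ratio of the size of [t] on the box [w] to the F-density that the step kernel [D] gives to
    that box. Patterns of density below [beta] are dropped, which keeps the weights at most
    C/beta. *)
Definition gamma (w : words) : R :=
  if beta <= Dw w then tau w / (\prod_v p (w v) * Dw w) else 0.

Let btb w : kbm (fun x => t x * box c w x).
Proof. by apply: bmM => //; case: (unit_box R mc w). Qed.

Let uD : unit_bm2 (fun x y => D (c x) (c y)).
Proof. by split; [exact: bm2_label | move=> x y]. Qed.

Let box0 (w : words) (x : pts) : 0 <= box c w x :> R.
Proof. by rewrite boxE. Qed.

Lemma tau_ge0 w : 0 <= tau w.
Proof. by apply: kint_ge0 => x; rewrite mulr_ge0. Qed.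

Lemma tau_sum (g : words -> R) : kint nu (fun x => t x * g (word c x)) = \sum_w g w * tau w.
Proof.
have -> : (fun x => t x * g (word c x)) = (fun x => \sum_w g w * (t x * box c w x)).
  apply/funext => x; rewrite word_sum mulr_sumr; apply: eq_bigr => w _.
  by rewrite mulrCA.
rewrite kint_sum; last by move=> w; exact: (bmZ (g w) (btb w)).
by apply: eq_bigr => w _; rewrite kintZ.
Qed.

Let t_le_C x : t x <= C.
Proof.
rewrite (le_trans (tK x))// ler_piMr//.
by have [_ /(_ x)/andP[]] := unit_hom_density s uK.
Qed.

Lemma tau_le w : tau w <= C * \prod_v p (w v).
Proof.
have [bb _] := unit_box R mc w.
rewrite -(kint_box nu mc) -kintZ//; apply: kint_le => //; first exact: bmZ.
by move=> x; rewrite ler_wpM2r.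
Qed.

Lemma tau_marg a : \sum_(l < k) \sum_(w : words | w l == a) tau w <= p a.
Proof.
have bi : bm (fun x => (c x == a)%:R : R) by exact: bm_ind.
have -> : \sum_(l < k) \sum_(w : words | w l == a) tau w =
    Ex nu (fun x => (c x == a)%:R * \sum_(l < k) marg nu t l x).
  under [in RHS]eq_fun do rewrite mulr_sumr.
  rewrite Ex_sum; last by move=> l; apply: bmM => //; exact: bm_marg.
  apply: eq_bigr => l _; rewrite (Ex_marg nu l bi bt).
  have := tau_sum (fun w => (w l == a)%:R).
  rewrite (_ : (fun x => _) = (fun x => (c (x l) == a)%:R * t x)).
    by move=> ->; rewrite big_mkcond; apply: eq_bigr => w _; case: eqP; rewrite ?mul1r ?mul0r.
  by apply/funext => x; rewrite ffunE mulrC.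
apply: Ex_le => //.
  by apply: bmM => //; apply: bm_sum => l; exact: bm_marg.
by move=> x; rewrite ler_piMr.
Qed.

Lemma mass_word_ge0 (P : pred 'I_k) (w : words) : 0 <= \prod_(v | P v) p (w v).
Proof. by apply: prodr_ge0 => v _; exact: mass_ge0. Qed.

Lemma word_density01 w : 0 <= Dw w <= 1.
Proof.
apply/andP; split; first by apply: prodr_ge0 => e _; have /andP[] := D01 (w e.1) (w e.2).
by apply: prodr_ile1 => e _; exact: D01.
Qed.

Lemma gamma_bounds w : 0 <= gamma w <= C / beta.
Proof.
rewrite /gamma; case: (leP beta (Dw w)) => [bD|_]; last by rewrite lexx divr_ge0// ltW.
have D0 : 0 < Dw w by exact: lt_le_trans bD.
rewrite divr_ge0 ?tau_ge0 ?mulr_ge0 ?mass_word_ge0 ?(ltW D0)//=.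
have := mass_word_ge0 xpredT w; rewrite le_eqVlt => /predU1P[p0|p0].
  by rewrite -p0 mul0r invr0 mulr0 divr_ge0// ltW.
rewrite ler_pdivrMr ?mulr_gt0// (le_trans (tau_le w))// -mulrA ler_wpM2l//.
by rewrite mulrCA ler_peMr ?(ltW p0)// mulrC ler_pdivlMr// mul1r.
Qed.

Lemma gamma_mass w : gamma w * (\prod_v p (w v) * Dw w) = (beta <= Dw w)%R%:R * tau w.
Proof.
rewrite /gamma; case: (leP beta (Dw w)) => [bD|_]; last by rewrite !mul0r.
rewrite mul1r; have D0 : 0 < Dw w by exact: lt_le_trans bD.
have [p0|p0] := eqVneq (\prod_v p (w v)) 0; last first.
  by rewrite divfK// mulf_neq0// gt_eqF.
have := tau_le w; rewrite p0 mulr0 mul0r invr0 !mulr0 => h.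
by apply/eqP; rewrite eq_le tau_ge0 h.
Qed.

(** Only patterns of density below [beta] are lost. There [t] is at most C times the F-density of
    [K], whose integral is within the L1 counting error of that of the step kernel, and the latter
    is at most [beta]. *)
Lemma gamma_size (delta : R) : E2 nu (fun x y => `|K x y - D (c x) (c y)|) <= delta ->
  kint nu t - C * (beta + (size s)%:R * delta) <= \sum_w gamma w * (\prod_v p (w v) * Dw w).
Proof.
move=> Kd; under eq_bigr do rewrite gamma_mass.
pose chi (w : words) : R := (Dw w < beta)%R%:R.
have bchi : kbm (fun x => chi (word c x))  by exact: kbm_word.
have chi01 (x : pts) : 0 <= chi (word c x) <= 1 by rewrite /chi; case: (_ < _); rewrite ?ler01 ?lexx.
have bK : kbm (hom_density s K) by case: (unit_hom_density s uK).
have bDc : kbm (hom_density s (fun x y => D (c x) (c y))) by case: (unit_hom_density s uD).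
have -> : \sum_w (beta <= Dw w)%R%:R * tau w = kint nu t - kint nu (fun x => t x * chi (word c x)).
  have -> : kint nu t = \sum_w 1 * tau w.
    by rewrite -(tau_sum (fun=> 1)); congr kint; apply/funext => x; rewrite mulr1.
  rewrite (tau_sum chi) -sumrB; apply: eq_bigr => w _.
  by rewrite /chi; case: leP; rewrite ?mul1r ?mul0r ?subr0 ?subrr.
rewrite lerB//.
have b1 : kbm (fun x => hom_density s K x * chi (word c x)) by exact: bmM.
have b2 : kbm (fun x => hom_density s (fun x y => D (c x) (c y)) x * chi (word c x)) by exact: bmM.
apply: (@le_trans _ _ (C * kint nu (fun x => hom_density s K x * chi (word c x)))).
  rewrite -kintZ//; apply: kint_le; [exact: bmM | exact: bmZ | ].
  by move=> x; rewrite mulrA ler_wpM2r//; have /andP[] := chi01 x.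
rewrite ler_wpM2l//.
have := counting_L1 nu uK uD ls bchi chi01; rewrite mul1r => h.
have h2 : kint nu (fun x => hom_density s (fun x y => D (c x) (c y)) x * chi (word c x)) <= beta.
  rewrite -[leRHS](kint_cst nu k); apply: kint_le => //; first exact: bm_cst.
  move=> x; rewrite hom_density_word /chi; case: ltP => h'; first by rewrite mulr1 ltW.
  by rewrite mulr0 ltW.
have h3 : (size s)%:R * E2 nu (fun x y => `|K x y - D (c x) (c y)|) <= (size s)%:R * delta.
  by rewrite ler_wpM2l.
by move: h; rewrite ler_norml => /andP[_]; lra.
Qed.

(** The load constraint averaged over part [a]: multiplied by the mass of [a], the sum becomes at
    most the total load of [t] on that part. For a part of mass zero the weights themselves
    vanish. *)
Lemma gamma_marg a :
  \sum_(l < k) \sum_(w : words | w l == a) gamma w * (Dw w * \prod_(v | v != l) p (w v)) <= 1.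
Proof.
have split_p (w : words) l : w l = a -> p a * \prod_(v | v != l) p (w v) = \prod_v p (w v).
  by move=> wl; rewrite [RHS](bigD1 l)//= wl.
have := mass_ge0 nu c a; rewrite le_eqVlt => /predU1P[pa|pa].
  rewrite big1 ?ler01// => l _; rewrite big1// => w /eqP wl.
  rewrite /gamma; case: ifP => _; last by rewrite mul0r.
  by rewrite -(split_p w l wl) -pa !mul0r invr0 mulr0 mul0r.
rewrite -(ler_pM2l pa) mulr1 (le_trans _ (tau_marg a))// mulr_sumr; apply: ler_sum => l _.
rewrite mulr_sumr; apply: ler_sum => w /eqP wl.
have -> : p a * (gamma w * (Dw w * \prod_(v | v != l) p (w v))) =
    gamma w * (\prod_v p (w v) * Dw w) by rewrite -(split_p w l wl); ring.
by rewrite gamma_mass ler_piMl ?tau_ge0// lern1 leq_b1.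
Qed.

End BlockWeights.

(** * Turning block weights into a tiling of a nearby graphon *)

Section Transfer.
Context (d : measure_display) (Omega : measurableType d) (R : realType).
Variable nu : probability Omega R.
Variable k : nat.
Variable adj : rel 'I_k.
Local Notation pts := ('I_k -> Omega).
Local Notation s := (edges adj).
Variables (T : finType) (c : Omega -> T).
Hypothesis mc : label_measurable c.
Variable D : T -> T -> R.
Hypothesis D01 : forall a b, 0 <= D a b <= 1.
Variables (V K : Omega -> Omega -> R) (kappa delta B e1 : R).
Hypotheses (gV : graphon V) (uK : unit_bm2 K).
Hypothesis VK : cut_bounded nu (fun x y => V x y - K x y) kappa.
Hypothesis KD : E2 nu (fun x y => `|K x y - D (c x) (c y)|) <= delta.
Local Notation words := {ffun 'I_k -> T}.
Variable g : words -> R.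
Hypothesis g0B : forall w, 0 <= g w <= B.
Local Notation p := (mass nu c).
Local Notation Dw := (word_density s D).
Local Notation step := (fun x y => D (c x) (c y)).
Local Notation N := (#|{: words}|%:R : R).

(** Its support lies in that of the F-density of [V], so only the vertex loads separate it from a
    tiling of [V]. *)
Definition transferred (x : pts) : R := hom_density s V x * g (word c x).

Let uD : unit_bm2 step.
Proof. by split; [exact: bm2_label | move=> x y]. Qed.

Let uV : unit_bm2 V. Proof. exact: graphon_unit. Qed.

Let bhom (K1 : Omega -> Omega -> R) : unit_bm2 K1 -> kbm (hom_density (k := k) s K1).
Proof. by case/(unit_hom_density s). Qed.

Let bg : kbm (fun x : pts => g (word c x)). Proof. exact: kbm_word. Qed.

Let kappa0 : 0 <= kappa.
Proof. exact: le_trans (VK measurable0 measurable0). Qed.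

Let sum_g_le : \sum_w g w <= N * B.
Proof.
have -> : N * B = \sum_(w : words) B by rewrite sumr_const mulr_natl.
by apply: ler_sum => w _; have /andP[] := g0B w.
Qed.

Definition transfer_error : R := N * B * (size s)%:R * kappa + B * (size s)%:R * delta.

(** Two comparisons: from [V] to [K] by the cut-norm counting lemma, applied box by box since the
    weight is a combination of boxes, and from [K] to the step kernel by the L1 counting lemma,
    applied to the whole weight at once. *)
Lemma transferred_test (H : pts -> R) : unit_kbm H ->
  (forall e, e \in s -> separated e H) ->
  `|kint nu (fun x => transferred x * H x) -
    kint nu (fun x => hom_density s step x * (g (word c x) * H x))| <= transfer_error.
Proof.
move=> uH sH; have [bH H01] := uH.
have bgH : kbm (fun x => g (word c x) * H x) by exact: bmM.
have expand K1 : unit_bm2 K1 -> kint nu (fun x => hom_density s K1 x * (g (word c x) * H x)) =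
    \sum_w g w * kint nu (fun x => hom_density s K1 x * (box c w x * H x)).
  move=> uK1; have bw w : kbm (fun x : pts => hom_density s K1 x * (box c w x * H x)).
    by apply: bmM; [exact: bhom | apply: bmM => //; case: (unit_box R mc w)].
  rewrite (eq_bigr (fun w => kint nu (fun x => g w * (hom_density s K1 x * (box c w x * H x))))).
    rewrite -kint_sum; last by move=> w; exact: (bmZ (g w) (bw w)).
    congr kint; apply/funext => x; rewrite (word_sum c g) mulr_suml mulr_sumr.
    by apply: eq_bigr => w _; ring.
  by move=> w _; rewrite kintZ.
have -> : (fun x => transferred x * H x) =
    (fun x => hom_density s V x * (g (word c x) * H x)).
  by apply/funext => x; rewrite /transferred mulrA.
apply: (le_trans (ler_distD (kint nu (fun x => hom_density s K x * (g (word c x) * H x))) _ _)).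
apply: lerD.
  rewrite !expand// -sumrB (le_trans (ler_norm_sum _ _ _))//.
  apply: (@le_trans _ _ (\sum_w g w * ((size s)%:R * kappa))).
    apply: ler_sum => w _; have /andP[gw _] := g0B w.
    rewrite -mulrBr normrM (ger0_norm gw) ler_wpM2l//.
    apply: counting_cut => //.
    - exact: uniq_edges.
    - exact: edges_lt.
    - by apply: unit_kbmM => //; exact: unit_box.
    - by move=> e es; apply: separatedM; [exact: separated_box | exact: sH].
  rewrite -mulr_suml -mulrA ler_wpM2r// mulr_ge0//.
apply: (@le_trans _ _ (B * (size s)%:R * E2 nu (fun x y => `|K x y - D (c x) (c y)|))).
  apply: counting_L1 => //; first exact: edges_lt.
  move=> x; have /andP[gw gB] := g0B (word c x); have /andP[h0 h1] := H01 x.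
  by rewrite mulr_ge0//= (le_trans _ gB)// ler_piMr.
rewrite ler_wpM2l//.
(* Nonnegativity of [B] comes from [g0B] at any pattern, and a constant pattern exists. *)
case: (pickP (fun w : words => true)) => [w _|noword].
  have /andP[gw gB] := g0B w; rewrite mulr_ge0//; exact: le_trans gB.
by exfalso; have := noword [ffun _ => c point].
Qed.

Let one_unit : unit_kbm (fun _ : pts => 1 : R).
Proof. by split; [exact: bm_cst | move=> x; rewrite ler01 lexx]. Qed.

Lemma kbm_transferred : kbm transferred.
Proof. by apply: bmM => //; exact: bhom. Qed.

Lemma transferred_ge0 x : 0 <= transferred x.
Proof.
apply: mulr_ge0; last by have /andP[] := g0B (word c x).
by have [_ /(_ x)/andP[]] := unit_hom_density s uV.
Qed.

Lemma kint_step_word (H : pts -> R) : kbm H ->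
  kint nu (fun x => hom_density s step x * (g (word c x) * H x)) =
  \sum_w g w * Dw w * kint nu (fun x => box c w x * H x).
Proof.
move=> bH; have bw w : kbm (fun x : pts => box c w x * H x).
  by apply: bmM => //; case: (unit_box R mc w).
rewrite (eq_bigr (fun w => kint nu (fun x => g w * Dw w * (box c w x * H x)))).
  rewrite -kint_sum; last by move=> w; exact: (bmZ (g w * Dw w) (bw w)).
  congr kint; apply/funext => x; rewrite hom_density_word.
  rewrite mulrA (word_sum c (fun w => Dw w * g w)) mulr_suml.
  by apply: eq_bigr => w _; ring.
by move=> w _; rewrite kintZ.
Qed.

Lemma transferred_size (A : words -> R) :
  (forall w, `|Dw w * \prod_v p (w v) - A w| <= e1) ->
  \sum_w g w * A w - (N * B * e1 + transfer_error) <= kint nu transferred.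
Proof.
move=> hA.
have h1 := transferred_test one_unit (fun e _ => separated_cst _ e).
have -> : kint nu transferred = kint nu (fun x => transferred x * 1).
  by congr kint; apply/funext => x; rewrite mulr1.
have h2 : \sum_w g w * A w - N * B * e1 <=
    kint nu (fun x => hom_density s step x * (g (word c x) * 1)).
  rewrite kint_step_word; last by case: one_unit.
  rewrite lerBlDr -lerBlDl -sumrB.
  apply: (@le_trans _ _ (\sum_(w : words) B * e1)); last first.
    by rewrite sumr_const -[leLHS]mulr_natl mulrA.
  apply: ler_sum => w _; have /andP[gw gB] := g0B w.
  rewrite (_ : (fun x => _) = box c w); last by apply/funext => x; rewrite mulr1.
  rewrite kint_box// -mulrA -mulrBr; apply: (@le_trans _ _ (g w * e1)).
    rewrite ler_wpM2l// (le_trans _ (hA w))// distrC; exact: ler_norm.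
  by rewrite ler_wpM2r// (le_trans _ (hA w)).
by move: h1; rewrite ler_norml => /andP[h3 _]; lra.
Qed.

(** Closeness in cut norm does not control the load at single points, only its integral against a
    test function of one vertex; this weak form of the load bound is what can be proved. *)
Lemma transferred_marg (A : words -> 'I_k -> R) (f : Omega -> R) :
  (forall w l, `|Dw w * \prod_(v | v != l) p (w v) - A w l| <= e1) ->
  (forall a, \sum_(l < k) \sum_(w : words | w l == a) g w * A w l <= 1) ->
  bm f -> (forall x, 0 <= f x <= 1) ->
  \sum_(l < k) kint nu (fun x => f (x l) * transferred x) <=
    Ex nu f + k%:R * (N * B * e1 + transfer_error).
Proof.
move=> hA gA bf f01.
pose Ea a := Ex nu (fun x => (c x == a)%:R * f x).
have bi a : bm (fun x => (c x == a)%:R : R) by exact: bm_ind.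
have Ea0 a : 0 <= Ea a.
  by apply: Ex_ge0 => x; have /andP[h0 _] := f01 x; rewrite mulr_ge0.
have Ea1 a : Ea a <= 1.
  apply: Ex_le1; first exact: bmM.
  by move=> x; have /andP[h0 h1] := f01 x; case: (c x == a); rewrite ?mul1r ?mul0r.
have sEa : \sum_a Ea a = Ex nu f.
  rewrite -Ex_sum; last by move=> a; exact: bmM.
  congr Ex; apply/funext => x; rewrite -mulr_suml.
  rewrite (_ : \sum_a _ = 1) ?mul1r// [RHS](label_sum c (fun=> 1 : R) x).
  by apply: eq_bigr => a _; rewrite mul1r.
have step1 l : kint nu (fun x => f (x l) * transferred x) <=
    \sum_w g w * A w l * Ea (w l) + (N * B * e1 + transfer_error).
  have ufl : unit_kbm (fun x : pts => f (x l)).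
    by split; [exact: kbm_coord | move=> x; exact: f01].
  have h1 := transferred_test ufl (fun e _ => separated_coord e l bf f01).
  have -> : (fun x => f (x l) * transferred x) = (fun x => transferred x * f (x l)).
    by apply/funext => x; rewrite mulrC.
  have h2 : kint nu (fun x => hom_density s step x * (g (word c x) * f (x l))) <=
      \sum_w g w * A w l * Ea (w l) + N * B * e1.
    rewrite kint_step_word; last by case: ufl.
    rewrite -lerBlDl -sumrB.
    apply: (@le_trans _ _ (\sum_(w : words) B * e1)); last first.
      by rewrite sumr_const -[leLHS]mulr_natl mulrA.
    apply: ler_sum => w _; have /andP[gw gB] := g0B w.
    rewrite kint_box_coord// -/(Ea (w l)).
    have -> : g w * Dw w * (Ea (w l) * \prod_(v | v != l) p (w v)) - g w * A w l * Ea (w l) =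
      g w * (Ea (w l) * (Dw w * \prod_(v | v != l) p (w v) - A w l)) by ring.
    have e10 : 0 <= e1 by exact: le_trans (hA w l).
    apply: (@le_trans _ _ (g w * e1)); last by rewrite ler_wpM2r.
    rewrite ler_wpM2l// (@le_trans _ _ (Ea (w l) * e1))//.
      by rewrite ler_wpM2l// (le_trans (ler_norm _)).
    by rewrite ler_piMl.
  by move: h1; rewrite ler_norml => /andP[_ h3]; lra.
apply: (@le_trans _ _ (\sum_(l < k) (\sum_w g w * A w l * Ea (w l) + (N * B * e1 + transfer_error)))).
  by apply: ler_sum => l _; exact: step1.
rewrite big_split/= sumr_const card_ord -[X in _ + X <= _]mulr_natl lerD2r -sEa.
have -> : \sum_(l < k) \sum_w g w * A w l * Ea (w l) =
    \sum_a (\sum_(l < k) \sum_(w : words | w l == a) g w * A w l) * Ea a.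
  under [RHS]eq_bigr do rewrite mulr_suml.
  rewrite [RHS]exchange_big/=; apply: eq_bigr => l _.
  rewrite (partition_big (fun w : words => w l) xpredT)//=; apply: eq_bigr => a _.
  by rewrite mulr_suml; apply: eq_bigr => w /eqP ->.
by apply: ler_sum => a _; rewrite ler_piMl.
Qed.

(* The vertices that [transferred] overloads by more than a factor [1 + r] form a set of *)
(* measure at most [r]: dropping the tiles through them leaves a tiling after rescaling. *)
Lemma til_transferred (A : words -> R) (A' : words -> 'I_k -> R) (r : R) : 0 < r ->
  (forall w, `|Dw w * \prod_v p (w v) - A w| <= e1) ->
  (forall w l, `|Dw w * \prod_(v | v != l) p (w v) - A' w l| <= e1) ->
  (forall a, \sum_(l < k) \sum_(w : words | w l == a) g w * A' w l <= 1) ->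
  k%:R * (N * B * e1 + transfer_error) <= r ^+ 2 ->
  (((\sum_w g w * A w - (N * B * e1 + transfer_error) - r - r ^+ 2) / (1 + r))%:E
     <= til nu adj V)%E.
Proof.
move=> r0 hA hA' gA' kr.
have r1 : 0 < 1 + r by rewrite addr_gt0.
pose M x := \sum_(l < k) marg nu transferred l x.
have bM : bm M by apply: bm_sum => l; apply: bm_marg; exact: kbm_transferred.
pose b x := 1 + r <= M x.
have mb : measurable [set x | b x] by exact: measurable_pred_ge.
have bb : bm (fun x => (b x)%:R : R) by exact: bm_ind.
have EbM : Ex nu (fun x => (b x)%:R * M x) <= Ex nu (fun x => (b x)%:R) + r ^+ 2.
  have -> : Ex nu (fun x => (b x)%:R * M x) =
      \sum_(l < k) kint nu (fun x => (b (x l))%:R * transferred x).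
    rewrite /M; under eq_fun do rewrite mulr_sumr.
    rewrite Ex_sum; last by move=> l; apply: bmM => //; apply: bm_marg; exact: kbm_transferred.
    by apply: eq_bigr => l _; rewrite (Ex_marg nu l bb kbm_transferred).
  rewrite (le_trans (transferred_marg hA' gA' bb _)) ?lerD2l//.
  by move=> x; case: (b x); rewrite ?ler01 ?lexx.
have Ebr : Ex nu (fun x => (b x)%:R) <= r.
  have h : (1 + r) * Ex nu (fun x => (b x)%:R) <= Ex nu (fun x => (b x)%:R * M x).
    rewrite -ExZ//; apply: Ex_le; [exact: bmZ | exact: bmM | ].
    by move=> x; case: (boolP (b x)) => bx; rewrite ?mulr1 ?mul1r// mulr0 mul0r.
  by rewrite -(ler_pM2l r0) -expr2; lra.
have S := transferred_size hA.
have Av := kint_avoid nu mb kbm_transferred transferred_ge0.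
pose t' x := (1 + r)^-1 * avoid b transferred x.
have bav := kbm_avoid mb kbm_transferred.
have BT : btiling nu adj V t'.
  split.
  - exact: bmZ.
  - move=> x; rewrite mulr_ge0 ?invr_ge0 ?(ltW r1)//.
    exact: (avoid_ge0 _ _ transferred_ge0).
  - move=> x; rewrite mulf_eq0 negb_or => /andP[_ /avoid_neq0[+ _]].
    by rewrite mulf_eq0 negb_or Wtensor_edges => /andP[].
  - move=> x; have mE l : marg nu t' l x = (1 + r)^-1 * marg nu (avoid b transferred) l x.
      by rewrite /marg rintZ.
    under eq_bigr do rewrite mE.
    rewrite -mulr_sumr mulrC ler_pdivrMr// mul1r.
    case: (boolP (b x)) => bx.
      rewrite big1 ?(ltW r1)// => l _.
      by rewrite (marg_avoid0 nu mb l kbm_transferred bx).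
    move: bx; rewrite -ltNge => /ltW; apply: le_trans; apply: ler_sum => l _.
    exact: (marg_avoid_le nu mb l x kbm_transferred transferred_ge0).
apply: le_trans (kint_le_til BT); rewrite lee_fin /t' kintZ// mulrC ler_pM2l ?invr_gt0//.
rewrite -/(M _) in Av; lra.
Qed.

End Transfer.

(** * Lower semicontinuity *)

Section LowerSemicontinuity.
Context (d : measure_display) (Omega : measurableType d) (R : realType).
Variable nu : probability Omega R.
Hypothesis atomless_nu : atomless nu.
Variables (F : set_system nat) (V : nat -> Omega -> Omega -> R).
Hypotheses (UF : UltraFilter F) (gV : forall n, graphon (V n)).
Variables (T0 : finType) (c0 : Omega -> T0).
Hypothesis mc0 : label_measurable c0.

Local Notation nl n i := (@nlab d Omega R nu V T0 c0 n i).
Local Notation pn n i := (mass nu (nl n i)).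
Local Notation Dn n i := (dens nu (nl n i) (V n)).
Local Notation pl i := (@lmass d Omega R nu F V T0 c0 i).
Local Notation Dl i := (@ldens d Omega R nu F V T0 c0 i).
Local Notation ll i := (@llab d Omega R nu F V T0 c0 i).
Local Notation en i := (@lenergy d Omega R nu F V T0 c0 i).
Local Notation Vh := (lim_kernel nu UF gV mc0).

Let PF : ProperFilter F. Proof. exact: ultra_proper. Qed.

Let uV n : unit_bm2 (V n). Proof. exact: graphon_unit. Qed.

Let mnl n i : label_measurable (nl n i). Proof. exact: (@nlab_measurable _ _ _ nu V gV T0 c0 mc0 n i). Qed.

Arguments mnl : clear implicits.

Definition nenergy n i : R := energy (pn n i) (Dn n i).

Lemma nrefines n m i :
  refines (@lproj T0 m i) (pn n (m + i)) (Dn n (m + i)) (pn n i) (Dn n i).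
Proof. by apply: refines_label => // x; exact: nlproj. Qed.

Lemma navg_dist n m i :
  E2 nu (fun x y => `|avg nu (nl n (m + i)) (V n) x y - Dn n i (nl n i x) (nl n i y)|) ^+ 2
    <= nenergy n (m + i) - nenergy n i.
Proof.
have -> : (fun x y => `|avg nu (nl n (m + i)) (V n) x y - Dn n i (nl n i x) (nl n i y)|) =
    (fun x y => (fun a b => `|Dn n (m + i) a b - Dn n i (lproj a) (lproj b)|)
        (nl n (m + i) x) (nl n (m + i) y)).
  by apply/funext => x; apply/funext => y; rewrite /avg !nlproj.
rewrite (E2_label nu (fun a b => `|Dn n (m + i) a b - Dn n i (lproj a) (lproj b)|)
  (mnl n (m + i))).
apply: (step_dist_energy _ _ (nrefines n m i)).
- by move=> a; exact: mass_ge0.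
- exact: sum_mass.
Qed.

(** The regularity step read backwards, with the factor 2 from [cut_witness] accounting for the
    division by 4. *)
Lemma ncut n j (e : R) : 0 <= e -> nenergy n j.+1 - nenergy n j <= e ^+ 2 / 4 ->
  cut_bounded nu (fun x y => V n x y - avg nu (nl n j) (V n) x y) e.
Proof.
move=> e0 he A B mA mB.
have [mc' /(_ A B mA mB) h] := regular_pairP nu (mnl n j) (uV n).
apply: (le_trans h); rewrite -ler_pdivlMl// mulrC.
rewrite -(ler_pXn2r (n := 2%N)) ?nnegrE//; last 2 first.
- apply: sumr_ge0 => a _; apply: sumr_ge0 => b _; rewrite mulr_ge0//.
  by rewrite mulr_ge0// mass_ge0.
- by rewrite divr_ge0.
have -> : (e / 2) ^+ 2 = e ^+ 2 / 4 by field.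
apply: le_trans he.
apply: step_dist_energy; first by move=> a; exact: mass_ge0.
  exact: sum_mass.
by apply: refines_label.
Qed.

Lemma nenergy_cvg i : nenergy n i @[n --> F] --> en i.
Proof.
apply: (cvg_energy UF (p' := fun n => pn n i) (D' := fun n => Dn n i)
  (q' := pl i) (G' := Dl i)).
- by move=> a; exact: (lmass_cvg UF gV mc0).
- by move=> a b; exact: (ldens_cvg UF gV mc0).
Qed.

Lemma nenergy_gap m i (e : R) : 0 < e -> en (m + i) - en i <= e ->
  \forall n \near F, nenergy n (m + i) - nenergy n i <= 2 * e.
Proof.
move=> e0 he; have h : nenergy n (m + i) - nenergy n i @[n --> F] --> en (m + i) - en i.
  by apply: cvgB; exact: nenergy_cvg.
have hlt : en (m + i) - en i < 2 * e by lra.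
exact: (cvgr_le _ h _ hlt).
Qed.

Lemma word_density_cvg k (s : seq ('I_k * 'I_k)) i (P : pred 'I_k) (w : {ffun 'I_k -> ltype T0 i}) :
  word_density s (Dn n i) w * \prod_(v | P v) pn n i (w v) @[n --> F] -->
  word_density s (Dl i) w * \prod_(v | P v) mass nu (ll i) (w v).
Proof.
apply: cvgM.
  by apply: (cvg_fprod UF) => e; exact: (ldens_cvg UF gV mc0).
apply: (cvg_fprod UF) => v; rewrite (llab_mass atomless_nu UF gV mc0).
exact: (lmass_cvg UF gV mc0).
Qed.

Lemma fraction_bound (q X z : R) : 0 < q -> 0 <= X -> 0 <= z ->
  q * (X * (z / (3 * q * (X + 1)))) <= z / 3.
Proof.
move=> q0 X0 z0; have X1 : 0 < X + 1 by rewrite ltr_wpDl.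
have -> : q * (X * (z / (3 * q * (X + 1)))) = z / 3 * (X / (X + 1)).
  by field; rewrite !gt_eqF.
by rewrite ler_piMr ?divr_ge0// ler_pdivrMr// mul1r lerDl.
Qed.

Variable k : nat.
Variable adj : rel 'I_k.

(** The weights come from [t] at a level i where the limit kernel is almost a step function. For
    [F]-many n, V n is close in cut norm to its averages at a much finer level N1 + i, these are
    close in L1 to its averages at level i, and the latter have almost the limit masses and
    densities; then [til_transferred] applies. The allowance [rho] is shared between the
    small-density cut-off, the counting errors, and the deletion and rescaling of overloaded
    vertices. *)
Lemma til_lim_kernel_near (t : ('I_k -> Omega) -> R) (C0 rho : R) : 0 < rho ->
  btiling nu adj Vh t -> (forall x, t x <= C0 * Wtensor adj Vh x) ->
  \forall n \near F, ((kint nu t)%:E <= til nu adj (V n) + rho%:E)%E.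
Proof.
move=> rho0 [bt t0 tW tm] tC0.
have gVh : graphon Vh := graphon_lim_kernel atomless_nu UF gV mc0.
have uVh := graphon_unit gVh.
pose s := edges adj; pose C := `|C0|.
have C_ge0 : 0 <= C by exact: normr_ge0.
have tC x : t x <= C * hom_density s Vh x.
  rewrite -Wtensor_edges (le_trans (tC0 x))// ler_wpM2r ?ler_norm//.
  exact: Wtensor_ge0.
have It0 : 0 <= kint nu t by exact: kint_ge0.
have ItC : kint nu t <= C.
  rewrite -[leRHS](kint_cst nu k); apply: kint_le => //; first exact: bm_cst.
  move=> x; rewrite (le_trans (tC x))// ler_piMr//.
  by have [_ /(_ x)/andP[]] := unit_hom_density s uVh.
pose a := rho / 4 / (2 + C).
have C2 : 0 < 2 + C by rewrite ltr_wpDr.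
have a0 : 0 < a by rewrite !divr_gt0.
pose r := Num.min 1 a.
have r0 : 0 < r by rewrite lt_min ltr01.
have r1 : r <= 1 by rewrite ge_min lexx.
have rC : r * (2 + C) <= rho / 4.
  by rewrite -ler_pdivlMr// ge_min lexx orbT.
have rr : r ^+ 2 <= r by rewrite expr2 ler_piMl// ltW.
(* [zeta] bounds q = k+1 times the whole counting error; each of its three terms receives one third
   ([fraction_bound]). *)
pose zeta := Num.min (r ^+ 2) (rho / 4).
have zeta0 : 0 < zeta by rewrite lt_min exprn_gt0// divr_gt0.
pose beta := rho / 8 / (C + 1).
have C1 : 0 < C + 1 by rewrite ltr_wpDl.
have beta0 : 0 < beta by rewrite !divr_gt0.
have Cbeta : C * beta <= rho / 8.
  by rewrite /beta mulrCA ler_piMr ?divr_ge0 ?(ltW rho0)// ler_pdivrMr// mul1r lerDl.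
pose B := C / beta.
have B0 : 0 <= B by rewrite divr_ge0// ltW.
pose sz : R := (size s)%:R.
have sz0 : 0 <= sz by exact: ler0n.
pose q : R := k%:R + 1.
have q0 : 0 < q by rewrite ltr_wpDl.
pose delta := zeta / (3 * q * (B * sz + 1)).
have Bsz0 : 0 <= B * sz by exact: mulr_ge0.
have delta0 : 0 < delta by rewrite divr_gt0// !mulr_gt0// ltr_wpDl.
(* The first bound controls the loss in [gamma_size]; the second makes the energy gained beyond
   level i at most delta^2/2 in the limit, hence at most delta^2 for [F]-many n. *)
pose e := Num.min (rho / 8 / (C * sz + 1)) (delta ^+ 2 / 2).
have Csz0 : 0 <= C * sz by exact: mulr_ge0.
have Csz1 : 0 < C * sz + 1 by rewrite ltr_wpDl.
have e0 : 0 < e by rewrite lt_min !divr_gt0//= exprn_gt0.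
have [i [hi gapi]] := lim_kernel_approx atomless_nu UF gV mc0 e0.
have ml : label_measurable (ll i) := @llab_measurable _ _ _ _ atomless_nu _ _ UF gV _ _ mc0 i.
have Dl01 x y : 0 <= Dl i x y <= 1 by exact: (ldens01 nu UF gV mc0).
pose words := {ffun 'I_k -> ltype T0 i}.
pose N : R := #|{: words}|%:R.
have N0 : 0 <= N by exact: ler0n.
(* The number of patterns is known only once the level i is fixed, so [kappa] and [e1] are chosen
   after it. *)
pose kappa := zeta / (3 * q * (N * B * sz + 1)).
have NBsz0 : 0 <= N * B * sz := mulr_ge0 (mulr_ge0 N0 B0) sz0.
have kappa0 : 0 < kappa by rewrite divr_gt0// !mulr_gt0// ltr_wpDl.
pose e1 := zeta / (3 * q * (N * B + 1)).
have NB0 : 0 <= N * B by rewrite mulr_ge0.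
have e10 : 0 < e1 by rewrite divr_gt0// !mulr_gt0// ltr_wpDl.
pose g := gamma nu s (ll i) (Dl i) t beta.
have g0B w : 0 <= g w <= B by apply: (gamma_bounds nu ml (Dl i) uVh bt t0 tC C_ge0 beta0).
have kap8 : 0 < kappa ^+ 2 / 8 by rewrite divr_gt0// exprn_gt0.
have [N1 hN1] := lenergy_cauchy nu UF gV mc0 kap8.
(* At level N1 + i a single further refinement gains at most kappa^2/8 in the limit, so at most
   kappa^2/4 for [F]-many n, as [ncut] requires. *)
have gapj := hN1 (N1 + i)%N 1%N (leq_addr _ _).
have near1 := nenergy_gap (m := 1) kap8 gapj.
have d2 : 0 < delta ^+ 2 / 2 by rewrite divr_gt0// exprn_gt0.
have gapi' : en (N1 + i) - en i <= delta ^+ 2 / 2.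
  by rewrite (le_trans (gapi N1))// ge_min lexx orbT.
have near2 := nenergy_gap d2 gapi'.
have near3 : \forall n \near F, forall w : words,
    `|word_density s (Dn n i) w * \prod_v pn n i (w v) -
      word_density s (Dl i) w * \prod_v mass nu (ll i) (w v)| <= e1.
  apply: filter_forall => w.
  have /cvgrPdist_le/(_ _ e10) := @word_density_cvg k s i xpredT w.
  by apply: filterS => n /=; rewrite distrC.
have near4 : \forall n \near F, forall (wl : words * 'I_k),
    `|word_density s (Dn n i) wl.1 * \prod_(v | v != wl.2) pn n i (wl.1 v) -
      word_density s (Dl i) wl.1 * \prod_(v | v != wl.2) mass nu (ll i) (wl.1 v)| <= e1.
  apply: filter_forall => wl.
  have /cvgrPdist_le/(_ _ e10) := @word_density_cvg k s i (fun v => v != wl.2) wl.1.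
  by apply: filterS => n /=; rewrite distrC.
apply: filterS (filterI (filterI near1 near2) (filterI near3 near4)) =>
  n [[/= h1 h2] [/= h3 h4]].
have VK : cut_bounded nu (fun x y => V n x y - avg nu (nl n (N1 + i)) (V n) x y) kappa.
  by apply: ncut; [exact: ltW | apply: le_trans h1 _; lra].
have KD : E2 nu (fun x y => `|avg nu (nl n (N1 + i)) (V n) x y -
    Dn n i (nl n i x) (nl n i y)|) <= delta.
  rewrite -(ler_pXn2r (n := 2%N)) ?nnegrE ?(ltW delta0)//; last exact: E2_ge0.
  by apply: (le_trans (navg_dist n N1 i)); lra.
have Dn01 x y : 0 <= Dn n i x y <= 1 by exact: dens_bounds.
have uK : unit_bm2 (avg nu (nl n (N1 + i)) (V n)) by exact: unit_avg.
pose E := N * B * e1 + (N * B * sz * kappa + B * sz * delta).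
have qE : q * E <= zeta.
  have f1 := fraction_bound q0 NB0 (ltW zeta0).
  have f2 := fraction_bound q0 NBsz0 (ltW zeta0).
  have f3 := fraction_bound q0 Bsz0 (ltW zeta0).
  rewrite -/e1 in f1; rewrite -/kappa in f2; rewrite -/delta in f3.
  rewrite /E !mulrDr; lra.
have E0 : 0 <= E.
  by apply: addr_ge0; [|apply: addr_ge0]; apply: mulr_ge0 => //; exact: ltW.
have kE : k%:R * E <= r ^+ 2.
  have : k%:R * E <= q * E by rewrite ler_wpM2r// lerDl.
  have : zeta <= r ^+ 2 by rewrite ge_min lexx.
  lra.
have Erho : E <= rho / 4.
  have : E <= q * E by rewrite ler_peMl// lerDr.
  have : zeta <= rho / 4 by rewrite ge_min lexx orbT.
  lra.
pose A (w : words) := word_density s (Dl i) w * \prod_v mass nu (ll i) (w v).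
pose A' (w : words) (l : 'I_k) :=
  word_density s (Dl i) w * \prod_(v | v != l) mass nu (ll i) (w v).
have := til_transferred (mnl n i) Dn01 (gV n) uK VK KD g0B (A := A) (A' := A') r0 h3
  (fun w l => h4 (w, l)) (gamma_marg ml (Dl i) uVh bt t0 tC tm C_ge0 beta0) kE.
rewrite -/N -/E => htil.
have hS : kint nu t - C * (beta + sz * e) <= \sum_w g w * A w.
  apply: le_trans (gamma_size (@edges_lt k adj) ml Dl01 uVh bt t0 tC C_ge0 beta0 hi) _.
  by apply: ler_sum => w _; rewrite /A [X in _ * X <= _]mulrC.
have hCe : C * sz * e <= rho / 8.
  apply: (@le_trans _ _ (C * sz * (rho / 8 / (C * sz + 1)))).
    by rewrite ler_wpM2l// ge_min lexx.
  by rewrite mulrCA ler_piMr ?divr_ge0 ?(ltW rho0)// ler_pdivrMr// mul1r lerDl.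
have h5 : C * (beta + sz * e) <= rho / 4.
  have -> : rho / 4 = rho / 8 + rho / 8 by field.
  by rewrite mulrDr (mulrA C sz e); apply: lerD.
have {}hS : kint nu t - rho / 4 <= \sum_w g w * A w by rewrite (le_trans _ hS)// lerB.
apply: le_trans (leeD2r _ htil); rewrite -EFinD lee_fin -lerBlDr.
have r1' : 0 < 1 + r by rewrite addr_gt0.
rewrite ler_pdivlMr//.
have x1 : kint nu t * r <= C * r by rewrite ler_wpM2r// ltW.
have x2 : 0 <= rho * r by rewrite mulr_ge0 ?ltW.
have -> : (kint nu t - rho) * (1 + r) = kint nu t - rho + kint nu t * r - rho * r by ring.
move: rC; rewrite mulrDr [r * C]mulrC => rC.
rewrite /transfer_error -/sz -/N -/E.
have arith (S x1' c y r2 E' kint' rho' r' : R) : kint' - rho' / 4 <= S -> x1' <= c -> 0 <= y ->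
    r' * 2 + c <= rho' / 4 -> E' <= rho' / 4 -> r2 <= r' -> 0 < rho' ->
    kint' - rho' + x1' - y <= S - E' - r' - r2 by lra.
exact: (arith _ _ _ _ _ _ _ _ _ hS x1 x2 rC Erho rr rho0).
Qed.

End LowerSemicontinuity.

(** * Comparing the limit kernel with W *)

Section LowerBound.
Context (d : measure_display) (Omega : measurableType d) (R : realType).
Variable nu : probability Omega R.
Hypothesis atomless_nu : atomless nu.
Variables (F : set_system nat) (V : nat -> Omega -> Omega -> R).
Hypotheses (UF : UltraFilter F) (gV : forall n, graphon (V n)).
Variables (T0 : finType) (c0 : Omega -> T0).
Hypothesis mc0 : label_measurable c0.

Local Notation nl n i := (@nlab d Omega R nu V T0 c0 n i).
Local Notation pn n i := (mass nu (nl n i)).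
Local Notation Dn n i := (dens nu (nl n i) (V n)).
Local Notation pl i := (@lmass d Omega R nu F V T0 c0 i).
Local Notation Dl i := (@ldens d Omega R nu F V T0 c0 i).
Local Notation ll i := (@llab d Omega R nu F V T0 c0 i).
Local Notation Vh := (lim_kernel nu UF gV mc0).

Let PF : ProperFilter F. Proof. exact: ultra_proper. Qed.

Let uV n : unit_bm2 (V n). Proof. exact: graphon_unit. Qed.

Fixpoint lbase i : ltype T0 i -> T0 :=
  match i with 0 => fun a => a | i'.+1 => fun a => lbase (i := i') a.1 end.

Lemma nlab_base n i x : lbase (nl n i x) = c0 x.
Proof. by elim: i => //= i; apply. Qed.

Lemma llab_base i x : lbase (ll i x) = c0 x.
Proof. by elim: i => //= i; apply. Qed.

Variables (W : Omega -> Omega -> R) (Wn : nat -> Omega -> Omega -> R) (eps : R).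
Hypotheses (gW : graphon W) (gWn : forall n, graphon (Wn n)).
Hypothesis VW : forall n x y, V n x y <= Wn n x y.
Hypothesis VWeps : forall n, E2 nu (Wn n) - E2 nu (V n) <= eps.
Hypothesis cutWn : forall e, 0 < e ->
  \forall n \near F, cut_bounded nu (fun x y => Wn n x y - W x y) e.
Variables (f0 : T0 -> T0 -> R) (delta : R).
Hypothesis delta0 : 0 < delta.
Hypothesis Wf0 : E2 nu (fun x y => `|W x y - f0 (c0 x) (c0 y)|) <= delta.

Let bW := graphon_bm2 gW.
Let bWn n := graphon_bm2 (gWn n).
Let bV n := graphon_bm2 (gV n).
Let bf0 : bm2 (fun x y => f0 (c0 x) (c0 y)) := bm2_label f0 mc0.
Let bll i : label_measurable (ll i) := @llab_measurable _ _ _ _ atomless_nu _ _ UF gV _ _ mc0 i.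
Let bnl n i : label_measurable (nl n i) := @nlab_measurable _ _ _ nu V gV T0 c0 mc0 n i.

Let step_cvg i (chi : ltype T0 i -> ltype T0 i -> R) (h : ltype T0 i -> ltype T0 i -> R) :
  \sum_a \sum_b pn n i a * pn n i b * ((Dn n i a b - h a b) * chi a b) @[n --> F] -->
  \sum_a \sum_b mass nu (ll i) a * mass nu (ll i) b * ((Dl i a b - h a b) * chi a b).
Proof.
have cp a : pn n i a @[n --> F] --> mass nu (ll i) a.
  by rewrite (llab_mass atomless_nu UF gV mc0); exact: (lmass_cvg UF gV mc0).
apply: (cvg_fsum UF) => a; apply: (cvg_fsum UF) => b.
apply: cvgM; first by apply: cvgM; exact: cp.
apply: cvgM; last exact: cvg_cst.
by apply: cvgB; [exact: (ldens_cvg UF gV mc0) | exact: cvg_cst].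
Qed.

Let step_n i n (chi h : ltype T0 i -> ltype T0 i -> R) :
  \sum_a \sum_b pn n i a * pn n i b * ((Dn n i a b - h a b) * chi a b) =
  E2 nu (fun x y => (V n x y - h (nl n i x) (nl n i y)) * chi (nl n i x) (nl n i y)).
Proof.
have mc := @bnl n i.
have -> : (fun x y => (V n x y - h (nl n i x) (nl n i y)) * chi (nl n i x) (nl n i y)) =
   (fun x y => V n x y * chi (nl n i x) (nl n i y) -
     (fun a b => h a b * chi a b) (nl n i x) (nl n i y)).
  by apply/funext => x; apply/funext => y; rewrite mulrBl.
rewrite E2B; last 2 first.
- exact: (bmM (bV n) (bm2_label chi mc)).
- exact: (bm2_label (fun a b => h a b * chi a b) mc).
rewrite (E2_step nu mc (uV n)) (E2_label nu (fun a b => h a b * chi a b) mc).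
rewrite -sumrB; apply: eq_bigr => a _; rewrite -sumrB; apply: eq_bigr => b _.
by ring.
Qed.

(** The total mass of V n converges to that of the step kernel, the one of Wn converges to that of W
    (a cut test on all of Omega), and V n misses at most [eps] of Wn. *)
Lemma E2_lkernel_ge i : E2 nu W - eps <= E2 nu (lkernel nu F V c0 i).
Proof.
have := @step_cvg i (fun _ _ => 1) (fun _ _ => 0).
have -> : \sum_a \sum_b mass nu (ll i) a * mass nu (ll i) b * ((Dl i a b - 0) * 1) =
    E2 nu (lkernel nu F V c0 i).
  rewrite (E2_label nu (Dl i) (@bll i)).
  by apply: eq_bigr => a _; apply: eq_bigr => b _; rewrite subr0 mulr1.
move=> cE; apply/ler_addgt0Pr => e e0.
rewrite -lerBlDr; apply: (cvgr_to_ge cE).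
apply: filterS (cutWn e0) => n /(_ setT setT measurableT measurableT) cn.
rewrite step_n (_ : (fun x y => _) = V n); last first.
  by apply/funext => x; apply/funext => y; rewrite subr0 mulr1.
have hE : E2 nu (fun x y => (Wn n x y - W x y) * (\1_[set: Omega] x * \1_[set: Omega] y)) =
    E2 nu (Wn n) - E2 nu W.
  rewrite -E2B//; congr E2; apply/funext => x; apply/funext => y.
  by rewrite !indicE !in_setT !mulr1.
move: cn; rewrite hE ler_norml => /andP[cn _].
have := VWeps n; lra.
Qed.

(** V n lies below Wn, and a step function cannot distinguish Wn from W in the limit. The blocks
    where the limit density is at least [f0] form a fixed set of label pairs; testing V n - f0 on
    these pairs for each n and passing to the limit gives the integral of the positive part. One
    [delta] pays for Wn - W, the other for W - f0. *)
Lemma E2_lkernel_excess i : E2 nu (fun x y =>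
  Num.max (lkernel nu F V c0 i x y - f0 (c0 x) (c0 y)) 0) <= 2 * delta.
Proof.
pose h (a b : ltype T0 i) : R := f0 (lbase a) (lbase b).
pose chi (a b : ltype T0 i) : R := (h a b <= Dl i a b)%R%:R.
have -> : (fun x y => Num.max (lkernel nu F V c0 i x y - f0 (c0 x) (c0 y)) 0) =
    (fun x y => (fun a b => (Dl i a b - h a b) * chi a b) (ll i x) (ll i y)).
  apply/funext => x; apply/funext => y; rewrite /lkernel /chi /h !llab_base.
  case: (leP (f0 _ _) (Dl i _ _)) => hf; rewrite ?mulr1 ?mulr0.
    by rewrite max_l// subr_ge0.
  by rewrite max_r// subr_le0 ltW.
rewrite (E2_label nu (fun a b => (Dl i a b - h a b) * chi a b) (@bll i)).
apply: (cvgr_to_le (@step_cvg i chi h)).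
pose S := \sum_(a : ltype T0 i) \sum_(b : ltype T0 i) `|chi a b|.
have S0 : 0 <= S by apply: sumr_ge0 => a _; apply: sumr_ge0.
have S1 : 0 < S + 1 by rewrite ltr_wpDl.
have e0 : 0 < delta / (S + 1) by rewrite divr_gt0.
apply: filterS (cutWn e0) => n cn; rewrite step_n.
have mc := @bnl n i.
have bchi := bm2_label chi mc.
have chi01 a b : 0 <= chi a b <= 1 by rewrite /chi ler0n lern1 leq_b1.
have bD : bm2 (fun x y => Wn n x y - W x y) := bmB (bWn n) bW.
have b1 := bmM bD bchi.
have b2 := bm_norm (bmB bW bf0).
apply: (@le_trans _ _ (E2 nu (fun x y => (Wn n x y - W x y) * chi (nl n i x) (nl n i y)) +
   E2 nu (fun x y => `|W x y - f0 (c0 x) (c0 y)|))).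
  rewrite -E2D; [|exact: b1|exact: b2]; apply: E2_le.
  - apply: (bmM _ bchi); apply: (bmB (bV n)); exact: (bm2_label h mc).
  - exact: (bmD b1 b2).
  move=> x y; rewrite /h !nlab_base.
  have /andP[c1 c2] := chi01 (nl n i x) (nl n i y).
  apply: (@le_trans _ _ ((Wn n x y - W x y) * chi (nl n i x) (nl n i y) +
      (W x y - f0 (c0 x) (c0 y)) * chi (nl n i x) (nl n i y))).
    by rewrite -mulrDl ler_wpM2r// addrA subrK lerD2r.
  by rewrite lerD2l (le_trans (ler_norm _))// normrM ler_piMr// ger0_norm.
have -> : 2 * delta = delta + delta by ring.
apply: lerD => //; rewrite (le_trans (ler_norm _))//.
rewrite (le_trans (cut_bounded_label chi bD mc cn))// -/S.
by rewrite mulrCA ler_piMr ?(ltW delta0)// ler_pdivrMr// mul1r lerDl.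
Qed.

(** The positive part of W - Vh. Removing it from W leaves min(Vh, W), which vanishes wherever Vh
    does. *)
Definition residual x y : R := W x y - Num.min (Vh x y) (W x y).

Lemma graphon_residual : graphon residual.
Proof.
have gVh := graphon_lim_kernel atomless_nu UF gV mc0.
have [sVh Vh01 mVh] := gVh; have [sW W01 mW] := gW.
apply: graphonB => //; last by move=> x y; rewrite ge_min lexx orbT.
split.
- by move=> x y; rewrite sVh sW.
- move=> x y; have /andP[v0 v1] := Vh01 x y; have /andP[w0 w1] := W01 x y.
  by rewrite le_min v0 w0 /= ge_min v1.
- by have [] : bm2 (fun x y => Num.min (Vh x y) (W x y)) by
    exact: (bm_min (graphon_bm2 gVh) bW).
Qed.

(** The positive part of W - Vh is W - Vh plus the positive part of Vh - W. The mass of the first is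
    bounded through [E2_lkernel_ge] and that of the second through [E2_lkernel_excess]; replacing Vh
    by a step kernel costs [delta] twice and replacing W by [f0] once, which with the excess 2 *
    delta makes 5 * delta. *)
Lemma E2_residual : E2 nu residual <= eps + 5 * delta.
Proof.
have gVh := graphon_lim_kernel atomless_nu UF gV mc0.
have bVh := graphon_bm2 gVh.
have [i [hi _]] := lim_kernel_approx atomless_nu UF gV mc0 delta0.
have bi : bm2 (lkernel nu F V c0 i) by case: (unit_lkernel atomless_nu UF gV mc0 i).
have bd1 := bm_norm (bmB bVh bi).
have bd2 := bm_norm (bmB bW bf0).
have bmx := bm_max (bmB bi bf0) (bm_cst (0 : R)).
have bx := bmD (bmD bd1 bmx) bd2.
have bWi := bmB bW bi.
have ptw x y : residual x y <= (W x y - lkernel nu F V c0 i x y) +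
    ((`|Vh x y - lkernel nu F V c0 i x y| +
      Num.max (lkernel nu F V c0 i x y - f0 (c0 x) (c0 y)) 0) +
      `|W x y - f0 (c0 x) (c0 y)|) + `|Vh x y - lkernel nu F V c0 i x y|.
  rewrite /residual; set v := Vh x y; set u := lkernel _ _ _ _ _ _ _; set w := W x y.
  set f := f0 _ _.
  have n1 := ler_norm (v - u); have n2 := ler_norm (u - v); rewrite distrC in n2.
  have n3 := ler_norm (w - f); have n4 := ler_norm (f - w); rewrite distrC in n4.
  have m1 : u - f <= Num.max (u - f) 0 by rewrite le_max lexx.
  have m2 : 0 <= Num.max (u - f) 0 by rewrite le_max lexx orbT.
  by case: (leP v w) => vw; lra.
apply: (@le_trans _ _ ((E2 nu W - E2 nu (lkernel nu F V c0 i)) + ((delta + 2 * delta) + delta) + delta)); last first.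
  by have := E2_lkernel_ge i; lra.
apply: (@le_trans _ _ (E2 nu (fun x y => (W x y - lkernel nu F V c0 i x y) +
    ((`|Vh x y - lkernel nu F V c0 i x y| +
      Num.max (lkernel nu F V c0 i x y - f0 (c0 x) (c0 y)) 0) +
      `|W x y - f0 (c0 x) (c0 y)|) + `|Vh x y - lkernel nu F V c0 i x y|))).
  apply: E2_le => //; first exact: (graphon_bm2 graphon_residual).
  exact: (bmD (bmD bWi bx) bd1).
have sumE (G1 G2 G3 G4 : Omega -> Omega -> R) : bm2 G1 -> bm2 G2 -> bm2 G3 -> bm2 G4 ->
    E2 nu (fun x y => G1 x y + ((G2 x y + G3 x y) + G4 x y) + G2 x y) =
    E2 nu G1 + ((E2 nu G2 + E2 nu G3) + E2 nu G4) + E2 nu G2.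
  move=> b1 b2 b3 b4; rewrite -(E2D nu b2 b3).
  have b23 : bm2 (fun x y => G2 x y + G3 x y) := bmD b2 b3.
  rewrite -(E2D nu b23 b4).
  have b234 : bm2 (fun x y => G2 x y + G3 x y + G4 x y) := bmD b23 b4.
  rewrite -(E2D nu b1 b234).
  have b5 : bm2 (fun x y => G1 x y + (G2 x y + G3 x y + G4 x y)) := bmD b1 b234.
  by rewrite -(E2D nu b5 b2).
rewrite (sumE (fun x y => W x y - lkernel nu F V c0 i x y)
  (fun x y => `|Vh x y - lkernel nu F V c0 i x y|)
  (fun x y => Num.max (lkernel nu F V c0 i x y - f0 (c0 x) (c0 y)) 0)
  (fun x y => `|W x y - f0 (c0 x) (c0 y)|) bWi bd1 bmx bd2).
rewrite (E2B nu bW bi); apply: lerD => //; rewrite lerD2l; apply: lerD => //.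
by apply: lerD => //; exact: E2_lkernel_excess.
Qed.

End LowerBound.

(** * Lower semicontinuity, degenerate cases and conclusion *)

Section Continuity.
Context (d : measure_display) (Omega : measurableType d) (R : realType).
Variable nu : probability Omega R.
Hypothesis atomless_nu : atomless nu.
Variable k : nat.
Variable adj : rel 'I_k.
Implicit Types W U : Omega -> Omega -> R.

Lemma graphon0 : graphon (fun _ _ : Omega => 0 : R).
Proof.
split; [by [] | by move=> x y; rewrite lexx ler01 | exact: measurable_cst].
Qed.

(** By contradiction. Along an ultrafilter on the bad indices, the kernels Wn - Un have tiling
    numbers below that of W by more than [e]; hence so has their limit kernel up to equality, and so
    has min(Vh, W), which is W minus a kernel of norm at most eps + eta. By [slack] the norm returns
    below eps at the price e/2, less than the gap [e]. *)
Lemma til_eps_lower W (Wn : nat -> Omega -> Omega -> R) (eps e : R) :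
  0 < eps -> 0 < e -> graphon W -> (forall n, graphon (Wn n)) ->
  cutnorm nu (fun x y => Wn n x y - W x y) @[n --> \oo] --> 0%E ->
  til_eps nu eps adj W \is a fin_num ->
  \forall n \near \oo, (til_eps nu eps adj W <= til_eps nu eps adj (Wn n) + e%:E)%E.
Proof.
move=> eps0 e0 gW gWn cW finW.
pose P := [set n | ~ (til_eps nu eps adj W <= til_eps nu eps adj (Wn n) + e%:E)%E].
apply: contrapT => notnear.
(* The bad indices are met by every tail, so the tails restricted to [P] generate a proper filter,
   which extends to an ultrafilter containing [P]. *)
have PG : ProperFilter (within P \oo).
  apply: Build_ProperFilter_ex => A; rewrite /within/= => PA.
  apply: contrapT => nA; apply: notnear; apply: filterS PA => n /= PnA.
  by apply: contrapT => Pn; apply: nA; exists n; exact: PnA.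
have [F [UF GF]] := ultraFilterLemma PG.
have FP : F P by apply: GF; exact: nearW.
have Foo A : (\forall n \near \oo, A n) -> \forall n \near F, A n.
  by move=> hA; apply: GF; apply: filterS hA => n An _.
have PF : ProperFilter F by exact: ultra_proper.
have /choice[U HU] : forall n, exists U, [/\ graphon U, forall x y, U x y <= Wn n x y,
    E2 nu U <= eps & P n -> (til nu adj (fun x y => (Wn n x y - U x y)%R) + e%:E <
      til_eps nu eps adj W)%E].
  move=> n; have [Pn|nPn] := pselect (P n); last first.
    (* Outside [P] any admissible kernel will do; it only makes the sequence total. *)
    exists (fun _ _ => 0); split => //.
    - exact: graphon0.
    - by move=> x y; have [_ /(_ x y)/andP[]] := gWn n.
    - by rewrite E2_cst ltW.
  have : (til_eps nu eps adj (Wn n) < til_eps nu eps adj W - e%:E)%E.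
    by rewrite lteBrDr// ltNge; apply/negP.
  move=> /ereal_inf_lt[_ [U [gU [UW Ueps]] <-] hU].
  exists U; split => //; first by move: Ueps; rewrite L1norm_E2// lee_fin.
  by rewrite -lteBrDr.
pose V n x y := Wn n x y - U n x y.
have gU n : graphon (U n) by case: (HU n).
have gV n : graphon (V n) by apply: graphonB => //; case: (HU n).
have [N hN] := ex_inv_le (divr_gt0 e0 (ltr0n R 2 : 0 < 2%:R)).
pose eta := eps / (4 * N.+1%:R).
have eta0 : 0 < eta by rewrite divr_gt0// mulr_gt0// ltr0n.
pose delta := eta / 5.
have delta0 : 0 < delta by rewrite divr_gt0.
have [T0 [c0 [f0 [mc0 Wf0]]]] := step_approx_unit nu (graphon_unit gW) delta0.
have bD n : bm2 (fun x y => Wn n x y - W x y).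
  exact: (bmB (graphon_bm2 (gWn n)) (graphon_bm2 gW)).
have cutWn r : 0 < r -> \forall n \near F, cut_bounded nu (fun x y => Wn n x y - W x y) r.
  by move=> r0; apply: Foo; exact: cutnorm_cvg0.
have VWeps n : E2 nu (Wn n) - E2 nu (V n) <= eps.
  rewrite /V E2B; [|exact: graphon_bm2|exact: graphon_bm2].
  by case: (HU n) => _ _ + _; lra.
have VW n x y : V n x y <= Wn n x y.
  by rewrite lerBlDr lerDl; have [_ /(_ x y)/andP[]] := gU n.
pose U0 := residual nu UF gV mc0 W.
have gU0 : graphon U0 by exact: graphon_residual.
have U0W x y : U0 x y <= W x y.
  rewrite /U0 /residual lerBlDr lerDl.
  have [_ /(_ x y)/andP[v0 _] _] := graphon_lim_kernel atomless_nu UF gV mc0.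
  by have [_ /(_ x y)/andP[w0 _] _] := gW; rewrite le_min v0 w0.
have U0eps : E2 nu U0 <= eps + eta.
  have -> : eta = 5 * delta by rewrite /delta; field.
  exact: (E2_residual atomless_nu UF gV mc0 gW gWn VW VWeps cutWn delta0 Wf0).
have [U' [gU' U'W U'eps tU']] := slack atomless_nu adj gW gU0 U0W eps0 U0eps.
have tilU0 : (til nu adj (fun x y => (W x y - U0 x y)%R) <= til_eps nu eps adj W - e%:E)%E.
  apply: (@le_trans _ _ (til nu adj (lim_kernel nu UF gV mc0))).
    apply: eq_le_til => x y; apply: contra => /eqP v0.
    rewrite /U0 /residual v0 subr_eq0; apply/eqP.
    have [_ /(_ x y)/andP[w0 _] _] := gW.
    by rewrite (min_l w0) subr0.
  apply: til_le; first exact: graphon_lim_kernel.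
  move=> t C bt tC; apply/lee_addgt0Pr => rho rho0.
  have /(filterI FP)/filter_ex[n [Pn hn]] :=
    til_lim_kernel_near atomless_nu rho0 bt tC.
  apply: (le_trans hn); rewrite leeD2r// leeBrDr//.
  by have [_ _ _ /(_ Pn)/ltW] := HU n.
have : (til_eps nu eps adj W <= til_eps nu eps adj W - e%:E + (e / 2)%:E)%E.
  apply: (@le_trans _ _ (til nu adj (fun x y => (W x y - U' x y)%R))).
    apply: ereal_inf_lbound; exists U' => //; split => //; split => //.
    by rewrite L1norm_E2// lee_fin (le_trans U'eps)// lerBlDr lerDl ltW.
  by apply: (le_trans tU'); apply: leeD => //; rewrite lee_fin.
rewrite -(fineK finW) -EFinB -EFinD lee_fin; lra.
Qed.

Lemma til_ge0 W : (0 <= til nu adj W)%E.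
Proof.
have BT : btiling nu adj W (fun=> 0).
  split => //; first exact: bm_cst.
    by move=> x; rewrite eqxx.
  by move=> x; rewrite big1// => l _; rewrite /marg rint_cst.
by have := kint_le_til BT; rewrite kint_cst.
Qed.

(** The size of a tiling is the integral of its load in one coordinate, which is at most 1
    everywhere; this needs a coordinate to exist. *)
Lemma til_le1 W : (0 < k)%N -> graphon W -> (til nu adj W <= 1)%E.
Proof.
move=> k0 gW; apply: til_le => // t C [bt t0 tW tm] _.
pose l0 := Ordinal k0.
have h := Ex_marg nu l0 (bm_cst (1 : R)) bt.
have -> : kint nu t = kint nu (fun y => 1 * t y) by congr kint; apply/funext => y; rewrite mul1r.
rewrite -h lee_fin; apply: Ex_le1.
  by apply: bmM; [exact: bm_cst | exact: bm_marg].
move=> x; rewrite mul1r; apply: le_trans (tm x).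
by rewrite (bigD1 l0)//= lerDl sumr_ge0// => l _; exact: marg_ge0.
Qed.

Lemma til_eps_fin W (eps : R) : (0 < k)%N -> 0 < eps -> graphon W ->
  til_eps nu eps adj W \is a fin_num.
Proof.
move=> k0 eps0 gW.
have g0 : graphon (fun _ _ : Omega => 0 : R) by exact: graphon0.
have W0 x y : 0 <= W x y by have [_ /(_ x y)/andP[]] := gW.
rewrite fin_real//; apply/andP; split.
  apply: (@lt_le_trans _ _ 0%E); first exact: ltNy0.
  by apply: le_ereal_inf_tmp => _ [U _ <-]; exact: til_ge0.
apply: (@le_lt_trans _ _ 1%E); last exact: ltry.
apply: (@le_trans _ _ (til nu adj (fun x y => W x y - 0))).
  apply: ereal_inf_lbound; exists (fun _ _ => 0) => //; split => //; split => //.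
  by rewrite L1norm_E2// E2_cst lee_fin ltW.
by apply: til_le1 => //; exact: graphonB.
Qed.

(** For the empty graph the F-density is the empty product 1 and no load is constrained, so [til]
    does not depend on the kernel. Its value is then infinite, so this case is kept apart from the
    argument with finite values. *)
Lemma til_eps_empty W W' (eps : R) : k = 0%N -> 0 < eps -> graphon W -> graphon W' ->
  (til_eps nu eps adj W <= til_eps nu eps adj W')%E.
Proof.
move=> k0 eps0 gW gW'; apply: le_ereal_inf_tmp => _ [U _ <-].
have tE V V' : (til nu adj V <= til nu adj V')%E.
  apply: ge_ereal_sup => _ [t [mt t0 tV tm] <-].
  apply: ereal_sup_ubound; exists t => //; split => // x _.
  rewrite /Wtensor big1 ?oner_neq0// => i _.
  by exfalso; case: i => i; rewrite k0.
apply: le_trans (tE (fun x y => W x y - 0) _).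
apply: ereal_inf_lbound; exists (fun _ _ => 0) => //; split; first exact: graphon0.
split; first by move=> x y; have [_ /(_ x y)/andP[]] := gW.
by rewrite L1norm_E2 ?E2_cst ?lee_fin ?ltW//; exact: graphon0.
Qed.

End Continuity.

Theorem theorem3p10 (d : measure_display) (Omega : measurableType d)
    (R : realType) (nu : probability Omega R)
    (k : nat) (adj : rel 'I_k) (eps : R)
    (W : Omega -> Omega -> R) (Wn : nat -> Omega -> Omega -> R) :
  standard_borel Omega R ->
  atomless nu ->
  symmetric adj -> irreflexive adj ->
  0 < eps ->
  graphon W -> (forall n, graphon (Wn n)) ->
  cutnorm nu (fun x y => Wn n x y - W x y) @[n --> \oo] --> 0%E ->
  til_eps nu eps adj (Wn n) @[n --> \oo] --> til_eps nu eps adj W.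
Proof.
move=> _ anu _ _ eps0 gW gWn cW.
have [k0|k0] := posnP k.
  rewrite (_ : (fun n => til_eps nu eps adj (Wn n)) = cst (til_eps nu eps adj W)).
    exact: cvg_cst.
  apply/funext => n; apply/eqP; rewrite eq_le.
  by apply/andP; split; exact: til_eps_empty.
have finW := til_eps_fin nu adj k0 eps0 gW.
have finWn n := til_eps_fin nu adj k0 eps0 (gWn n).
rewrite -(fineK finW); apply/fine_cvgP; split; first exact: nearW.
apply/cvgrPdist_le => e e0.
have up := til_eps_upper anu eps0 e0 gW gWn cW finW.
have lo := til_eps_lower anu eps0 e0 gW gWn cW finW.
apply: filterS2 up lo => n /=.
rewrite -(fineK finW) -(fineK (finWn n)) -!EFinD !lee_fin => h1 h2.
by rewrite ler_norml; apply/andP; split; lra.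
Qed.
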